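(* Let $R$ be the exponential map for $\mathcal{M}$. Suppose that the loss $L$ satisfies: for every $y\in\mathcal{S}_y=\{y:(x,y)\in\mathcal{S}\}$, $L(\cdot,y)$ is smooth, $\mu$-strongly convex, with $\kappa_L$-Lipschitz gradient and $\kappa_H$-Lipschitz Hessian, i.e. $$\mu I\preceq\nabla^2_{zz}L(z,y)\preceq\kappa_LI,\qquad \|\nabla^2_{zz}L(z,y)-\nabla^2_{zz}L(x,y)\|\le\kappa_H\|z-x\|,\quad\forall z,x\in\mathbb{R}^q,$$ and $F_L(x,\theta)=\nabla^2_{zz}L(z,y)|_{z=f(x,\theta)}=:H_L(f(x,\theta))$. Suppose also that the following Riemannian Jacobian stability condition holds: with $\sigma_0:=\sqrt{\lambda_{\min}(J^R(\theta^0)J^R(\theta^0)^\top)}>0$, for every $\theta$ with $\|\theta-\theta^0\|\le4\kappa_L(\mu\sigma_0)^{-1}\|u^0-y\|$, $$\|J^R(\theta)-J^R(\theta^0)\|\le\min\left\{\tfrac12,\tfrac{\mu}{6\kappa_L}\right\}\sigma_0.$$ Let $\{\theta^k\}$ be generated, with fixed step size $t>0$, by $$d^k=(F^R(\theta^k))^\dagger J^R(\theta^k)^\top\nabla L(u^k,y),\qquad\theta^{k+1}=R_{\theta^k}(-td^k),$$ and let $u^k=u(\theta^k)$. (a) There exists a constant $\kappa_R>0$ such that if $\|u^0-y\|<\frac{\mu}{3\kappa_H}$ and $t\le\min\left\{1,\left(\frac{1}{6\|u^0-y\|}-\frac{\kappa_H}{2\mu}\right)\cdot\frac{3\mu^2\sigma_0}{8\kappa_R\kappa_L^2}\right\}$,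 then for all $k\ge0$, $$\|u^{k+1}-y\|\le\left(1-\frac t2\right)\|u^k-y\|.$$ (b) Suppose further (in addition to the hypotheses of (a)) that $J^R$ is $\kappa_J$-Lipschitz continuous with respect to $\theta$, i.e. $\|J^R(\theta)-J^R(\nu)\|\le\kappa_J\|\theta-\nu\|$ for all $\theta,\nu$. Then the rate of convergence is quadratic when $t=1$, namely there is a constant $\kappa_q>0$ such that for all $k\ge0$, $$\|u^{k+1}-y\|\le\kappa_q\|u^k-y\|^2.$$
   Context: $\mathcal{M}\subseteq\mathbb{R}^{m\times n}$ is an embedded Riemannian manifold with the metric induced by the Euclidean inner product; $\Theta\in\mathcal{M}$ is identified with $\theta=\mathrm{vec}(\Theta)\in\mathbb{R}^r$, $r=mn$. $\mathcal{S}=\{(x_i,y_i)\}_{i=1}^N$ is a finite data set, $f(x,\theta)=[f_1(x,\theta),\dots,f_q(x,\theta)]^\top\in\mathbb{R}^q$ is the input-output map, and $L(z,y):=-\log p(y|z)$ where $p(y|z)$ is a conditional density; $P_{y|x}(\theta)$ is the distribution with density $p(\cdot|f(x,\theta))$. $\|\cdot\|$ is the Euclidean norm of vectors and the Frobenius norm of matrices. $F_L(x,\theta):=\mathbb{E}_{P_{y|x}(\theta)}[\nabla_z\log p(y|z)\nabla_z\log p(y|z)^\top]|_{z=f(x,\theta)}$. $J^R(x,\theta):=[\mathrm{grad}f_1(x,\theta),\dots,\mathrm{grad}f_q(x,\theta)]^\top\in\mathbb{R}^{q\times r}$ is the Riemannian Jacobian of $f(x,\cdot)$ at $\theta$ ($\mathrm{grad}$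 = Riemannian gradient in $\theta$). $J^R(\theta)\in\mathbb{R}^{Nq\times r}$ is obtained by stacking $J^R(x_1,\theta),\dots,J^R(x_N,\theta)$. $u(\theta)\in\mathbb{R}^{Nq}$ is the stacking of $f(x_1,\theta),\dots,f(x_N,\theta)$; $y\in\mathbb{R}^{Nq}$ is the stacking of $y_1,\dots,y_N$; $\nabla L(u,y)\in\mathbb{R}^{Nq}$ is the stacking of $\nabla_zL(u_i,y_i)$, $i=1,\dots,N$. $H_L(u(\theta))=\mathrm{blkdiag}(H_L(f(x_1,\theta)),\dots,H_L(f(x_N,\theta)))$. The Riemannian Fisher information matrix is taken as $F^R(\theta)=J^R(\theta)^\top H_L(u(\theta))J^R(\theta)$, and, when $J^R(\theta)J^R(\theta)^\top$ is invertible, its pseudo-inverse is $$F^R(\theta)^\dagger=J^R(\theta)^\top(J^R(\theta)J^R(\theta)^\top)^{-1}H_L(u(\theta))^{-1}(J^R(\theta)J^R(\theta)^\top)^{-1}J^R(\theta).$$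
   Formalization: The formal theorem adds that ∇_z L(y_i,y_i)=0 for each label (y_i minimises L(·,y_i)); without it the claim fails, e.g. f(x,θ)=θ, p(·|z)=N(2z,1), y=1, θ⁰=1/2. It also takes f(x_i,·) to be C¹ on M and the exponential map to be defined on the whole tangent bundle. *)

(* Defs.v *)
From HB Require Import structures.
From mathcomp Require Import all_boot all_order all_algebra.
From mathcomp Require Import all_classical all_reals all_analysis.
Import Order.TTheory GRing.Theory Num.Theory numFieldNormedType.Exports.

Set Implicit Arguments.
Unset Strict Implicit.
Unset Printing Implicit Defensive.

Local Open Scope classical_set_scope.
Local Open Scope ring_scope.

(** * Matrices *)

Definition mxdot (R : realType) (m n : nat) (A B : 'M[R]_(m, n)) : R :=
  \sum_(i < m) \sum_(j < n) A i j * B i j.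

(* The library norm of a matrix is the max norm (it gives the same topology);
   quantitative statements use the Frobenius norm, which on 'cV_n is the
   Euclidean norm. *)
Definition frob (R : realType) (m n : nat) (A : 'M[R]_(m, n)) : R :=
  Num.sqrt (mxdot A A).

Definition loewner_le (R : realType) (n : nat) (A B : 'M[R]_n) : Prop :=
  forall v : 'cV[R]_n, 0 <= (v^T *m (B - A) *m v) 0 0.

(* Meaningful for symmetric A of positive size; it is 0 for the empty matrix. *)
Definition lambda_min (R : realType) (n : nat) (A : 'M[R]_n) : R :=
  inf [set a | eigenvalue A a].

(* Moore-Penrose inverse over the reals. *)
Definition is_pinv (R : realType) (m n : nat)
    (A : 'M[R]_(m, n)) (B : 'M[R]_(n, m)) : Prop :=
  [/\ A *m B *m A = A, B *m A *m B = B,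
      (A *m B)^T = A *m B & (B *m A)^T = B *m A].

Definition pinv (R : realType) (m n : nat) (A : 'M[R]_(m, n)) : 'M[R]_(n, m) :=
  xget 0 [set B | is_pinv A B].

Lemma is_pinv_unique (R : realType) (m n : nat) (A : 'M[R]_(m, n)) B C :
  is_pinv A B -> is_pinv A C -> B = C.
Proof.
move=> [AB1 AB2 AB3 AB4] [AC1 AC2 AC3 AC4].
have ABC : A *m B = A *m C.
  have -> : A *m C = A *m B *m (A *m C) by rewrite mulmxA AB1.
  rewrite -{2}AB3 -AC3 -trmx_mul.
  by rewrite mulmxA AC1.
have BCA : B *m A = C *m A.
  have -> : C *m A = C *m A *m (B *m A) by rewrite -mulmxA (mulmxA A) AB1.
  rewrite -AB4 -AC4 -trmx_mul.
  by rewrite -mulmxA (mulmxA A) AC1.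
by rewrite -AB2 BCA -mulmxA ABC mulmxA AC2.
Qed.

Lemma pinv_gram (R : realType) (m n : nat) (J : 'M[R]_(m, n)) (H : 'M[R]_m) :
  J *m J^T \in unitmx -> H \in unitmx ->
  pinv (J^T *m H *m J) =
  J^T *m invmx (J *m J^T) *m invmx H *m invmx (J *m J^T) *m J.
Proof.
move=> uJ uH; set G := invmx (J *m J^T).
set B := RHS; set A := J^T *m H *m J.
have GT : G^T = G by rewrite /G trmx_inv trmx_mul trmxK.
have AB : A *m B = J^T *m G *m J.
  rewrite /A /B -!mulmxA (mulmxA J J^T) (mulmxA (J *m J^T)) mulmxV // mul1mx.
  by rewrite (mulmxA H) mulmxV // mul1mx.
have BA : B *m A = J^T *m G *m J.
  rewrite /A /B -!mulmxA (mulmxA J J^T) (mulmxA G (J *m J^T)) mulVmx // mul1mx.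
  by rewrite (mulmxA (invmx H)) mulVmx // mul1mx.
have PT : (J^T *m G *m J)^T = J^T *m G *m J.
  by rewrite !trmx_mul trmxK GT mulmxA.
have piB : is_pinv A B.
  split; rewrite ?AB ?BA ?PT //.
    by rewrite /A -!mulmxA (mulmxA J J^T) (mulmxA G) mulVmx // mul1mx.
  by rewrite /B -!mulmxA (mulmxA J J^T) (mulmxA G (J *m J^T)) mulVmx // mul1mx.
apply: (is_pinv_unique _ piB).
by apply: (@xgetPex _ 0 [set C | is_pinv A C]); exists B.
Qed.

(* Column-stacking vectorisation of an m x n matrix, and its inverse. *)
Definition vec (R : realType) (m n : nat) (A : 'M[R]_(m, n)) : 'cV[R]_(n * m) :=
  (mxvec A^T)^T.

Definition unvec (R : realType) (m n : nat) (w : 'cV[R]_(n * m)) :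
  'M[R]_(m, n) := (vec_mx w^T)^T.

(** * Smooth maps, gradients and Hessians *)

(* Class C^k on an open set: in finite dimension it is enough to iterate
   directional derivatives in fixed directions. *)
Fixpoint Ck (R : realType) (V W : normedModType R) (k : nat) (U : set V)
    (g : V -> W) : Prop :=
  match k with
  | 0 => forall z, U z -> {for z, continuous g}
  | k'.+1 => (forall z, U z -> differentiable g z) /\
             (forall v : V, Ck k' U ('D_v g))
  end.

Definition smooth_on (R : realType) (V W : normedModType R) (U : set V)
    (g : V -> W) : Prop := forall k, Ck k U g.

Definition gradient (R : realType) (q : nat) (g : 'cV[R]_q -> R)
    (z : 'cV[R]_q) : 'cV[R]_q :=
  \col_(a < q) 'D_(delta_mx a 0) g z.

Definition hessian (R : realType) (q : nat) (g : 'cV[R]_q -> R)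
    (z : 'cV[R]_q) : 'M[R]_q :=
  \matrix_(a < q, b < q) 'D_(delta_mx a 0) ('D_(delta_mx b 0) g) z.

(** * Embedded submanifolds of 'M_(m, n) with the induced metric *)

(* Slice charts: around each point a diffeomorphism phi : U -> V of open sets
   of the ambient space, with inverse psi, sends M to a d-dimensional linear
   subspace. *)
Definition embedded_submanifold (R : realType) (m n d : nat)
    (M : set 'M[R]_(m, n)) : Prop :=
  forall th, M th ->
  exists (U V : set 'M[R]_(m, n)) (phi psi : 'M[R]_(m, n) -> 'M[R]_(m, n))
         (S : {vspace 'M[R]_(m, n)}),
    [/\ open U, open V & U th] /\
    [/\ smooth_on U phi, smooth_on V psi,
        (forall z, U z -> V (phi z) /\ psi (phi z) = z) &
        (forall w, V w -> U (psi w) /\ phi (psi w) = w)] /\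
    \dim S = d /\
    (forall z, U z -> (M z <-> phi z \in S)).

Definition curve_at (R : realType) (m n : nat) (M : set 'M[R]_(m, n))
    (th : 'M[R]_(m, n)) (c : R -> 'M[R]_(m, n)) : Prop :=
  exists I : set R, [/\ open I, I 0, smooth_on I c,
    (forall s, I s -> M (c s)) & c 0 = th].

Definition tangent (R : realType) (m n : nat) (M : set 'M[R]_(m, n))
    (th : 'M[R]_(m, n)) : set 'M[R]_(m, n) :=
  [set v | exists2 c, curve_at M th c & derive1 c 0 = v].

(* The gradient of g at th is the tangent vector G representing the
   differential: (g o c)'(0) = <G, c'(0)> along every curve c through th. *)
Definition is_rgrad (R : realType) (m n : nat) (M : set 'M[R]_(m, n))
    (g : 'M[R]_(m, n) -> R) (th G : 'M[R]_(m, n)) : Prop :=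
  tangent M th G /\
  forall c : R -> 'M[R]_(m, n), curve_at M th c ->
    is_derive (0 : R) (1 : R) (g \o c) (mxdot G (derive1 c 0)).

Definition rgrad (R : realType) (m n : nat) (M : set 'M[R]_(m, n))
    (g : 'M[R]_(m, n) -> R) (th : 'M[R]_(m, n)) : 'M[R]_(m, n) :=
  xget 0 [set G | is_rgrad M g th G].

Definition C1_on_manifold (R : realType) (m n : nat) (M : set 'M[R]_(m, n))
    (g : 'M[R]_(m, n) -> R) : Prop :=
  (forall th, M th -> is_rgrad M g th (rgrad M g th)) /\
  {within M, continuous (rgrad M g)}.

(* For the induced metric, zero covariant acceleration means that the ambient
   acceleration is normal to M. *)
Definition geodesic (R : realType) (m n : nat) (M : set 'M[R]_(m, n))
    (c : R -> 'M[R]_(m, n)) : Prop :=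
  [/\ smooth_on setT c, (forall s, M (c s)) &
      forall s v, tangent M (c s) v -> mxdot (derive1n 2 c s) v = 0].

(* E is defined on the whole tangent bundle (its values elsewhere are
   irrelevant). *)
Definition exponential_map (R : realType) (m n : nat) (M : set 'M[R]_(m, n))
    (E : 'M[R]_(m, n) -> 'M[R]_(m, n) -> 'M[R]_(m, n)) : Prop :=
  forall th v, M th -> tangent M th v ->
  exists c, [/\ geodesic M c, c 0 = th, derive1 c 0 = v & E th v = c 1].

(** * Loss and Fisher information *)

(* R^q with its Borel sigma-algebra *)
Definition labels (R : realType) (q : nat) :=
  g_sigma_algebraType (@open 'cV[R]_q).

(* p y z is the density p(y|z) with respect to a reference measure nu. *)
Definition conditional_density (R : realType) (q : nat)
    (nu : {measure set (labels R q) -> \bar R})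
    (p : labels R q -> 'cV[R]_q -> R) : Prop :=
  forall z, [/\ measurable_fun setT (fun y => p y z),
                (forall y, 0 <= p y z) &
                (\int[nu]_y (p y z)%:E = 1)%E].

Definition loss (R : realType) (q : nat) (p : labels R q -> 'cV[R]_q -> R)
    (z : 'cV[R]_q) (y : labels R q) : R := - ln (p y z).

Definition score (R : realType) (q : nat) (p : labels R q -> 'cV[R]_q -> R)
    (z : 'cV[R]_q) (y : labels R q) : 'cV[R]_q :=
  gradient (fun z' => ln (p y z')) z.

Definition fisher_entry (R : realType) (q : nat)
    (p : labels R q -> 'cV[R]_q -> R) (z : 'cV[R]_q) (a b : 'I_q)
    (y : labels R q) : R :=
  p y z * (score p z y *m (score p z y)^T) a b.

(* The expectation defining the Fisher matrix makes sense. *)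
Definition fisher_defined (R : realType) (q : nat)
    (nu : {measure set (labels R q) -> \bar R})
    (p : labels R q -> 'cV[R]_q -> R) (z : 'cV[R]_q) : Prop :=
  {ae nu, forall y, 0 < p y z -> differentiable (fun z' => ln (p y z')) z} /\
  forall a b, nu.-integrable setT (fun y => (fisher_entry p z a b y)%:E).

Definition fisher (R : realType) (q : nat)
    (nu : {measure set (labels R q) -> \bar R})
    (p : labels R q -> 'cV[R]_q -> R) (z : 'cV[R]_q) : 'M[R]_q :=
  \matrix_(a < q, b < q) Rintegral nu setT (fisher_entry p z a b).

(** * Stacked quantities and the Riemannian natural gradient iteration *)

Definition RJac1 (R : realType) (m n q : nat) (M : set 'M[R]_(m, n))
    (g : 'M[R]_(m, n) -> 'cV[R]_q) (th : 'M[R]_(m, n)) : 'M[R]_(q, n * m) :=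
  \matrix_(a < q) (vec (rgrad M (fun th' => g th' a 0) th))^T.

Definition RJac (R : realType) (X : Type) (m n q N : nat)
    (M : set 'M[R]_(m, n)) (f : X -> 'M[R]_(m, n) -> 'cV[R]_q)
    (x : 'I_N -> X) (th : 'M[R]_(m, n)) : 'M[R]_(\sum_(i < N) q, n * m) :=
  \mxcol_(i < N) RJac1 M (f (x i)) th.

Definition outputs (R : realType) (X : Type) (m n q N : nat)
    (f : X -> 'M[R]_(m, n) -> 'cV[R]_q) (x : 'I_N -> X) (th : 'M[R]_(m, n)) :
    'cV[R]_(\sum_(i < N) q) :=
  \mxcol_(i < N) f (x i) th.

Definition residual (R : realType) (X : Type) (m n q N : nat)
    (f : X -> 'M[R]_(m, n) -> 'cV[R]_q) (x : 'I_N -> X)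
    (y : 'I_N -> 'cV[R]_q) (th : 'M[R]_(m, n)) : R :=
  frob (outputs f x th - \mxcol_(i < N) y i).

Definition grad_loss (R : realType) (X : Type) (m n q N : nat)
    (p : labels R q -> 'cV[R]_q -> R) (f : X -> 'M[R]_(m, n) -> 'cV[R]_q)
    (x : 'I_N -> X) (y : 'I_N -> 'cV[R]_q) (th : 'M[R]_(m, n)) :
    'cV[R]_(\sum_(i < N) q) :=
  \mxcol_(i < N) gradient (fun z => loss p z (y i)) (f (x i) th).

Definition RFisher (R : realType) (X : Type) (m n q N : nat)
    (M : set 'M[R]_(m, n)) (H_L : 'cV[R]_q -> 'M[R]_q)
    (f : X -> 'M[R]_(m, n) -> 'cV[R]_q) (x : 'I_N -> X) (th : 'M[R]_(m, n)) :
    'M[R]_(n * m) :=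
  (RJac M f x th)^T *m (\mxdiag_(i < N) H_L (f (x i) th)) *m RJac M f x th.

Definition RNG_direction (R : realType) (X : Type) (m n q N : nat)
    (M : set 'M[R]_(m, n)) (p : labels R q -> 'cV[R]_q -> R)
    (H_L : 'cV[R]_q -> 'M[R]_q) (f : X -> 'M[R]_(m, n) -> 'cV[R]_q)
    (x : 'I_N -> X) (y : 'I_N -> 'cV[R]_q) (th : 'M[R]_(m, n)) :
    'M[R]_(m, n) :=
  unvec (pinv (RFisher M H_L f x th) *m (RJac M f x th)^T
         *m grad_loss p f x y th).

Definition RNG_iterates (R : realType) (X : Type) (m n q N : nat)
    (M : set 'M[R]_(m, n)) (E : 'M[R]_(m, n) -> 'M[R]_(m, n) -> 'M[R]_(m, n))
    (p : labels R q -> 'cV[R]_q -> R)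
    (H_L : 'cV[R]_q -> 'M[R]_q) (f : X -> 'M[R]_(m, n) -> 'cV[R]_q)
    (x : 'I_N -> X) (y : 'I_N -> 'cV[R]_q) (t : R) (th0 : 'M[R]_(m, n))
    (th : nat -> 'M[R]_(m, n)) : Prop :=
  th 0%N = th0 /\
  forall k, th k.+1 = E (th k) (- (t *: RNG_direction M p H_L f x y (th k))).

Definition sigma0 (R : realType) (X : Type) (m n q N : nat)
    (M : set 'M[R]_(m, n)) (f : X -> 'M[R]_(m, n) -> 'cV[R]_q)
    (x : 'I_N -> X) (th0 : 'M[R]_(m, n)) : R :=
  Num.sqrt (lambda_min (RJac M f x th0 *m (RJac M f x th0)^T)).

(* e is the initial residual; 1 / (6 e) is read as +oo when e = 0. *)
Definition step_bound (R : realType) (mu kL kH kR s0 e : R) : R :=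
  if e == 0 then 1 else
  Num.min 1 ((1 / (6 * e) - kH / (2 * mu))
             * ((3 * mu ^+ 2 * s0) / (8 * kR * kL ^+ 2))).

Definition linear_rate (R : realType) (X : Type) (m n q N : nat)
    (M : set 'M[R]_(m, n)) (E : 'M[R]_(m, n) -> 'M[R]_(m, n) -> 'M[R]_(m, n))
    (p : labels R q -> 'cV[R]_q -> R)
    (H_L : 'cV[R]_q -> 'M[R]_q) (f : X -> 'M[R]_(m, n) -> 'cV[R]_q)
    (x : 'I_N -> X) (y : 'I_N -> 'cV[R]_q) (mu kL kH : R)
    (th0 : 'M[R]_(m, n)) (kR : R) : Prop :=
  residual f x y th0 < mu / (3 * kH) ->
  forall (t : R) (th : nat -> 'M[R]_(m, n)),
    0 < t ->
    t <= step_bound mu kL kH kR (sigma0 M f x th0) (residual f x y th0) ->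
    RNG_iterates M E p H_L f x y t th0 th ->
    forall k : nat,
      residual f x y (th k.+1) <= (1 - t / 2) * residual f x y (th k).

(* Main.v *)
(** Write [e] for the error [u - y] and [J] for the Riemannian Jacobian. Since the
  Hessian is Lipschitz and the gradient of the loss vanishes at the label, the
  natural gradient direction [d] satisfies [|J d - e| <= kH / mu |e|^2], and the
  stability of [J] gives [|d| <= 8 / (5 sigma0) |e|]. Along the geodesic
  [c] with [c' 0 = - t d] the error changes by the integral of [J (c s) (c' s)],
  whence [|e(c 1)| <= (1 - t) |e| + t kH / mu |e|^2 + B], where [B] measures the
  variation of [J (c s) (c' s)] over [0 <= s <= 1]. The contraction of the error
  bounds the total length of the iteration, so all geodesics involved stay in a
  fixed set of points reachable from [theta0] by paths of bounded length.

  The constants must be uniform on that set, so its closure has to be a compact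
  subset of [M]. This is the Hopf-Rinow theorem, the exponential map being defined
  on all of the tangent bundle: chains of points of [M] minimising the energy are
  discrete geodesics, and a discrete Gronwall estimate in slice charts shows that
  fine chains are close to the genuine geodesic with the same start, which does not
  leave [M]. On the compact set the accelerations of geodesics are at most a constant
  times the squared speed and [J] is uniformly continuous (or Lipschitz), which
  makes [B] a small multiple of [t |e|] for short steps (or of order [|e|^2]). *)
Require Import Defs.
From HB Require Import structures.
From mathcomp Require Import all_boot all_order all_algebra.
From mathcomp Require Import all_classical all_reals all_analysis.
From mathcomp Require Import ring lra.
Import Order.TTheory GRing.Theory Num.Theory numFieldNormedType.Exports.
Local Open Scope classical_set_scope.
Local Open Scope ring_scope.
Set Implicit Arguments.
Unset Strict Implicit.
Unset Printing Implicit Defensive.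

(** * Frobenius geometry *)

Section frobenius.
Context {R : realType} {m n : nat}.
Implicit Types A B C : 'M[R]_(m, n).

(** The exponential map only provides some geodesic for given initial data; neither uniqueness nor
    continuity in the initial velocity is at hand, so limits of geodesics cannot be formed directly.
    Chains avoid this: compactness produces them, and they are compared with a single geodesic. The
    geodesic equation enters only in weak form, as orthogonality to tangent vectors, tested with the
    image of the error in a chart, so that no connection coefficients appear. The numbers fit
    together as follows. Moving [J] by [sigma0 / 6] leaves the lower bound [5 sigma0 / 6] for its
    transpose, hence [|d| <= 6 / (5 sigma0) |J d|], while [kH |e| / mu <= 1 / 3] gives
    [|J d| <= 4 / 3 |e|]; this is the factor [8 / 5]. The loss takes [t / 3] of the decrease and [B]
    is held to [t / 6 |e|], which turns [1 - t] into [1 - t / 2]. Each step of length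
    [8 t / (5 sigma0) |e|] is thus paid by a drop [t / 2 |e|], and the total length is at most
    [16 / (5 sigma0)] times the initial error, inside the radius of the stability condition because
    [mu <= kL]. *)

Lemma mxdotC A B : mxdot A B = mxdot B A.
Proof.
by apply: eq_bigr => i _; apply: eq_bigr => j _; rewrite mulrC.
Qed.

Lemma mxdotDl A B C : mxdot (A + B) C = mxdot A C + mxdot B C.
Proof.
rewrite /mxdot -big_split; apply: eq_bigr => i _ /=; rewrite -big_split.
by apply: eq_bigr => j _ /=; rewrite mxE mulrDl.
Qed.

Lemma mxdotZl k A B : mxdot (k *: A) B = k * mxdot A B.
Proof.
rewrite /mxdot mulr_sumr; apply: eq_bigr => i _; rewrite mulr_sumr.
by apply: eq_bigr => j _ /=; rewrite mxE mulrA.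
Qed.

Lemma mxdotNl A B : mxdot (- A) B = - mxdot A B.
Proof. by rewrite -scaleN1r mxdotZl mulN1r. Qed.

Lemma mxdotBl A B C : mxdot (A - B) C = mxdot A C - mxdot B C.
Proof. by rewrite mxdotDl mxdotNl. Qed.

Lemma mxdotDr A B C : mxdot A (B + C) = mxdot A B + mxdot A C.
Proof. by rewrite mxdotC mxdotDl mxdotC (mxdotC C). Qed.

Lemma mxdotZr k A B : mxdot A (k *: B) = k * mxdot A B.
Proof. by rewrite mxdotC mxdotZl mxdotC. Qed.

Lemma mxdotNr A B : mxdot A (- B) = - mxdot A B.
Proof. by rewrite mxdotC mxdotNl mxdotC. Qed.

Lemma mxdotBr A B C : mxdot A (B - C) = mxdot A B - mxdot A C.
Proof. by rewrite mxdotDr mxdotNr. Qed.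

Lemma mxdot0l A : mxdot 0 A = 0.
Proof. by rewrite -(scale0r (0 : 'M[R]_(m, n))) mxdotZl mul0r. Qed.

Lemma mxdot0r A : mxdot A 0 = 0.
Proof. by rewrite mxdotC mxdot0l. Qed.

Lemma mxdot_ge0 A : 0 <= mxdot A A.
Proof.
by apply: sumr_ge0 => i _; apply: sumr_ge0 => j _; rewrite -expr2 sqr_ge0.
Qed.

Lemma sqr_frob A : frob A ^+ 2 = mxdot A A.
Proof. by rewrite /frob sqr_sqrtr// mxdot_ge0. Qed.

Lemma frob_ge0 A : 0 <= frob A.
Proof. exact: sqrtr_ge0. Qed.

Lemma coord_le_frob A i j : `|A i j| <= frob A.
Proof.
rewrite -sqrtr_sqr; apply: ler_wsqrtr; rewrite /mxdot (bigD1 i)//=.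
rewrite (bigD1 j)//= -expr2 -addrA lerDl addr_ge0//.
  by apply: sumr_ge0 => k _; rewrite -expr2 sqr_ge0.
apply: sumr_ge0 => k _; apply: sumr_ge0 => l _.
by rewrite -expr2 sqr_ge0.
Qed.

Lemma frob_eq0 A : frob A = 0 -> A = 0.
Proof.
move=> A0; apply/matrixP => i j; rewrite mxE; apply/eqP.
by rewrite -normr_le0 -A0 coord_le_frob.
Qed.

Lemma frob0 : frob (0 : 'M[R]_(m, n)) = 0.
Proof. by rewrite /frob mxdot0l sqrtr0. Qed.

Lemma frobZ k A : frob (k *: A) = `|k| * frob A.
Proof.
by rewrite /frob mxdotZl mxdotZr mulrA -expr2 sqrtrM ?sqr_ge0// sqrtr_sqr.
Qed.

Lemma frobN A : frob (- A) = frob A.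
Proof. by rewrite -scaleN1r frobZ normrN1 mul1r. Qed.

Lemma frob_distC A B : frob (A - B) = frob (B - A).
Proof. by rewrite -frobN opprB. Qed.

(** Cauchy-Schwarz, from expanding the square of [mxdot B B *: A - mxdot A B *: B]. *)
Lemma mxdot_le A B : mxdot A B <= frob A * frob B.
Proof.
have [->|B0] := eqVneq B 0; first by rewrite mxdot0r frob0 mulr0.
have b0 : 0 < mxdot B B.
  rewrite lt_def mxdot_ge0 andbT -sqr_frob sqrf_eq0.
  by apply: contra_neq B0; exact: frob_eq0.
have := mxdot_ge0 (mxdot B B *: A - mxdot A B *: B).
rewrite mxdotBl !mxdotBr !mxdotZl !mxdotZr (mxdotC B A).
set a := mxdot A A; set b := mxdot B B in b0 *; set s := mxdot A B => h.
have sab : s ^+ 2 <= a * b.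
  rewrite -(@ler_pM2l _ b)// -subr_ge0; apply: le_trans h _.
  by rewrite le_eqVlt; apply/orP; left; apply/eqP; ring.
apply: le_trans (ler_norm _) _.
by rewrite -sqrtr_sqr /frob -sqrtrM ?mxdot_ge0// ler_wsqrtr.
Qed.

Lemma normr_mxdot_le A B : `|mxdot A B| <= frob A * frob B.
Proof.
by rewrite ler_norml mxdot_le andbT lerNl -mxdotNl -(frobN A) mxdot_le.
Qed.

Lemma frobD A B : frob (A + B) <= frob A + frob B.
Proof.
rewrite -(@ler_pXn2r _ 2%N)// ?nnegrE ?addr_ge0 ?frob_ge0//.
rewrite sqr_frob mxdotDl !mxdotDr -!sqr_frob (mxdotC B A).
have := mxdot_le A B; lra.
Qed.

Lemma frobB A B : frob (A - B) <= frob A + frob B.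
Proof. by rewrite -(frobN B) frobD. Qed.

Lemma frob_dist_triangle B A C : frob (A - C) <= frob (A - B) + frob (B - C).
Proof. by have := frobD (A - B) (B - C); rewrite subrKA. Qed.

Lemma frob_le_distD A B : frob A <= frob B + frob (A - B).
Proof. by rewrite -{1}(subrKC B A) frobD. Qed.

Lemma frob_tr A : frob A^T = frob A.
Proof.
rewrite /frob /mxdot exchange_big; congr Num.sqrt.
by apply: eq_bigr => i _; apply: eq_bigr => j _; rewrite !mxE.
Qed.

Lemma frob_sum_le I (r : seq I) (F : I -> 'M[R]_(m, n)) :
  frob (\sum_(i <- r) F i) <= \sum_(i <- r) frob (F i).
Proof.
elim/big_ind2 : _ => //; first by rewrite frob0.
by move=> x a y b xa yb; apply: le_trans (frobD _ _) (lerD xa yb).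
Qed.

Lemma mx_norm_le_frob A : `|A| <= frob A.
Proof.
rewrite [leLHS]/Num.Def.normr/= mx_normrE; apply: bigmax_le; first exact: frob_ge0.
by move=> i _; exact: coord_le_frob.
Qed.

Lemma frob_le_mx_norm A : frob A <= (m * n)%:R * `|A|.
Proof.
rewrite {1}(matrix_sum_delta A); apply: le_trans (frob_sum_le _ _) _.
rewrite natrM -mulrA -[m in m%:R]card_ord -sumr_const mulr_suml.
apply: ler_sum => i _; apply: le_trans (frob_sum_le _ _) _.
rewrite mul1r -[n in n%:R]card_ord -sumr_const mulr_suml.
apply: ler_sum => j _; rewrite mul1r frobZ.
suff -> : frob (delta_mx i j : 'M[R]_(m, n)) = 1.
  rewrite mulr1 [leRHS]/Num.Def.normr/= mx_normrE.
  by apply/bigmax_geP; right; exists (i, j).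
rewrite /frob /mxdot (bigD1 i)//= (bigD1 j)//= mxE !eqxx mulr1.
rewrite big1 ?addr0 => [|k kj]; last by rewrite mxE (negbTE kj) andbF mul0r.
rewrite big1 ?addr0 ?sqrtr1// => k ki.
by rewrite big1// => l _; rewrite mxE (negbTE ki) mul0r.
Qed.

(** The max norm and the Frobenius norm bound each other, so both describe the same neighbourhoods;
    quantitative estimates reach the topology through this equivalence. *)
Lemma nbhs_frobP (A : 'M[R]_(m, n)) (P : set 'M[R]_(m, n)) :
  nbhs A P <-> exists2 e : R, 0 < e & forall B, frob (B - A) < e -> P B.
Proof.
split=> [/nbhs_normP[e /= e0 eP]|[e e0 eP]].
  exists e => // B BA; apply: eP => /=; rewrite distrC.
  exact: le_lt_trans (mx_norm_le_frob _) BA.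
(* The [+ 1] keeps the divisor positive for matrices without entries. *)
apply/(nbhs_normP A P); have k0 : 0 < (m * n)%:R + 1 :> R.
  by rewrite ltr_wpDl.
exists (e / ((m * n)%:R + 1)); first by rewrite /= divr_gt0.
move=> B /=; rewrite distrC ltr_pdivlMr// => BA; apply: eP.
apply: le_lt_trans (frob_le_mx_norm _) _; apply: le_lt_trans BA.
by rewrite mulrC ler_wpM2l// lerDl.
Qed.

End frobenius.

Lemma frob_mulmx {R : realType} {m n p : nat}
    (A : 'M[R]_(m, n)) (B : 'M[R]_(n, p)) :
  frob (A *m B) <= frob A * frob B.
Proof.
rewrite -(@ler_pXn2r _ 2%N)// ?nnegrE ?mulr_ge0 ?frob_ge0//.
rewrite exprMn !sqr_frob {1 2}/mxdot mulr_suml; apply: ler_sum => i _.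
have -> : (\sum_(j < n) A i j * A i j) = mxdot (row i A) (row i A).
  by rewrite /mxdot big_ord1; apply: eq_bigr => j _; rewrite mxE.
have -> : mxdot B B = \sum_(k < p) mxdot (col k B)^T (col k B)^T.
  rewrite /mxdot exchange_big; apply: eq_bigr => k _.
  by rewrite big_ord1; apply: eq_bigr => j _; rewrite !mxE.
rewrite mulr_sumr; apply: ler_sum => k _; rewrite -!sqr_frob -exprMn.
have -> : (A *m B) i k = mxdot (row i A) (col k B)^T.
  by rewrite mxE /mxdot big_ord1; apply: eq_bigr => j _; rewrite !mxE.
rewrite -expr2 -real_normK ?num_real//.
by rewrite ler_pXn2r ?nnegrE ?mulr_ge0 ?frob_ge0// normr_mxdot_le.
Qed.

(** * Calculus along curves *)

Section calculus.
Context {R : realType} {V : normedModType R} {m n : nat}.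
Implicit Types (f g : V -> 'M[R]_(m, n)).

Lemma is_derive_mxP f x v df :
  is_derive x v f df <-> forall i j, is_derive x v (fun y => f y i j) (df i j).
Proof.
split=> [[fD fv] i j|h].
  split; first by move/derivable_mxP : fD; exact.
  by rewrite -fv derive_mx// mxE.
have fD : derivable f x v by apply/derivable_mxP => i j; case: (h i j).
split=> //; rewrite derive_mx//; apply/matrixP => i j; rewrite mxE.
by case: (h i j).
Qed.

Lemma is_derive_mxdot f g x v df dg :
  is_derive x v f df -> is_derive x v g dg ->
  is_derive x v (fun y => mxdot (f y) (g y)) (mxdot df (g x) + mxdot (f x) dg).
Proof.
move=> /is_derive_mxP fD /is_derive_mxP gD.
have -> : (fun y => mxdot (f y) (g y)) =
    \sum_(i < m) \sum_(j < n) ((fun y => f y i j) * (fun y => g y i j)).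
  by apply/funext => y; rewrite fct_sumE; apply: eq_bigr => i _; rewrite fct_sumE.
have fgD i j := is_deriveM (fD i j) (gD i j).
have := is_derive_sum (fun i => is_derive_sum (fgD i)).
move=> /is_derive_eq; apply.
rewrite addrC /mxdot -big_split; apply: eq_bigr => i _ /=.
rewrite -big_split; apply: eq_bigr => j _ /=.
by congr (_ + _); rewrite /GRing.scale/= mulrC.
Qed.

End calculus.

(* Reduces to the scalar mean value theorem for [s |-> <g s, g b - g a>]. *)
Lemma frob_mean_value {R : realType} {m n : nat} (g dg : R -> 'M[R]_(m, n))
    (a b K : R) : a <= b ->
  (forall s, a <= s <= b -> is_derive s 1 g (dg s)) ->
  (forall s, a <= s <= b -> frob (dg s) <= K) ->
  frob (g b - g a) <= K * (b - a).
Proof.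
move=> ab gD dgK; pose u := g b - g a.
have hD s : a <= s <= b ->
    is_derive s 1 (fun s => mxdot (g s) u) (mxdot (dg s) u).
  move=> /gD gs; have := is_derive_mxdot gs (is_derive_cst u s 1).
  by rewrite mxdot0r addr0.
have [c cab] : exists2 c, c \in `[a, b]%R &
    mxdot (g b) u - mxdot (g a) u = mxdot (dg c) u * (b - a).
  apply: (@MVT_segment R (fun s => mxdot (g s) u) (fun s => mxdot (dg s) u)) => //.
    by move=> s; rewrite in_itv/= => /andP[/ltW ? /ltW ?]; apply: hD; apply/andP.
  apply: derivable_within_continuous => s; rewrite in_itv/= => sab.
  by case: (hD s sab).
rewrite -mxdotBl -/u -sqr_frob => uE.
have [u0|u0] := eqVneq (frob u) 0.
  rewrite u0 mulr_ge0 ?subr_ge0//; apply: le_trans (frob_ge0 _) (dgK a _).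
  by rewrite lexx.
have {}u0 : 0 < frob u by rewrite lt_def u0 frob_ge0.
rewrite -(ler_pM2r u0) -expr2 uE mulrAC ler_wpM2r ?subr_ge0//.
apply: le_trans (mxdot_le _ _) _; rewrite ler_wpM2r ?frob_ge0//.
by apply: dgK; rewrite in_itv in cab.
Qed.

(** * Smooth maps and their derivative bounds on balls *)

Section smooth_maps.
Context {R : realType} {V W : normedModType R}.
Implicit Types (g h : V -> W) (U : set V).

Lemma smooth_on_differentiable U h x :
  smooth_on U h -> U x -> differentiable h x.
Proof. by move=> /(_ 1%N)[hU _]; exact: hU. Qed.

Lemma smooth_on_derive U h v : smooth_on U h -> smooth_on U ('D_v h).
Proof. by move=> hU k; case: (hU k.+1) => _; exact. Qed.

Lemma smooth_on_continuous U h x : smooth_on U h -> U x -> {for x, continuous h}.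
Proof. by move=> /(_ 0%N); exact. Qed.

Lemma is_derive_chain h (c : R -> V) (s : R) v :
  is_derive s (1 : R) c v -> differentiable h (c s) ->
  is_derive s (1 : R) (h \o c) ('D_v h (c s)).
Proof.
move=> [cD cv] hD; have cd : differentiable c s by apply/derivable1_diffP.
have hcd : differentiable (h \o c) s by exact: differentiable_comp.
split; first exact/diff_derivable.
by rewrite deriveE// diff_comp//= -[X in 'd h _ X]deriveE// cv deriveE.
Qed.

Lemma is_derive_line (x a : V) (s : R) :
  is_derive s (1 : R) (fun s : R => x + s *: a) a.
Proof.
have lD : is_derive s (1 : R) (fun s : R => s *: a) a.
  have dl : differentiable (fun s : R => s *: a) s by [].
  by split; [exact/diff_derivable|rewrite deriveE// diff_val scale1r].
by have := is_deriveD (is_derive_cst x s (1 : R)) lD; rewrite add0r.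
Qed.

Lemma is_derive_along_line h x a (s : R) : differentiable h (x + s *: a) ->
  is_derive s (1 : R) (fun s : R => h (x + s *: a)) ('D_a h (x + s *: a)).
Proof. exact: is_derive_chain (is_derive_line x a s). Qed.

Lemma derive_dirD h x a b : differentiable h x ->
  'D_(a + b) h x = 'D_a h x + 'D_b h x.
Proof. by move=> hx; rewrite !deriveE// linearD. Qed.

Lemma derive_dirZ h x k a : differentiable h x -> 'D_(k *: a) h x = k *: 'D_a h x.
Proof. by move=> hx; rewrite !deriveE// linearZ. Qed.

Lemma derive_dirB h x a b : differentiable h x ->
  'D_(a - b) h x = 'D_a h x - 'D_b h x.
Proof. by move=> hx; rewrite !deriveE// linearB. Qed.

End smooth_maps.

Lemma le_sum2 {R : numDomainType} m n (F : 'I_m -> 'I_n -> R) i j :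
  (forall i j, 0 <= F i j) -> F i j <= \sum_(i < m) \sum_(j < n) F i j.
Proof.
move=> F0; rewrite (bigD1 i)// [leRHS]/= (bigD1 j)//= -addrA lerDl.
by apply: addr_ge0; apply: sumr_ge0 => // k _; apply: sumr_ge0.
Qed.

Lemma sum_mixed_difference {R : pzRingType} {V : lmodType R} m n
    (v : 'M[R]_(m, n)) (A B C D : 'I_m -> 'I_n -> V) :
  (\sum_(i < m) \sum_(j < n) v i j *: A i j - \sum_(i < m) \sum_(j < n) v i j *: B i j)
  - (\sum_(i < m) \sum_(j < n) v i j *: C i j - \sum_(i < m) \sum_(j < n) v i j *: D i j)
  = \sum_(i < m) \sum_(j < n) v i j *: (A i j - B i j - (C i j - D i j)).
Proof.
rewrite -!sumrB; apply: eq_bigr => i _; rewrite -!sumrB.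
by apply: eq_bigr => j _; rewrite -!scalerBr.
Qed.

Section tame_maps.
Context {R : realType} {m n k l : nat}.
Implicit Types (h : 'M[R]_(m, n) -> 'M[R]_(k, l)) (x v a z : 'M[R]_(m, n)).

Lemma derive_dir_sum h x v : differentiable h x ->
  'D_v h x = \sum_(i < m) \sum_(j < n) v i j *: 'D_(delta_mx i j) h x.
Proof.
move=> hx; rewrite [in LHS](matrix_sum_delta v) deriveE// linear_sum.
apply: eq_bigr => i _; rewrite linear_sum; apply: eq_bigr => j _.
by rewrite linearZ -deriveE.
Qed.

Lemma frob_coord_sum_le v (F : 'I_m -> 'I_n -> 'M[R]_(k, l)) (C : R) :
  (forall i j, frob (F i j) <= C) ->
  frob (\sum_(i < m) \sum_(j < n) v i j *: F i j) <= (m * n)%:R * C * frob v.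
Proof.
move=> FC; apply: le_trans (frob_sum_le _ _) _.
rewrite natrM -!mulrA -[m in m%:R]card_ord -sumr_const mulr_suml.
apply: ler_sum => i _; apply: le_trans (frob_sum_le _ _) _.
rewrite mul1r -[n in n%:R]card_ord -sumr_const mulr_suml.
apply: ler_sum => j _; rewrite mul1r frobZ mulrC.
by rewrite ler_pM ?frob_ge0 ?coord_le_frob.
Qed.

(** [C] bounds the operator norm of the derivative on a whole ball; balls are convex, so the mean
    value inequality turns this into a Lipschitz bound. *)
Definition bounded_derive h z (r C : R) : Prop :=
  forall x, frob (x - z) < r ->
    differentiable h x /\ forall v, frob ('D_v h x) <= C * frob v.

Lemma bounded_derive_le h z (r r' C C' : R) : r' <= r -> C <= C' ->
  bounded_derive h z r C -> bounded_derive h z r' C'.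
Proof.
move=> rr CC hz x xz; have [hx hv] := hz x (lt_le_trans xz rr).
by split=> // v; apply: le_trans (hv v) _; rewrite ler_wpM2r ?frob_ge0.
Qed.

(** Only finitely many partial derivatives matter: each is continuous, hence near [z] bounded by its
    norm at [z] plus one, and a general direction is a combination of coordinate directions. *)
Lemma smooth_bounded_derive U h z : open U -> U z -> smooth_on U h ->
  exists r C : R, [/\ 0 < r, 0 < C & bounded_derive h z r C].
Proof.
move=> oU Uz hU.
pose B i j := frob ('D_(delta_mx i j) h z) + 1.
have Bnear i j : \forall x \near z, frob ('D_(delta_mx i j) h x) < B i j.
  have nb : nbhs ('D_(delta_mx i j) h z)
      [set y | frob (y - 'D_(delta_mx i j) h z) < 1].
    by apply/nbhs_frobP; exists 1.
  have Hn : nbhs z [set x |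
      frob ('D_(delta_mx i j) h x - 'D_(delta_mx i j) h z) < 1].
    have cD := smooth_on_continuous (smooth_on_derive (delta_mx i j) hU) Uz.
    exact: (cD _ nb).
  apply: (filterS _ Hn) => x /= hx; rewrite /B; 
  apply: le_lt_trans (frob_le_distD _ ('D_(delta_mx i j) h z)) _.
  by rewrite ltrD2l.
pose C := \sum_(i < m) \sum_(j < n) B i j.
have BC i j : B i j <= C.
  by apply: le_sum2 => i' j'; rewrite /B addr_ge0 ?frob_ge0.
have An : \forall x \near z, forall i j, frob ('D_(delta_mx i j) h x) < B i j.
  pose P i j := [set x | frob ('D_(delta_mx i j) h x) < B i j].
  have Pi i : \forall x \near z, forall j, P i j x.
    exact: (filter_forall (nbhs_filter z) (Bnear i)).
  exact: (filter_forall (nbhs_filter z) Pi).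
have : nbhs z [set x | U x /\ forall i j, frob ('D_(delta_mx i j) h x) < B i j].
  by apply: filterI; first exact: open_nbhs_nbhs.
move=> zn; have [r r0 rP] := (nbhs_frobP _ _).1 zn.
have C0 : 0 <= C.
  rewrite /C; apply: sumr_ge0 => i _; apply: sumr_ge0 => j _.
  by rewrite /B addr_ge0 ?frob_ge0.
exists r, ((m * n)%:R * C + 1); split=> //.
  by rewrite ltr_wpDl// mulr_ge0.
move=> x /rP[Ux xB]; have hx := smooth_on_differentiable hU Ux.
split=> // v; rewrite derive_dir_sum//.
apply: le_trans (frob_coord_sum_le (C := C) v _) _.
  by move=> i j; apply: le_trans (ltW (xB i j)) (BC i j).
by rewrite ler_wpM2r ?frob_ge0// lerDl.
Qed.

Lemma frob_segment_lt z x y (r s : R) : frob (x - z) < r -> frob (y - z) < r ->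
  0 <= s <= 1 -> frob (x + s *: (y - x) - z) < r.
Proof.
move=> xz yz /andP[s0 s1].
have -> : x + s *: (y - x) - z = (1 - s) *: (x - z) + s *: (y - z).
  apply/matrixP => i j; rewrite !mxE; ring.
apply: le_lt_trans (frobD _ _) _; rewrite !frobZ !ger0_norm ?subr_ge0//.
have [->|s0'] := eqVneq s 0; first by rewrite subr0 mul1r mul0r addr0.
have {s0 s0'} s0 : 0 < s by rewrite lt_def s0'.
rewrite [ltRHS](_ : r = (1 - s) * r + s * r); last by ring.
by rewrite ler_ltD// ?ltr_pM2l// ler_wpM2l ?subr_ge0// ltW.
Qed.

Lemma bounded_derive_lipschitz h z (r C : R) : bounded_derive h z r C ->
  forall x y, frob (x - z) < r -> frob (y - z) < r ->
    frob (h x - h y) <= C * frob (x - y).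
Proof.
move=> hz x y xz yz.
have := @frob_mean_value _ _ _ (fun s => h (y + s *: (x - y)))
  (fun s => 'D_(x - y) h (y + s *: (x - y))) 0 1 (C * frob (x - y)) ler01.
rewrite scale1r scale0r addr0 subrKC subr0 mulr1; apply=> s s01.
  by apply: is_derive_along_line; case: (hz _ (frob_segment_lt yz xz s01)).
by case: (hz _ (frob_segment_lt yz xz s01)) => _; exact.
Qed.

Definition lipschitz_derive h z (r C : R) : Prop :=
  forall x y v, frob (x - z) < r -> frob (y - z) < r ->
    frob ('D_v h x - 'D_v h y) <= C * frob v * frob (x - y).

(** The increment [a] and the displacement [x - y] enter symmetrically, as the two arguments of a
    second derivative would. *)
Definition mixed_bound h z (r C : R) : Prop := forall x y a,
  frob (x - z) < r -> frob (y - z) < r ->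
  frob (x + a - z) < r -> frob (y + a - z) < r ->
  frob (h (x + a) - h x - (h (y + a) - h y)) <= C * frob a * frob (x - y).

(* The quantitative consequences of C^3 regularity near [z] that the proof
   uses; [tame_quad] compares the second order remainders of two expansions. *)
Record tame h z (r C : R) : Prop := Tame {
  tame_bounded : bounded_derive h z r C;
  tame_lipschitz_derive : lipschitz_derive h z r C;
  tame_mixed : mixed_bound h z r C;
  tame_quad : forall x y a b,
    frob (x - z) < r -> frob (y - z) < r ->
    frob (x + a - z) < r -> frob (x + b - z) < r -> frob (y + b - z) < r ->
    frob (h (x + a) - h x - 'D_a h x - (h (y + b) - h y - 'D_b h y)) <=
    C * (frob b ^+ 2 * frob (x - y) + (frob a + frob b) * frob (a - b)) }.

Lemma tame_le h z (r r' C C' : R) : r' <= r -> C <= C' ->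
  tame h z r C -> tame h z r' C'.
Proof.
move=> rr CC [h1 h2 h3 h4]; split.
- exact: bounded_derive_le h1.
- move=> x y v xz yz; apply: le_trans (h2 _ _ _ _ _) _.
  + exact: lt_le_trans rr.
  + exact: lt_le_trans rr.
  by rewrite !ler_wpM2r ?frob_ge0.
- move=> x y v xz yz xa ya; apply: le_trans (h3 _ _ _ _ _ _ _) _.
  1-4: exact: lt_le_trans rr.
  by rewrite !ler_wpM2r ?frob_ge0.
- move=> x y a b xz yz xa xb yb; apply: le_trans (h4 _ _ _ _ _ _ _ _ _) _.
  1-5: exact: lt_le_trans rr.
  by rewrite ler_wpM2r// addr_ge0// mulr_ge0 ?addr_ge0 ?frob_ge0 ?exprn_ge0 ?frob_ge0.
Qed.

Lemma bounded_derive_family (I : finType) (H : I -> 'M[R]_(m, n) -> 'M[R]_(k, l)) z :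
  (forall i, exists r C : R, [/\ 0 < r, 0 < C & bounded_derive (H i) z r C]) ->
  exists r C : R, [/\ 0 < r, 0 < C & forall i, bounded_derive (H i) z r C].
Proof.
move=> HI; have /choice[rC rCP] : forall i, exists rC : R * R,
    [/\ 0 < rC.1, 0 < rC.2 & bounded_derive (H i) z rC.1 rC.2].
  by move=> i; have [r [C rC]] := HI i; exists (r, C).
exists (\big[Num.min/1]_i (rC i).1), (\sum_i (rC i).2 + 1); split.
- by apply/bigmin_gtP; split=> // i _; case: (rCP i).
- by rewrite ltr_wpDl// sumr_ge0// => i _; case: (rCP i) => _ /ltW.
move=> i; have [_ C0 hi] := rCP i; apply: bounded_derive_le hi.
  exact: bigmin_le_cond.
rewrite (bigD1 i)//= -addrA lerDl addr_ge0// sumr_ge0// => j _.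
by case: (rCP j) => _ /ltW.
Qed.

Lemma lipschitz_derive_le h z (r r' C C' : R) : r' <= r -> C <= C' ->
  lipschitz_derive h z r C -> lipschitz_derive h z r' C'.
Proof.
move=> rr CC h2 x y v xz yz; apply: le_trans (h2 _ _ _ _ _) _.
- exact: lt_le_trans rr.
- exact: lt_le_trans rr.
by rewrite !ler_wpM2r ?frob_ge0.
Qed.

Lemma smooth_lipschitz_derive U h z : open U -> U z -> smooth_on U h ->
  exists r C : R, [/\ 0 < r, 0 < C, bounded_derive h z r C & lipschitz_derive h z r C].
Proof.
move=> oU Uz hU; have [r1 [C1 [r10 C10 h1]]] := smooth_bounded_derive oU Uz hU.
have [|r2 [C2 [r20 C20 h2]]] := @bounded_derive_family ('I_m * 'I_n)%type
    (fun ij => 'D_(delta_mx ij.1 ij.2) h) z.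
  by move=> ij; apply: smooth_bounded_derive oU Uz _; exact: smooth_on_derive.
have mC0 : 0 <= (m * n)%:R * C2 by rewrite mulr_ge0// ltW.
exists (Num.min r1 r2), (C1 + (m * n)%:R * C2); split.
- by rewrite lt_min r10.
- by rewrite ltr_wpDr.
- by apply: bounded_derive_le h1; rewrite ?ge_min ?lexx// lerDl.
move=> x y v; rewrite !lt_min => /andP[x1 x2] /andP[y1 y2].
rewrite !derive_dir_sum; [|by case: (h1 _ y1)|by case: (h1 _ x1)].
rewrite -sumrB (eq_bigr (fun i => \sum_j v i j *: ('D_(delta_mx i j) h x
    - 'D_(delta_mx i j) h y))) => [|i _]; last first.
  by rewrite -sumrB; apply: eq_bigr => j _; rewrite -scalerBr.
apply: le_trans (frob_coord_sum_le (C := C2 * frob (x - y)) v _) _.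
  move=> i j; exact: (bounded_derive_lipschitz (h2 (i, j))).
rewrite -subr_ge0.
have -> : (C1 + (m * n)%:R * C2) * frob v * frob (x - y) -
    (m * n)%:R * (C2 * frob (x - y)) * frob v = C1 * frob v * frob (x - y) by ring.
by rewrite !mulr_ge0 ?frob_ge0// ltW.
Qed.

(** Mean value inequality along [s |-> h (x + s *: a) - h (y + s *: a)], whose derivative compares
    ['D_a h] at two points that stay [x - y] apart. *)
Lemma lipschitz_derive_mixed h z (r C : R) : bounded_derive h z r C ->
  lipschitz_derive h z r C -> mixed_bound h z r C.
Proof.
move=> h1 h2 x y a xz yz xa ya.
have sx s : 0 <= s <= 1 -> frob (x + s *: a - z) < r.
  by move=> /(frob_segment_lt xz xa); rewrite [x + a - x]addrAC subrr add0r.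
have sy s : 0 <= s <= 1 -> frob (y + s *: a - z) < r.
  by move=> /(frob_segment_lt yz ya); rewrite [y + a - y]addrAC subrr add0r.
have := @frob_mean_value _ _ _ (fun s => h (x + s *: a) - h (y + s *: a))
  (fun s => 'D_a h (x + s *: a) - 'D_a h (y + s *: a)) 0 1
  (C * frob a * frob (x - y)) ler01.
rewrite !scale1r !scale0r !addr0 subr0 mulr1 => H.
rewrite [X in frob X](_ : _ = h (x + a) - h (y + a) - (h x - h y)); last first.
  by apply/matrixP => i j; rewrite !mxE; ring.
apply: H => s s01.
  apply: is_deriveB; apply: is_derive_along_line.
    by case: (h1 _ (sx s s01)).
  by case: (h1 _ (sy s s01)).
apply: le_trans (h2 _ _ a (sx s s01) (sy s s01)) _.
by rewrite opprD addrACA subrr addr0.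
Qed.

(** The difference of remainders is split at the pair [(x, b)]: changing the increment from [a] to
    [b] costs the Lipschitz bound of the derivative ([E1]), moving the base from [x] to [y] costs
    the mixed difference bound for the partial derivatives ([E2]), which is where third derivatives
    enter. *)
Lemma smooth_tame U h z : open U -> U z -> smooth_on U h ->
  exists r C : R, [/\ 0 < r, 0 < C & tame h z r C].
Proof.
move=> oU Uz hU.
have [r1 [C1 [r10 C10 h1 h2]]] := smooth_lipschitz_derive oU Uz hU.
have /choice[rC rCP] : forall ij : 'I_m * 'I_n, exists rC : R * R,
    [/\ 0 < rC.1, 0 < rC.2 & mixed_bound ('D_(delta_mx ij.1 ij.2) h) z rC.1 rC.2].
  move=> ij.
  have [r [C [r0 C0 hb hl]]] :=
    smooth_lipschitz_derive oU Uz (smooth_on_derive (delta_mx ij.1 ij.2) hU).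
  by exists (r, C); split=> //=; exact: lipschitz_derive_mixed.
pose r2 := \big[Num.min/1]_i (rC i).1; pose C2 := \sum_i (rC i).2.
have r20 : 0 < r2 by apply/bigmin_gtP; split=> // i _; case: (rCP i).
have C20 : 0 <= C2 by apply: sumr_ge0 => i _; case: (rCP i) => _ /ltW.
pose C3 := (m * n)%:R * C2; have C30 : 0 <= C3 by rewrite mulr_ge0.
have h3 x y a v : frob (x - z) < Num.min r1 r2 -> frob (y - z) < Num.min r1 r2 ->
    frob (x + a - z) < Num.min r1 r2 -> frob (y + a - z) < Num.min r1 r2 ->
    frob ('D_v h (x + a) - 'D_v h x - ('D_v h (y + a) - 'D_v h y)) <=
    C3 * frob v * (frob a * frob (x - y)).
  rewrite !lt_min => /andP[x1 x2] /andP[y1 y2] /andP[xa1 xa2] /andP[ya1 ya2].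
  pose F i j := let D := 'D_(delta_mx i j) h in D (x + a) - D x - (D (y + a) - D y).
  have -> : 'D_v h (x + a) - 'D_v h x - ('D_v h (y + a) - 'D_v h y) =
      \sum_(i < m) \sum_(j < n) v i j *: F i j.
    rewrite !derive_dir_sum; first last.
    - by case: (h1 _ xa1).
    - by case: (h1 _ x1).
    - by case: (h1 _ ya1).
    - by case: (h1 _ y1).
    exact: (sum_mixed_difference v (fun i j => 'D_(delta_mx i j) h (x + a))).
  apply: le_trans (frob_coord_sum_le (C := C2 * (frob a * frob (x - y))) v _) _.
    move=> i j; have [_ c0 mb] := rCP (i, j).
    have rr : r2 <= (rC (i, j)).1 by exact: bigmin_le_cond.
    apply: le_trans (mb _ _ _ _ _ _ _) _.
    1-4: exact: lt_le_trans rr.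
    rewrite -mulrA ler_wpM2r ?mulr_ge0 ?frob_ge0//.
    rewrite /C2 (bigD1 (i, j))//= lerDl.
    by apply: sumr_ge0 => ij _; case: (rCP ij) => _ /ltW.
  by rewrite /C3 le_eqVlt; apply/orP; left; apply/eqP; ring.
exists (Num.min r1 r2), (C1 + C3); split.
- by rewrite lt_min r10.
- by rewrite ltr_wpDr.
have rr : Num.min r1 r2 <= r1 by rewrite ge_min lexx.
have CC : C1 <= C1 + C3 by rewrite lerDl.
have b1 := bounded_derive_le rr CC h1.
have l1 := lipschitz_derive_le rr CC h2.
split=> //; first exact: lipschitz_derive_mixed.
move=> x y a b xz yz xa xb yb.
have seg u v s : frob (u - z) < Num.min r1 r2 -> frob (u + v - z) < Num.min r1 r2 ->
    0 <= s <= 1 -> frob (u + s *: v - z) < Num.min r1 r2.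
  move=> uz uvz /(frob_segment_lt uz uvz).
  by rewrite [u + v - u]addrAC subrr add0r.
have bd u : frob (u - z) < Num.min r1 r2 -> differentiable h u.
  by move=> /b1[].
have E1 : frob (h (x + a) - h x - 'D_a h x - (h (x + b) - h x - 'D_b h x)) <=
    (C1 + C3) * ((frob a + frob b) * frob (a - b)).
  have sx s : 0 <= s <= 1 -> frob (x + b + s *: (a - b) - z) < Num.min r1 r2.
    by apply: seg => //; rewrite addrA [x + b + a]addrAC addrK.
  (* The subtracted linear term makes the increment over [[0, 1]] equal to the difference of the two
     remainders at [x]; the idle [0 +] fits the form of [is_derive_line]. *)
  have := @frob_mean_value _ _ _
    (fun s => h (x + b + s *: (a - b)) - (0 + s *: 'D_(a - b) h x))
    (fun s => 'D_(a - b) h (x + b + s *: (a - b)) - 'D_(a - b) h x) 0 1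
    ((C1 + C3) * ((frob a + frob b) * frob (a - b))) ler01.
  rewrite !scale1r !scale0r !addr0 !add0r !subr0 mulr1.
  have -> : x + b + (a - b) = x + a by rewrite addrACA -addrA subrr addr0.
  move=> H.
  rewrite [X in frob X](_ : _ = h (x + a) - 'D_(a - b) h x - h (x + b)); last first.
    rewrite derive_dirB; last exact: bd.
    move: (h _) (h _) (h _) ('D_a h _) ('D_b h _) => p1 p2 p3 p4 p5.
    by apply/matrixP => i j; rewrite !mxE; ring.
  apply: H => s s01.
    apply: is_deriveB; last exact: is_derive_line.
    by apply: is_derive_along_line; apply: bd; exact: sx.
  apply: le_trans (l1 _ _ _ (sx _ s01) xz) _.
  rewrite -mulrA ler_wpM2l//; first by rewrite (le_trans (ltW C10)).
  rewrite mulrC ler_wpM2r ?frob_ge0//.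
  rewrite [X in frob X](_ : _ = s *: a + (1 - s) *: b); last first.
    by apply/matrixP => i j; rewrite !mxE; ring.
  case/andP : s01 => s0 s1.
  apply: le_trans (frobD _ _) _; rewrite !frobZ !ger0_norm ?subr_ge0//.
  by rewrite lerD// ler_piMl ?frob_ge0// gerBl.
have E2 : frob (h (x + b) - h x - 'D_b h x - (h (y + b) - h y - 'D_b h y)) <=
    (C1 + C3) * (frob b ^+ 2 * frob (x - y)).
  have := @frob_mean_value _ _ _
    (fun s => (h (x + s *: b) - (0 + s *: 'D_b h x)) -
              (h (y + s *: b) - (0 + s *: 'D_b h y)))
    (fun s => ('D_b h (x + s *: b) - 'D_b h x) - ('D_b h (y + s *: b) - 'D_b h y))
    0 1 ((C1 + C3) * (frob b ^+ 2 * frob (x - y))) ler01.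
  rewrite !scale1r !scale0r !addr0 !add0r !subr0 mulr1 => H.
  rewrite [X in frob X](_ : _ = h (x + b) - 'D_b h x - (h (y + b) - 'D_b h y)
    - (h x - h y)); last first.
    move: (h _) (h _) (h _) (h _) ('D_b h _) ('D_b h _) => p1 p2 p3 p4 p5 p6.
    by apply/matrixP => i j; rewrite !mxE; ring.
  apply: H => s s01.
    apply: is_deriveB; apply: is_deriveB; try exact: is_derive_line.
      by apply: is_derive_along_line; apply: bd; exact: seg.
    by apply: is_derive_along_line; apply: bd; exact: seg.
  apply: le_trans (h3 _ _ _ _ _ _ _ _) _ => //; try exact: seg.
  have f0 := mulr_ge0 (sqr_ge0 (frob b)) (frob_ge0 (x - y)).
  case/andP : s01 => s0 s1; rewrite frobZ ger0_norm//.
  apply: (@le_trans _ _ (C3 * (frob b ^+ 2 * frob (x - y)))); last first.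
    by rewrite ler_wpM2r// lerDr ltW.
  rewrite -mulrA ler_wpM2l// expr2 -mulrA ler_wpM2l ?frob_ge0//.
  by rewrite ler_wpM2r ?frob_ge0// ler_piMl ?frob_ge0.
rewrite [X in frob X](_ : _ =
  (h (x + a) - h x - 'D_a h x - (h (x + b) - h x - 'D_b h x)) +
  (h (x + b) - h x - 'D_b h x - (h (y + b) - h y - 'D_b h y))); last first.
  by rewrite subrKA.
by apply: le_trans (frobD _ _) _; rewrite mulrDr addrC lerD.
Qed.

End tame_maps.

(** * Curves and slice charts *)

Section curves.
Context {R : realType} {W : normedModType R}.

Lemma Ck_ext_curve k (I : set R) (g h : R -> W) : open I ->
  (forall s, I s -> g s = h s) -> Ck k I g -> Ck k I h.
Proof.
move=> oI; elim: k g h => [|k IH] g h gh.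
  move=> gc s Is; have ngh : {near s, g =1 h}.
    by apply: filterS (open_nbhs_nbhs (conj oI Is)) => x Ix /=; exact: gh.
  rewrite /prop_for /continuous_at -(gh s Is); apply: cvg_trans (gc s Is).
  by apply: near_eq_cvg; apply: filterS ngh => x /= ->.
have ngh s : I s -> {near s, g =1 h}.
  by move=> Is; apply: filterS (open_nbhs_nbhs (conj oI Is)) => x Ix; exact: gh.
move=> [gd gD]; split=> [s Is|v].
  apply/derivable1_diffP; apply: near_eq_derivable (ngh s Is) _.
  exact/derivable1_diffP/gd.
apply: IH (gD v) => s Is; apply: near_eq_derive; exact: ngh.
Qed.

Lemma is_derive_frob_approx {m n : nat} (g : R -> 'M[R]_(m, n)) (s : R) dg :
  is_derive s (1 : R) g dg -> forall e : R, 0 < e -> exists2 d : R, 0 < d &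
    forall t, t != 0 -> `|t| < d -> frob (g (s + t) - g s - t *: dg) <= e * `|t|.
Proof.
move=> [gd <-] e e0; pose K : R := (m * n)%:R + 1.
have K0 : 0 < K by rewrite ltr_wpDl.
move: gd; rewrite /derivable -/(derive g s 1) => /cvgrPdist_le.
move=> /(_ (e / K)) /(_ (divr_gt0 e0 K0)) [d /= d0 dP].
exists d => // t t0 td; have := dP t; rewrite /ball_/= sub0r normrN => /(_ td t0).
rewrite /derive -/(derive g s 1) => H.
have -> : g (s + t) - g s - t *: 'D_1 g s =
    - t *: ('D_1 g s - t^-1 *: (g (t *: 1 + s) - g s)).
  rewrite scalerBr !scaleNr scalerA mulfV// scale1r opprK addrC.
  by rewrite /GRing.scale/= mulr1 (addrC t).
rewrite frobZ normrN mulrC ler_wpM2r ?normr_ge0//.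
apply: le_trans (frob_le_mx_norm _) _.
apply: (@le_trans _ _ (K * (e / K))); last by rewrite mulrC divfK ?gt_eqF.
by apply: ler_pM => //; rewrite /K lerDl.
Qed.

End curves.

(** The derivative of the restriction in the direction [v] is ['D_(v *: a) h] restricted to the same
    line, so the induction hypothesis applies to it. *)
Lemma Ck_line {R : realType} {V W : normedModType R} k (U : set V) (h : V -> W) (w a : V) :
  open U -> Ck k U h -> Ck k [set s : R | U (w + s *: a)] (fun s => h (w + s *: a)).
Proof.
move=> oU; have oI : open [set s : R | U (w + s *: a)].
  have lc : continuous (fun s : R => w + s *: a).
    move=> s; apply: differentiable_continuous; apply/derivable1_diffP.
    by case: (is_derive_line w a s).
  exact: ((continuousP _).1 lc _ oU).
elim: k h => [|k IH] h.
  move=> hc s Us; apply: (@continuous_comp _ _ _ (fun s : R => w + s *: a) h).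
    apply: differentiable_continuous; apply/derivable1_diffP.
    by case: (is_derive_line w a s).
  exact: hc.
move=> [hd hD]; split=> [s Us|v].
  apply/derivable1_diffP.
  by case: (is_derive_along_line (hd _ Us)).
have sD : Ck k [set s : R | U (w + s *: a)] (fun s => 'D_(v *: a) h (w + s *: a)).
  exact: IH (hD (v *: a)).
apply: Ck_ext_curve sD => // s Us.
have hs : differentiable (fun s : R => h (w + s *: a)) s.
  by apply/derivable1_diffP; case: (is_derive_along_line (hd _ Us)).
have -> : 'D_v (fun s : R => h (w + s *: a)) s = v *: 'D_1 (fun s : R => h (w + s *: a)) s.
  by rewrite -derive_dirZ// /GRing.scale/= mulr1.
rewrite derive_dirZ; last exact: hd.
by case: (is_derive_along_line (hd _ Us)) => _ ->.
Qed.

Lemma smooth_on_line {R : realType} {V W : normedModType R} (U : set V)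
    (h : V -> W) (w a : V) :
  open U -> smooth_on U h ->
  smooth_on [set s : R | U (w + s *: a)] (fun s => h (w + s *: a)).
Proof. by move=> oU hU k; exact: Ck_line. Qed.

Section subspaces.
Context {R : realType} {m n : nat}.
Implicit Types (S : {vspace 'M[R]_(m, n)}) (v : 'M[R]_(m, n)).

(** The map [x - projv S x] is linear, hence bounded by a multiple of [frob x], and it vanishes
    exactly on [S]. *)
Lemma vspace_closed S v :
  (forall e : R, 0 < e -> exists2 a, a \in S & frob (v - a) <= e) -> v \in S.
Proof.
move=> vS; pose p x := x - projv S x.
have pB x y : p (x - y) = p x - p y.
  rewrite /p linearB/=; move: (projv S x) (projv S y) => u w.
  by apply/matrixP => i j; rewrite !mxE; ring.
pose C := \sum_(i < m) \sum_(j < n) frob (p (delta_mx i j)).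
have pC x : frob (p x) <= (m * n)%:R * C * frob x.
  have -> : p x = \sum_(i < m) \sum_(j < n) x i j *: p (delta_mx i j).
    rewrite /p {1 2}(matrix_sum_delta x) linear_sum -sumrB.
    apply: eq_bigr => i _; rewrite linear_sum -sumrB; apply: eq_bigr => j _.
    by rewrite linearZ scalerBr.
  apply: frob_coord_sum_le => i j.
  by apply: (le_sum2 (F := fun i j => frob (p (delta_mx i j)))) => *; exact: frob_ge0.
have C0 : 0 <= (m * n)%:R * C.
  by rewrite mulr_ge0// /C sumr_ge0// => i _; rewrite sumr_ge0// => j _; exact: frob_ge0.
suff : p v = 0 by rewrite /p => /eqP; rewrite subr_eq0 => /eqP ->; exact: memv_proj.
apply: frob_eq0; apply/eqP; rewrite eq_le frob_ge0 andbT.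
apply/ler_addgt0Pr => e e0; rewrite add0r.
have K0 : 0 < (m * n)%:R * C + 1 by rewrite ltr_wpDl.
have [a aS va] := vS _ (divr_gt0 e0 K0).
have pa : p a = 0 by rewrite /p projv_id// subrr.
have -> : p v = p (v - a) by rewrite pB pa subr0.
apply: le_trans (pC _) _.
apply: (@le_trans _ _ (((m * n)%:R * C + 1) * (e / ((m * n)%:R * C + 1)))).
  by apply: ler_pM; rewrite ?frob_ge0// lerDl.
by rewrite mulrC divfK ?gt_eqF.
Qed.

(** Difference quotients of a curve in [S] lie in [S], which is closed. *)
Lemma is_derive_vspace S (g : R -> 'M[R]_(m, n)) (s : R) dg :
  is_derive s (1 : R) g dg -> (\forall t \near s, g t \in S) -> dg \in S.
Proof.
move=> gD gS; apply: vspace_closed => e e0.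
have [d d0 dP] := is_derive_frob_approx gD e0.
have gs : g s \in S by exact: nbhs_singleton gS.
move/nbhs_normP : gS => [d' /= d'0 d'P].
pose t := Num.min d d' / 2; have dd0 : 0 < Num.min d d' by rewrite lt_min d0.
have t0 : 0 < t by rewrite divr_gt0.
have tdd : t < Num.min d d' by rewrite /t ltr_pdivrMr// mulr_natr mulr2n ltrDl.
have td : `|t| < d by rewrite gtr0_norm// (lt_le_trans tdd)// ge_min lexx.
have td' : `|t| < d' by rewrite gtr0_norm// (lt_le_trans tdd)// ge_min lexx orbT.
exists (t^-1 *: (g (s + t) - g s)).
  apply: memvZ; apply: memvB => //; apply: d'P => /=.
  by rewrite opprD addNKr normrN.
have := dP t (lt0r_neq0 t0) td.
have -> : g (s + t) - g s - t *: dg = - t *: (dg - t^-1 *: (g (s + t) - g s)).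
  by rewrite scalerBr !scaleNr scalerA mulfV ?gt_eqF// scale1r opprK addrC.
by rewrite frobZ normrN mulrC ler_pM2r ?normr_gt0 ?gt_eqF.
Qed.

End subspaces.

Section charts.
Context {R : realType} {m n : nat}.
Implicit Types (M : set 'M[R]_(m, n)) (S : {vspace 'M[R]_(m, n)})
  (phi psi : 'M[R]_(m, n) -> 'M[R]_(m, n)) (x v w a z : 'M[R]_(m, n)).

(** A slice chart together with the local consequences used later, all on balls of one radius [r]
    with one constant [C]; [chart_immersion] says that [psi] is uniformly an immersion. *)
Record chart M z (r C : R) phi psi S : Prop := Chart {
  chart_r : 0 < r;
  chart_C : 1 <= C;
  chart_phi : tame phi z r C;
  chart_psi : tame psi (phi z) r C;
  chart_phiK : forall x, frob (x - z) < r -> psi (phi x) = x;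
  chart_psiK : forall w, frob (w - phi z) < r -> phi (psi w) = w;
  chart_M : forall x, frob (x - z) < r -> M x <-> phi x \in S;
  chart_psiM : forall w, frob (w - phi z) < r -> M (psi w) <-> w \in S;
  chart_derive_psi : forall w a, frob (w - phi z) < r -> w \in S -> a \in S ->
    tangent M (psi w) ('D_a psi w);
  chart_tangentP : forall x v, frob (x - z) < r -> M x ->
    tangent M x v <-> 'D_v phi x \in S;
  chart_derive_phi : forall x v, frob (x - z) < r ->
    'D_('D_v phi x) psi (phi x) = v;
  chart_immersion : forall w a, frob (w - phi z) < r ->
    frob a <= C * frob ('D_a psi w) }.

Lemma derive_inverse (U : set 'M[R]_(m, n)) phi psi x v : open U -> U x ->
  (forall y, U y -> psi (phi y) = y) -> differentiable phi x ->
  differentiable psi (phi x) -> 'D_('D_v phi x) psi (phi x) = v.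
Proof.
move=> oU Ux K dphi dpsi.
have x0 : x + (0 : R) *: v = x by rewrite scale0r addr0.
have := @is_derive_along_line _ _ _ phi x v 0; rewrite x0 => /(_ dphi) D1.
have := @is_derive_chain _ _ _ psi _ _ _ D1; rewrite x0 => /(_ dpsi)[_ <-].
have [_ vE] := is_derive_line x v 0; rewrite -[RHS]vE.
apply: near_eq_derive; near=> s => /=; apply: K; near: s.
have lc : {for 0 : R, continuous (fun s : R => x + s *: v)}.
  apply: differentiable_continuous; apply/derivable1_diffP.
  by case: (is_derive_line x v 0).
by apply: lc; rewrite x0; exact: open_nbhs_nbhs.
Unshelve. all: by end_near. Qed.

Lemma chart_exists d M z : embedded_submanifold d M -> M z ->
  exists r C phi psi S, chart M z r C phi psi S.
Proof.
move=> eM Mz; have [U [V [phi [psi [S [[oU oV Uz]]]]]]] := eM z Mz.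
move=> [[sphi spsi UV VU] [_ MS]].
have [Vz psiz] := UV z Uz.
have [r1 [C1 [r10 C10 t1]]] := smooth_tame oU Uz sphi.
have [r2 [C2 [r20 C20 t2]]] := smooth_tame oV Vz spsi.
have [r3 r30 B3] := (nbhs_frobP _ _).1 (open_nbhs_nbhs (conj oU Uz)).
have [r4 r40 B4] := (nbhs_frobP _ _).1 (open_nbhs_nbhs (conj oV Vz)).
pose C := C1 + C2 + 1.
have CC1 : C1 <= C by rewrite /C -addrA lerDl addr_ge0// ltW.
have CC2 : C2 <= C by rewrite /C addrAC lerDr addr_ge0// ltW.
have C1' : 1 <= C by rewrite /C lerDr addr_ge0// ltW.
pose r5 := Num.min (Num.min r1 r2) (Num.min r3 r4).
have r50 : 0 < r5 by rewrite !lt_min r10 r20 r30 r40.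
(* The cap [r5 / C] makes [psi] send the ball around [phi z] into the ball where the derivative of
   [phi] is bounded; the immersion bound inverts ['D_a psi w] there. *)
pose r := Num.min r5 (r5 / C).
have C0 : 0 < C by rewrite (lt_le_trans _ C1').
have rr5 : r <= r5 by rewrite /r ge_min lexx.
have rr1 : r <= r1 by rewrite (le_trans rr5)// /r5 !ge_min lexx.
have rr2 : r <= r2 by rewrite (le_trans rr5)// /r5 !ge_min lexx ?orbT.
have rr3 : r <= r3 by rewrite (le_trans rr5)// /r5 !ge_min lexx ?orbT.
have rr4 : r <= r4 by rewrite (le_trans rr5)// /r5 !ge_min lexx ?orbT.
have inU x : frob (x - z) < r -> U x.
  by move=> xr; apply: B3; exact: lt_le_trans rr3.
have inV w : frob (w - phi z) < r -> V w.
  by move=> xr; apply: B4; exact: lt_le_trans rr4.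
have tV w a : V w -> w \in S -> a \in S -> tangent M (psi w) ('D_a psi w).
  move=> Vw wS aS; exists (fun s => psi (w + s *: a)).
    exists [set s : R | V (w + s *: a)]; split.
    - have lc : continuous (fun s : R => w + s *: a).
        move=> s; apply: differentiable_continuous; apply/derivable1_diffP.
        by case: (is_derive_line w a s).
      exact: ((continuousP _).1 lc _ oV).
    - by rewrite /= scale0r addr0.
    - exact: smooth_on_line.
    - move=> s /= Vs; have [Us pK] := VU _ Vs; apply/(MS _ Us).
      by rewrite pK memvD// memvZ.
    - by rewrite scale0r addr0.
  have dpsi : differentiable psi (w + (0 : R) *: a).
    by rewrite scale0r addr0; exact: smooth_on_differentiable Vw.
  rewrite derive1E; case: (is_derive_along_line dpsi) => _ ->.
  by rewrite scale0r addr0.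
have dphi x : U x -> differentiable phi x by exact: smooth_on_differentiable.
have dpsi w : V w -> differentiable psi w by exact: smooth_on_differentiable.
have Kphi x v : U x -> 'D_('D_v phi x) psi (phi x) = v.
  move=> Ux; apply: (@derive_inverse U phi psi x v oU Ux (fun y Uy => (UV y Uy).2)).
    exact: dphi.
  by apply: dpsi; case: (UV _ Ux).
exists r, C, phi, psi, S; split=> //.
- by rewrite lt_min r50 divr_gt0.
- exact: tame_le t1.
- exact: tame_le t2.
- by move=> x /inU/UV[].
- by move=> w /inV/VU[].
- by move=> x /inU/MS.
- by move=> w /inV/VU[/MS-> ->].
- by move=> w a /inV; exact: tV.
- move=> x v /inU Ux Mx; split=> [[c [I [oI I0 sc cM c0] <-]]|vS]; last first.
    have [Vx xK] := UV x Ux; rewrite -(Kphi x v Ux) -{1}xK.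
    by apply: tV => //; exact/(MS x Ux).1.
  have cD : is_derive (0 : R) (1 : R) c (derive1 c 0).
    rewrite derive1E; apply: derivableP; apply/derivable1_diffP.
    exact: smooth_on_differentiable sc I0.
  (* A curve in [M] is carried by [phi] into the subspace, so the image velocity belongs to the
     subspace too. *)
  have := @is_derive_chain _ _ _ phi _ _ _ cD; rewrite c0 => /(_ (dphi x Ux)) pcD.
  apply: is_derive_vspace pcD _.
  have cc : {for 0 : R, continuous c} by exact: smooth_on_continuous sc I0.
  have nU : nbhs (0 : R) (c @^-1` U).
    by apply: cc; rewrite c0; exact: open_nbhs_nbhs.
  apply: filterS2 nU (open_nbhs_nbhs (conj oI I0)) => s Us Is /=.
  by apply/(MS _ Us); exact: cM.
- by move=> x v /inU; exact: Kphi.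
- move=> w a wr; have Vw := inV _ wr; have [Up pK] := VU _ Vw.
  have := @derive_inverse V psi phi w a oV Vw (fun y Vy => (VU y Vy).2)
    (dpsi _ Vw) (dphi _ Up) => E.
  rewrite -[X in frob X <= _]E.
  have pz : frob (psi w - z) < r1.
    rewrite -[z in psi w - z]psiz.
    have h2 := bounded_derive_lipschitz (tame_bounded t2) (lt_le_trans wr rr2).
    apply: le_lt_trans (h2 (phi z) _) _; first by rewrite subrr frob0.
    apply: (@le_lt_trans _ _ (C * frob (w - phi z))).
      by rewrite ler_wpM2r ?frob_ge0.
    apply: (@lt_le_trans _ _ (C * r)); first by rewrite ltr_pM2l.
    apply: (@le_trans _ _ (C * (r5 / C))); last first.
      rewrite mulrC divfK ?gt_eqF//.
      by rewrite /r5 !ge_min lexx.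
    by rewrite ler_pM2l// /r ge_min lexx orbT.
  have [_ /(_ ('D_a psi w)) h1] := tame_bounded t1 pz.
  by apply: le_trans h1 _; rewrite ler_wpM2r ?frob_ge0.
Qed.

End charts.

Section chart_consequences.
Context {R : realType} {m n : nat}.
Variables (M : set 'M[R]_(m, n)) (z : 'M[R]_(m, n)) (r C : R)
  (phi psi : 'M[R]_(m, n) -> 'M[R]_(m, n)) (S : {vspace 'M[R]_(m, n)}).
Hypothesis ch : chart M z r C phi psi S.

Lemma chart_C0 : 0 < C.
Proof. exact: lt_le_trans (chart_C ch). Qed.

Lemma chart_phi_lipschitz x y : frob (x - z) < r -> frob (y - z) < r ->
  frob (phi x - phi y) <= C * frob (x - y).
Proof. exact: (bounded_derive_lipschitz (tame_bounded (chart_phi ch))). Qed.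

Lemma chart_psi_lipschitz x y : frob (x - phi z) < r -> frob (y - phi z) < r ->
  frob (psi x - psi y) <= C * frob (x - y).
Proof. exact: (bounded_derive_lipschitz (tame_bounded (chart_psi ch))). Qed.

Lemma chart_center : frob (z - z) < r.
Proof. by rewrite subrr frob0 (chart_r ch). Qed.

Lemma chart_phi_near x (d : R) : d <= r -> frob (x - z) < d / C ->
  frob (x - z) < r /\ frob (phi x - phi z) < d.
Proof.
move=> dr xd; have xr : frob (x - z) < r.
  apply: lt_le_trans xd _; rewrite ler_pdivrMr ?chart_C0//.
  apply: le_trans dr _; apply: ler_peMr; first exact: ltW (chart_r ch).
  exact: chart_C ch.
split=> //; apply: le_lt_trans (chart_phi_lipschitz xr chart_center) _.
by rewrite mulrC -ltr_pdivlMr// chart_C0.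
Qed.

(** Inside a chart ball [M] is the preimage of a closed linear subspace under a Lipschitz map. A
    submanifold need not be closed globally, so closedness is available in this local form. *)
Lemma chart_closed x : frob (x - z) < r ->
  (forall e : R, 0 < e -> exists2 y, M y & frob (x - y) <= e) -> M x.
Proof.
move=> xr Mx; apply/(chart_M ch xr); apply: vspace_closed => e e0.
pose e' := Num.min (e / C) ((r - frob (x - z)) / 2).
have e'0 : 0 < e' by rewrite lt_min !divr_gt0 ?chart_C0 ?subr_gt0.
have [y My xy] := Mx _ e'0.
have yr : frob (y - z) < r.
  apply: le_lt_trans (frob_dist_triangle x _ _) _; rewrite frob_distC.
  apply: (@le_lt_trans _ _ ((r - frob (x - z)) / 2 + frob (x - z))).
    by rewrite lerD2r (le_trans xy)// /e' ge_min lexx orbT.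
  by move: xr; lra.
exists (phi y); first exact/(chart_M ch yr).
apply: le_trans (chart_phi_lipschitz xr yr) _.
rewrite mulrC -ler_pdivlMr ?chart_C0// (le_trans xy)//.
by rewrite /e' ge_min lexx.
Qed.

(** The case [y = x], [b = 0] of [tame_quad], where the second remainder vanishes. *)
Lemma tame_quad0 h x0 (r0 C0 : R) x a : tame (h : 'M[R]_(m, n) -> 'M[R]_(m, n)) x0 r0 C0 ->
  frob (x - x0) < r0 -> frob (x + a - x0) < r0 ->
  frob (h (x + a) - h x - 'D_a h x) <= C0 * frob a ^+ 2.
Proof.
move=> th xr xar; have x0r : frob (x + 0 - x0) < r0 by rewrite [x + 0]addr0.
have := tame_quad th xr xr xar x0r x0r.
have -> : h (x + 0) - h x - 'D_0 h x = 0 by rewrite addr0 derive0 !subrr.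
by rewrite [X in frob X <= _]subr0 [a - 0]subr0 frob0 expr0n mul0r add0r addr0 expr2.
Qed.

End chart_consequences.

Section tangent_space.
Context {R : realType} {m n : nat} (d : nat) (M : set 'M[R]_(m, n)).
Hypothesis eM : embedded_submanifold d M.

(** Velocities of curves carry no evident linear structure; it is read off in a chart, where the
    tangent space is the preimage of [S] under the derivative of [phi]. *)
Lemma tangent_lin x (k : R) u v : M x -> tangent M x u -> tangent M x v ->
  tangent M x (k *: u + v).
Proof.
move=> Mx; have [r [C [phi [psi [S ch]]]]] := chart_exists eM Mx.
have xr := chart_center ch.
move=> /(chart_tangentP ch _ xr Mx) uS /(chart_tangentP ch _ xr Mx) vS.
apply/(chart_tangentP ch _ xr Mx).
have [dphi _] := tame_bounded (chart_phi ch) xr.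
rewrite (derive_dirD _ _ dphi) (derive_dirZ _ _ dphi).
exact: (memvD (memvZ k uS) vS).
Qed.

Lemma tangent0 x : M x -> tangent M x 0.
Proof.
move=> Mx; have [r [C [phi [psi [S ch]]]]] := chart_exists eM Mx.
apply/(chart_tangentP ch _ (chart_center ch) Mx); by rewrite derive0 mem0v.
Qed.

Lemma tangentZ x (k : R) v : M x -> tangent M x v -> tangent M x (k *: v).
Proof.
by move=> Mx Tv; have := tangent_lin k Mx Tv (tangent0 Mx); rewrite addr0.
Qed.

Lemma tangent_sum x (I : Type) (s : seq I) (P : pred I) (F : I -> 'M[R]_(m, n)) :
  M x -> (forall i, tangent M x (F i)) -> tangent M x (\sum_(i <- s | P i) F i).
Proof.
move=> Mx TF; elim/big_ind : _ => //; first exact: tangent0.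
by move=> u v Tu Tv; have := tangent_lin 1 Mx Tu Tv; rewrite scale1r.
Qed.

End tangent_space.

(** * Taylor estimates for smooth curves *)

Section taylor.
Context {R : realType} {m n : nat} (c c1 c2 c3 : R -> 'M[R]_(m, n)).

Lemma is_derive_affine (g : R -> 'M[R]_(m, n)) (a b s : R) dg :
  is_derive (a + s * b) (1 : R) g dg ->
  is_derive s (1 : R) (fun s => g (a + s * b)) (b *: dg).
Proof.
move=> gD; have [gd gE] := gD.
have dg' : differentiable g (a + s * b) by exact/derivable1_diffP.
have := @is_derive_chain _ _ _ g _ s b (is_derive_line (a : R^o) b s) dg'.
suff -> : 'D_b g (a + s * b) = b *: dg by [].
by rewrite -gE -(derive_dirZ _ _ dg') /GRing.scale/= mulr1.
Qed.

Hypothesis D0 : forall s, is_derive s (1 : R) c (c1 s).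
Hypothesis D1 : forall s, is_derive s (1 : R) c1 (c2 s).
Hypothesis D2 : forall s, is_derive s (1 : R) c2 (c3 s).

(** Each Taylor bound is the mean value inequality for a curve minus its Taylor polynomial. For the
    second difference the symmetric function [c (s + x) + c (s - x)] cancels the odd terms and
    leaves an error of third order. Halving [d] keeps [s + t] and [s - t] in the interval. *)
Lemma taylor_bounds (s0 d K : R) : 0 < K ->
  (forall s, `|s - s0| < d -> frob (c2 s) <= K) ->
  (forall s, `|s - s0| < d -> frob (c3 s) <= K) ->
  forall s t, `|s - s0| < d / 2 -> 0 <= t < d / 2 ->
  [/\ frob (c2 s) <= K,
      frob (c (s + t) - c s - t *: c1 s) <= K * t ^+ 2 &
      frob (c (s + t) - c s - (c s - c (s - t)) - t ^+ 2 *: c2 s)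
        <= 2 * K * t ^+ 3].
Proof.
move=> K0 b2 b3.
have lip s s' : `|s - s0| < d -> `|s' - s0| < d -> s <= s' ->
    frob (c2 s' - c2 s) <= K * (s' - s).
  move=> sd s'd ss'; apply: (frob_mean_value ss' (fun x _ => D2 x)) => x xs.
  by apply: b3; move: sd s'd xs; rewrite !ltr_norml; lra.
move=> s t sd /andP[t0 td].
have nearx x : 0 <= x <= t -> `|s + x - s0| < d /\ `|s - x - s0| < d.
  by move: sd; rewrite !ltr_norml => sd xt; split; move: sd xt td; lra.
have plus f df x : (forall s, is_derive s (1 : R) f (df s)) ->
    is_derive x (1 : R) (fun x => f (s + x * 1)) (df (s + x * 1) : 'M[R]_(m, n)).
  by move=> fD; have := is_derive_affine (fD (s + x * 1)); rewrite scale1r.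
have minus f df x : (forall s, is_derive s (1 : R) f (df s)) ->
    is_derive x (1 : R) (fun x => f (s + x * -1)) (- df (s + x * -1) : 'M[R]_(m, n)).
  by move=> fD; have := is_derive_affine (fD (s + x * -1)); rewrite scaleN1r.
have lin (v : 'M[R]_(m, n)) (x : R) : is_derive x (1 : R) (fun x : R => 0 + x *: v) v.
  exact: is_derive_line.
split.
- by apply: b2; move: sd; rewrite !ltr_norml; lra.
- pose g x := c (s + x * 1) - (0 + x *: c1 s).
  have -> : c (s + t) - c s - t *: c1 s = g t - g 0.
    rewrite /g mulr1 mul0r addr0 scale0r !add0r subr0.
    by rewrite addrAC.
  rewrite expr2 mulrA -[X in _ <= _ * X]subr0.
  have gD x : is_derive x (1 : R) g (c1 (s + x * 1) - c1 s).
    exact: (is_deriveB (plus _ _ x D0) (lin _ x)).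
  apply: (frob_mean_value t0 (fun x _ => gD x)) => x xt.
  case/andP : (xt) => x0 xt'; rewrite mulr1.
  apply: (@le_trans _ _ (K * (s + x - s))); last first.
    by rewrite addrAC subrr add0r ler_wpM2l// ltW.
  apply: (frob_mean_value _ (fun y _ => D1 y)) => [|y ys]; first by rewrite lerDl.
  by apply: b2; move: sd xt td ys; rewrite !ltr_norml; lra.
pose v := c2 s.
(* This is the derivative of the last function [g] below, so a quadratic bound here gives the cubic
   one there. *)
have key x : 0 <= x <= t -> frob (c1 (s + x * 1) - c1 (s + x * -1) - (2 * x) *: v)
    <= 2 * K * x * x.
  move=> /andP[x0 xt].
  pose g x := c1 (s + x * 1) - c1 (s + x * -1) - (0 + x *: (2 *: v)).
  have -> : c1 (s + x * 1) - c1 (s + x * -1) - (2 * x) *: v = g x - g 0.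
    rewrite /g !mul0r addr0 subrr scale0r !add0r !oppr0 addr0.
    by rewrite scalerA [x * 2]mulrC.
  rewrite -[X in _ <= _ * X]subr0.
  have gD y : is_derive y (1 : R) g (c2 (s + y * 1) - - c2 (s + y * -1) - 2 *: v).
    exact: (is_deriveB (is_deriveB (plus _ _ y D1) (minus _ _ y D1)) (lin _ y)).
  apply: (frob_mean_value x0 (fun y _ => gD y)) => y yx.
  have [n1 n2] : `|s + y - s0| < d /\ `|s - y - s0| < d.
    by apply: nearx; move: yx xt; lra.
  have sd' : `|s - s0| < d by move: sd; rewrite !ltr_norml; lra.
  rewrite mulr1 mulrN1 opprK scaler_nat mulr2n opprD addrACA.
  apply: le_trans (frobD _ _) _.
  have y0 : 0 <= y by case/andP : yx.
  have h1 : frob (c2 (s + y) - v) <= K * y.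
    have := lip _ _ sd' n1; rewrite [s + y - s]addrAC subrr add0r; apply.
    by rewrite lerDl.
  have h2 : frob (c2 (s - y) - v) <= K * y.
    rewrite frob_distC; have := lip _ _ n2 sd'; rewrite opprB subrKC; apply.
    by rewrite gerBl.
  apply: le_trans (lerD h1 h2) _; rewrite -mulrDr (mulrC 2) -!mulrA ler_pM2l//.
  by case/andP : yx; lra.
pose g x := c (s + x * 1) + c (s + x * -1) - (0 + (x * x) *: v).
have -> : c (s + t) - c s - (c s - c (s - t)) - t ^+ 2 *: c2 s = g t - g 0.
  rewrite /g -/v mulr1 mulrN1 !mul0r addr0 scale0r !add0r subr0.
  move: (c (s + t)) (c s) (c (s - t)) => p1 p2 p3.
  by apply/matrixP => i j; rewrite !mxE; ring.
rewrite (_ : 2 * K * t ^+ 3 = 2 * K * t * t * (t - 0)); last by ring.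
have qD x : is_derive x (1 : R) (fun x : R => 0 + (x * x) *: v) ((2 * x) *: v).
  have sq : is_derive x (1 : R) (fun x : R => x * x) (2 * x).
    have := is_deriveM (is_derive_id x (1 : R)) (is_derive_id x (1 : R)).
    by move=> /is_derive_eq; apply; rewrite /GRing.scale/=; ring.
  have df y : differentiable (fun y : R => 0 + y *: v) y.
    by apply/derivable1_diffP; case: (lin v y).
  have := @is_derive_chain _ _ _ (fun y : R => 0 + y *: v) (fun x : R => x * x) x _ sq.
  move=> /(_ (df _))/is_derive_eq; apply.
  have [_ lE] := lin v (x * x); rewrite -[in RHS]lE -(derive_dirZ _ _ (df _)).
  by rewrite /GRing.scale/= mulr1.
have gD x : is_derive x (1 : R) g (c1 (s + x * 1) + - c1 (s + x * -1) - (2 * x) *: v).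
  exact: (is_deriveB (is_deriveD (plus _ _ x D0) (minus _ _ x D0)) (qD x)).
apply: (frob_mean_value t0 (fun x _ => gD x)) => x xt.
apply: le_trans (key x xt) _; case/andP : xt => x0 xt.
by rewrite -!mulrA !ler_pM2l// ler_pM.
Qed.

End taylor.

Section smooth_curves.
Context {R : realType} {m n : nat} (c : R -> 'M[R]_(m, n)).
Hypothesis sc : smooth_on setT c.

Lemma smooth_derive1n k : smooth_on setT (derive1n k c).
Proof.
elim: k => [//|k IH]; rewrite derive1nS.
have -> : (derive1n k c)^`()%classic = 'D_1 (derive1n k c).
  by apply/funext => s; rewrite derive1E.
exact: smooth_on_derive.
Qed.

Lemma is_derive_derive1n k s : is_derive s (1 : R) (derive1n k c) (derive1n k.+1 c s).
Proof.
rewrite derive1nS derive1E; apply: derivableP; apply/derivable1_diffP.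
exact: (smooth_on_differentiable (smooth_derive1n k)).
Qed.

Lemma derive1n_locally_bounded k s0 : exists2 K : R, 0 < K & exists2 d : R, 0 < d &
  forall s, `|s - s0| < d -> frob (derive1n k c s) <= K.
Proof.
exists (frob (derive1n k c s0) + 1); first by rewrite ltr_wpDl ?frob_ge0.
have cD : {for s0, continuous (derive1n k c)}.
  exact: smooth_on_continuous (smooth_derive1n k) _.
have nb : nbhs (derive1n k c s0) [set y | frob (y - derive1n k c s0) < 1].
  by apply/nbhs_frobP; exists 1.
have Hn : nbhs s0 [set s | frob (derive1n k c s - derive1n k c s0) < 1] by exact: (cD _ nb).
move/nbhs_normP : Hn => [d /= d0 dP]; exists d => // s sd.
apply: le_trans (frob_le_distD _ (derive1n k c s0)) _.
by rewrite lerD2l ltW//; apply: dP => /=; rewrite distrC.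
Qed.

Lemma curve_taylor s0 : exists2 K : R, 0 < K & exists2 d : R, 0 < d &
  forall s t, `|s - s0| < d -> 0 <= t < d ->
  [/\ frob (derive1n 2 c s) <= K,
      frob (c (s + t) - c s - t *: derive1n 1 c s) <= K * t ^+ 2 &
      frob (c (s + t) - c s - (c s - c (s - t)) - t ^+ 2 *: derive1n 2 c s)
        <= 2 * K * t ^+ 3].
Proof.
have [K2 K20 [d2 d20 B2]] := derive1n_locally_bounded 2 s0.
have [K3 K30 [d3 d30 B3]] := derive1n_locally_bounded 3 s0.
pose K := K2 + K3; have K2K : K2 <= K by rewrite lerDl ltW.
have K3K : K3 <= K by rewrite lerDr ltW.
pose d := Num.min d2 d3; have d0 : 0 < d by rewrite lt_min d20.
exists K; first exact: addr_gt0.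
exists (d / 2); first by rewrite divr_gt0.
apply: (@taylor_bounds _ _ _ c _ _ _ (is_derive_derive1n 0) (is_derive_derive1n 1)
  (is_derive_derive1n 2)); first exact: addr_gt0.
  by move=> s; rewrite lt_min => /andP[/B2 H _]; exact: le_trans K2K.
by move=> s; rewrite lt_min => /andP[_ /B3 H]; exact: le_trans K3K.
Qed.

End smooth_curves.

(** * Geodesics *)

(** [t] stands for the square of a time step, [A] and [B] for the forward and backward increments,
    [D1] and [D2] for their tangential linear parts. Pairing with the normal vector [v] removes
    [D1 + D2], so that [v] is governed by the quadratic errors [q] and the Taylor error [e]. *)
Lemma normal_second_difference {R : realType} {m n : nat}
    (v A B D1 D2 : 'M[R]_(m, n)) (t q e : R) :
  0 < frob v -> mxdot v (D1 + D2) = 0 ->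
  frob (A - D1) <= q -> frob (B - D2) <= q -> frob (A - - B - t *: v) <= e ->
  t * frob v <= q + q + e.
Proof.
move=> v0 vD h1 h2 h3; rewrite -(ler_pM2l v0).
have -> : frob v * (t * frob v) =
    mxdot v (A - D1) + mxdot v (B - D2) + mxdot v (- (A - - B - t *: v)).
  move: vD; rewrite mulrCA -expr2 sqr_frob mxdotDr mxdotNr !mxdotBr mxdotNr mxdotZr.
  by lra.
have h4 : frob (- (A - - B - t *: v)) <= e by rewrite frobN.
by rewrite !mulrDr !lerD//; apply: le_trans (mxdot_le _ _) _; rewrite ler_pM2l.
Qed.

Section geodesics.
Context {R : realType} {m n : nat} (M : set 'M[R]_(m, n)) (c : R -> 'M[R]_(m, n)).
Hypothesis gc : geodesic M c.

Lemma geodesic_smooth : smooth_on setT c.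
Proof. by case: gc. Qed.

Lemma geodesic_M s : M (c s).
Proof. by case: gc. Qed.

Lemma geodesic_is_derive s : is_derive s (1 : R) c (derive1 c s).
Proof. exact: (is_derive_derive1n geodesic_smooth 0). Qed.

Lemma geodesic_tangent s : tangent M (c s) (derive1 c s).
Proof.
have dc : differentiable c (s + (0 : R) *: (1 : R^o)).
  exact: (smooth_on_differentiable geodesic_smooth).
exists (fun t : R => c (s + t *: (1 : R^o))).
  exists setT; split=> //; first exact: openT.
  - exact: (smooth_on_line s (1 : R^o) openT geodesic_smooth).
  - by move=> t _; exact: geodesic_M.
  - by rewrite scale0r addr0.
rewrite derive1E; have [_ ->] := is_derive_along_line dc.
by rewrite scale0r addr0 derive1E.
Qed.

(** The derivative of the squared speed is twice the product of acceleration and velocity, and the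
    velocity is tangent. *)
Lemma geodesic_speed s : frob (derive1 c s) = frob (derive1 c 0).
Proof.
have h t : is_derive t (1 : R) (fun t => mxdot (derive1 c t) (derive1 c t)) 0.
  have D1 := is_derive_derive1n geodesic_smooth 1 t.
  have := is_derive_mxdot D1 D1.
  have [_ _ acc] := gc; have a0 := acc _ _ (geodesic_tangent t).
  by rewrite [X in _ + X]mxdotC [X in X + _]a0 [X in _ + X]a0 addr0.
by have := is_derive_0_is_cst s 0 h; rewrite /frob => ->.
Qed.

Lemma geodesic_lipschitz s t :
  frob (c s - c t) <= frob (derive1 c 0) * `|s - t|.
Proof.
wlog st : s t / t <= s.
  move=> H; have [ts|/ltW st] := leP t s; first exact: H.
  by rewrite frob_distC distrC; exact: H.
rewrite ger0_norm ?subr_ge0//.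
apply: (frob_mean_value st (fun s _ => geodesic_is_derive s)) => x _.
by rewrite geodesic_speed.
Qed.

(* The tangential part of a second difference of [c] is killed by [c''], and
   its normal part is quadratic in the increments. *)
Lemma geodesic_acceleration z r C phi psi S s : chart M z r C phi psi S ->
  frob (c s - z) < r / C ->
  frob (derive1n 2 c s) <= 2 * C ^+ 3 * frob (derive1 c 0) ^+ 2.
Proof.
move=> ch csz; set v := derive1n 2 c s; set sg := frob (derive1 c 0).
have C0 := chart_C0 ch.
have [K K0 [d d0 T]] := curve_taylor geodesic_smooth s.
have [v0|v0] := eqVneq (frob v) 0.
  by rewrite v0 mulr_ge0 ?sqr_ge0// mulr_ge0 ?exprn_ge0 ?(ltW C0).
have {}v0 : 0 < frob v by rewrite lt_def v0 frob_ge0.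
apply/ler_addgt0Pr => e e0.
pose gap := r / C - frob (c s - z).
have gap0 : 0 < gap by rewrite subr_gt0.
have sg0 : 0 <= sg by exact: frob_ge0.
(* The three bounds keep [t] in the range of the Taylor estimates, push the cubic error below
   [e * t ^+ 2], and hold [c (s + t)] and [c (s - t)] inside the chart. *)
pose t := Num.min (Num.min (d / 2) (e / (2 * K))) (gap / (2 * (sg + 1))).
have t0 : 0 < t.
  by rewrite !lt_min !divr_gt0// ?mulr_gt0// ltr_wpDl.
have td : 0 <= t < d.
  rewrite ltW//= (@le_lt_trans _ _ (d / 2)) ?ltr_pdivrMr ?ltr_pMr ?ltr1n//.
  by rewrite /t !ge_min lexx.
have ss : `|s - s| < d by rewrite subrr normr0.
have [_ _ T2] := T s t ss td.
have tg : sg * t < gap.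
  have tl : t <= gap / (2 * (sg + 1)) by rewrite /t !ge_min lexx orbT.
  apply: (@le_lt_trans _ _ (sg * (gap / (2 * (sg + 1))))); first by rewrite ler_wpM2l.
  rewrite mulrCA -subr_gt0 -[X in X - _](mulr1 gap) -mulrBr mulr_gt0// subr_gt0.
  by rewrite ltr_pdivrMr ?mul1r ?mulr_gt0 ?ltr_wpDl//; move: sg0; lra.
have near t' : `|t'| <= t -> frob (c (s + t') - z) < r / C.
  move=> t't; apply: le_lt_trans (frob_dist_triangle (c s) _ _) _.
  have l1 : frob (c (s + t') - c s) <= sg * `|s + t' - s| := geodesic_lipschitz _ _.
  rewrite addrAC subrr add0r in l1.
  apply: (@le_lt_trans _ _ (sg * t + frob (c s - z))).
    by rewrite lerD2r (le_trans l1)// ler_wpM2l.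
  by rewrite -ltrBrDr.
pose W t' := phi (c (s + t')).
have W0 : W 0 = phi (c s) by rewrite /W addr0.
have inr t' : `|t'| <= t -> frob (c (s + t') - z) < r /\ frob (W t' - phi z) < r.
  by move=> /near; exact: (chart_phi_near ch (lexx r)).
have WS t' : `|t'| <= t -> W t' \in S.
  by move=> /inr[h1 _]; apply/(chart_M ch h1); exact: geodesic_M.
have z0t : `|0 : R| <= t by rewrite normr0 ltW.
have ptt : `|t| <= t by rewrite gtr0_norm.
have ntt : `|- t| <= t by rewrite normrN gtr0_norm.
have [cr wr] := inr _ z0t; rewrite addr0 in cr; rewrite W0 in wr.
have psiW t' : `|t'| <= t -> psi (W t') = c (s + t').
  by move=> /inr[h1 _]; exact: (chart_phiK ch).
have dpsi : differentiable psi (phi (c s)).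
  by case: (tame_bounded (chart_psi ch) wr).
have Q t' : `|t'| <= t ->
    frob (c (s + t') - c s - 'D_(W t' - phi (c s)) psi (phi (c s)))
      <= C ^+ 3 * sg ^+ 2 * t ^+ 2.
  move=> tt; have [h1 h2] := inr _ tt.
  have := @tame_quad0 _ _ _ psi (phi z) r C (phi (c s)) (W t' - phi (c s)) (chart_psi ch) wr.
  rewrite subrKC psiW// (chart_phiK ch cr) => /(_ h2) h.
  apply: le_trans h _.
  rewrite (_ : C ^+ 3 * sg ^+ 2 * t ^+ 2 = C * (C * (sg * t)) ^+ 2); last by ring.
  rewrite ler_pM2l//.
  have l1 : frob (W t' - phi (c s)) <= C * (sg * t).
    apply: le_trans (chart_phi_lipschitz ch h1 cr) _; rewrite ler_pM2l//.
    apply: le_trans (geodesic_lipschitz _ _) _; rewrite ler_wpM2l//.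
    by rewrite addrAC subrr add0r.
  rewrite ler_pXn2r ?nnegrE ?frob_ge0//.
  by rewrite !mulr_ge0 ?(ltW t0) ?(ltW C0).
have key : mxdot v ('D_(W t - phi (c s)) psi (phi (c s))
    + 'D_(W (- t) - phi (c s)) psi (phi (c s))) = 0.
  have [_ _ acc] := gc; rewrite -derive_dirD//; apply: acc.
  rewrite -{1}(chart_phiK ch cr); apply: (chart_derive_psi ch wr).
    by rewrite -W0; exact: WS.
  by apply: memvD; apply: memvB; rewrite -?W0; exact: WS.
have bound : t ^+ 2 * frob v <= C ^+ 3 * sg ^+ 2 * t ^+ 2 + C ^+ 3 * sg ^+ 2 * t ^+ 2
    + 2 * K * t ^+ 3.
  apply: normal_second_difference v0 key (Q _ ptt) (Q _ ntt) _.
  by rewrite -[c s - c (s - t)]opprB in T2.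
have tK : 2 * K * t <= e.
  rewrite mulrC -ler_pdivlMr ?mulr_gt0//.
  by rewrite /t !ge_min lexx orbT.
have t20 : 0 < t ^+ 2 by rewrite exprn_gt0.
have h : t ^+ 2 * frob v <= t ^+ 2 * (2 * C ^+ 3 * sg ^+ 2 + 2 * K * t).
  apply: le_trans bound _.
  by rewrite le_eqVlt; apply/orP; left; apply/eqP; ring.
rewrite ler_pM2l// in h; apply: le_trans h _.
by rewrite lerD2l.
Qed.

End geodesics.

Section increments.
Context {R : realType} {m n : nat}.

(** Passing through the increment [b] at [x] separates the change of base point from the change of
    increment. *)
Lemma tame_increment (h : 'M[R]_(m, n) -> 'M[R]_(m, n)) z (r C : R) x y a b :
  tame h z r C -> frob (x - z) < r -> frob (y - z) < r ->
  frob (x + a - z) < r -> frob (x + b - z) < r -> frob (y + b - z) < r ->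
  frob (h (x + a) - h x - (h (y + b) - h y)) <= C * frob b * frob (x - y) + C * frob (a - b).
Proof.
move=> th xz yz xa xb yb.
have h1 := tame_mixed th xz yz xb yb.
have h2 := bounded_derive_lipschitz (tame_bounded th) xa xb.
rewrite opprD addrACA subrr add0r in h2.
have -> : h (x + a) - h x - (h (y + b) - h y) =
    (h (x + b) - h x - (h (y + b) - h y)) + (h (x + a) - h (x + b)).
  move: (h _) (h _) (h _) (h _) (h _) => p1 p2 p3 p4 p5.
  by apply/matrixP => i j; rewrite !mxE; ring.
by apply: le_trans (frobD _ _) _; exact: lerD.
Qed.

End increments.

(** * Stability of discrete geodesics *)

Section discrete_step.
Context {R : realType} {m n : nat}.

(** [Dw] and [DW] are images of one chart vector of size [a], the unknown difference of second
    differences, at two base points [g] apart; [Ew] and [EW] are likewise the images of a known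
    second difference of size [h]. Testing the exact equation with [Dw] and the approximate one with
    [DW] and subtracting isolates the square of [Dw]; every other term has a factor [a], which the
    immersion bound [a <= C * frob Dw] allows to cancel. *)
Lemma weak_difference_bound (Dw DW Ew EW q q' : 'M[R]_(m, n)) (C a g h e : R) :
  1 <= C -> 0 <= a -> 0 <= g -> 0 <= h ->
  mxdot (Dw + Ew + q) Dw = 0 -> `|mxdot (EW + q') DW| <= e * frob DW ->
  0 <= e -> frob (Dw - DW) <= C * a * g -> frob (Ew - EW) <= C * h * g ->
  frob Dw <= C * a -> frob DW <= C * a -> frob EW <= C * h -> a <= C * frob Dw ->
  a <= C ^+ 3 * (frob (q - q') + frob q' * g + e + 2 * C * h * g).
Proof.
move=> C1 a0 g0 h0 H1 H2 e0 dD dE bDw bDW bEW ha.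
have C0 : 0 < C by lra.
set X := (X in _ <= _ * X).
have qq0 := frob_ge0 (q - q'); have q0 := frob_ge0 q'.
have X0 : 0 <= X.
  rewrite /X; apply: addr_ge0; first apply: addr_ge0 => //.
    by apply: addr_ge0 => //; apply: mulr_ge0.
  by rewrite !mulr_ge0// ltW.
have key : frob Dw ^+ 2 <= C * a * X.
  have -> : frob Dw ^+ 2 = - mxdot (q - q') Dw - mxdot q' (Dw - DW)
      - mxdot (Ew - EW) Dw - mxdot EW (Dw - DW) - mxdot (EW + q') DW.
    move: H1; rewrite sqr_frob !mxdotDl !mxdotDr !mxdotNr !mxdotNl; lra.
  have Ca0 : 0 <= C * a by rewrite mulr_ge0// ltW.
  have i1 : - mxdot (q - q') Dw <= frob (q - q') * (C * a).
    rewrite -mxdotNl; apply: le_trans (mxdot_le _ _) _.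
    by rewrite frobN; apply: ler_wpM2l.
  have i2 : - mxdot q' (Dw - DW) <= frob q' * (C * a * g).
    rewrite -mxdotNl; apply: le_trans (mxdot_le _ _) _.
    by rewrite frobN; apply: ler_wpM2l.
  have i3 : - mxdot (Ew - EW) Dw <= (C * h * g) * (C * a).
    rewrite -mxdotNl; apply: le_trans (mxdot_le _ _) _.
    by rewrite frobN; apply: ler_pM => //; exact: frob_ge0.
  have i4 : - mxdot EW (Dw - DW) <= (C * h) * (C * a * g).
    rewrite -mxdotNl; apply: le_trans (mxdot_le _ _) _.
    by rewrite frobN; apply: ler_pM => //; exact: frob_ge0.
  have i5 : - mxdot (EW + q') DW <= e * (C * a).
    apply: le_trans (_ : e * frob DW <= _); last exact: ler_wpM2l.
    by apply: le_trans H2; rewrite -normrN; exact: ler_norm.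
  have -> : C * a * X = frob (q - q') * (C * a) + frob q' * (C * a * g)
      + (C * h * g) * (C * a) + (C * h) * (C * a * g) + e * (C * a).
    by rewrite /X; ring.
  lra.
have [a0'|a0'] := eqVneq a 0; first by rewrite a0' mulr_ge0// exprn_ge0// ltW.
have {a0'}a0 : 0 < a by rewrite lt_def a0'.
rewrite -(ler_pM2l a0) -expr2.
apply: (@le_trans _ _ ((C * frob Dw) ^+ 2)).
  by rewrite ler_pXn2r ?nnegrE ?mulr_ge0 ?frob_ge0// ltW.
rewrite exprMn (_ : a * (C ^+ 3 * X) = C ^+ 2 * (C * a * X)); last by ring.
by rewrite ler_pM2l// exprn_gt0.
Qed.

Variables (M : set 'M[R]_(m, n)) (z : 'M[R]_(m, n)) (r C : R)
  (phi psi : 'M[R]_(m, n) -> 'M[R]_(m, n)) (S : {vspace 'M[R]_(m, n)}).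
Hypothesis ch : chart M z r C phi psi S.

Let near w := w \in S /\ frob (w - phi z) < r / 4.

Let near_r w : near w -> frob (w - phi z) < r.
Proof. by move=> [_ h]; have := chart_r ch; lra. Qed.

Let near_add w w1 w2 : near w -> near w1 -> near w2 ->
  frob (w + (w1 - w2) - phi z) < r.
Proof.
move=> [_ h] [_ h1] [_ h2].
have -> : w + (w1 - w2) - phi z = (w - phi z) + ((w1 - phi z) - (w2 - phi z)).
  by move: (phi z) => u; apply/matrixP => i j; rewrite !mxE; ring.
apply: le_lt_trans (frobD _ _) _; have := frobB (w1 - phi z) (w2 - phi z).
by have := chart_r ch; lra.
Qed.

(** The second differences of [psi w] and [psi v] are expanded at the middle points into the
    derivative of [psi] applied to a second difference, plus quadratic remainders. Both equations
    are tested with ['D_a psi], where [a] is the difference of the second differences in the chart;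
    since [a] lies in [S], these test vectors are tangent. *)
Lemma chart_step w0 w1 w2 v0 v1 v2 (e : R) :
  near w0 -> near w1 -> near w2 -> near v0 -> near v1 -> near v2 -> 0 <= e ->
  (forall u, tangent M (psi w1) u ->
     mxdot (psi w2 - psi w1 - (psi w1 - psi w0)) u = 0) ->
  (forall u, tangent M (psi v1) u ->
     `|mxdot (psi v2 - psi v1 - (psi v1 - psi v0)) u| <= e * frob u) ->
  forall g b G2 G1 : R, g = frob (w1 - v1) ->
  b = frob (v2 - v1) ^+ 2 + frob (v1 - v0) ^+ 2 + frob (v2 - v1 - (v1 - v0)) ->
  G2 = (frob (w2 - w1) + frob (v2 - v1)) * frob (w2 - w1 - (v2 - v1)) ->
  G1 = (frob (w1 - w0) + frob (v1 - v0)) * frob (w1 - w0 - (v1 - v0)) ->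
  frob (w2 - w1 - (w1 - w0) - (v2 - v1 - (v1 - v0))) <=
  2 * C ^+ 4 * (b * g + G2 + G1 + e).
Proof.
move=> n0 n1 n2 k0 k1 k2 e0 Hw Hv g b G2 G1 gE bE G2E G1E.
have C1 := chart_C ch; have C0 := chart_C0 ch.
have tp := chart_psi ch.
set eta' := v2 - v1 - (v1 - v0).
set a := w2 - w1 - (w1 - w0) - eta'.
have S_ w : near w -> w \in S by case.
have etaS : eta' \in S by do ?apply: memvB; exact: S_.
have aS : a \in S by apply: memvB => //; do ?apply: memvB; exact: S_.
have dif w : near w -> differentiable psi w.
  by move=> /near_r/(tame_bounded tp)[].
have bD w u : near w -> frob ('D_u psi w) <= C * frob u.
  by move=> /near_r/(tame_bounded tp)[_].
pose Q w u := psi (w + u) - psi w - 'D_u psi w.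
pose q := Q w1 (w2 - w1) + Q w1 (w0 - w1).
pose q' := Q v1 (v2 - v1) + Q v1 (v0 - v1).
have split_ x0 x1 x2 : near x1 ->
    psi x2 - psi x1 - (psi x1 - psi x0) =
    'D_(x2 - x1 - (x1 - x0)) psi x1 + (Q x1 (x2 - x1) + Q x1 (x0 - x1)).
  move=> nx; rewrite /Q !subrKC.
  have -> : x2 - x1 - (x1 - x0) = (x2 - x1) + (x0 - x1) by rewrite opprB.
  rewrite (derive_dirD _ _ (dif _ nx)).
  move: ('D_(x2 - x1) psi x1) ('D_(x0 - x1) psi x1) (psi x0) (psi x1) (psi x2).
  by move=> p1 p2 p3 p4 p5; apply/matrixP => i j; rewrite !mxE; ring.
have H1 : mxdot ('D_a psi w1 + 'D_eta' psi w1 + q) ('D_a psi w1) = 0.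
  rewrite -(derive_dirD _ _ (dif _ n1)) [a + eta']subrK -split_//; apply: Hw.
  by apply: (chart_derive_psi ch (near_r n1)) => //; exact: S_.
have H2 : `|mxdot ('D_eta' psi v1 + q') ('D_a psi v1)| <= e * frob ('D_a psi v1).
  rewrite -split_//; apply: Hv.
  by apply: (chart_derive_psi ch (near_r k1)) => //; exact: S_.
have dD u : frob ('D_u psi w1 - 'D_u psi v1) <= C * frob u * g.
  by rewrite gE; apply: (tame_lipschitz_derive tp); exact: near_r.
have g0 : 0 <= g by rewrite gE frob_ge0.
have K := @weak_difference_bound _ _ _ _ _ _ C (frob a) g (frob eta') e C1
  (frob_ge0 _) g0 (frob_ge0 _) H1 H2 e0 (dD a) (dD eta')
  (bD _ _ n1) (bD _ _ k1) (bD _ _ k1) (chart_immersion ch a (near_r n1)).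
apply: le_trans K _.
have Qd x y u v : near x -> near y -> frob (x + u - phi z) < r ->
    frob (x + v - phi z) < r -> frob (y + v - phi z) < r ->
    frob (Q x u - Q y v) <=
    C * (frob v ^+ 2 * frob (x - y) + (frob u + frob v) * frob (u - v)).
  move=> nx ny h1 h2 h3.
  exact: (tame_quad tp (near_r nx) (near_r ny) h1 h2 h3).
have q1 : frob (q - q') <= C * (frob (v2 - v1) ^+ 2 * g + G2)
    + C * (frob (v1 - v0) ^+ 2 * g + G1).
  rewrite /q /q' opprD addrACA; apply: le_trans (frobD _ _) _; apply: lerD.
    by rewrite gE G2E; apply: (Qd w1 v1) => //; exact: near_add.
  rewrite gE G1E [frob (v1 - v0)]frob_distC.
  have -> : frob (w1 - w0 - (v1 - v0)) = frob (w0 - w1 - (v0 - v1)).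
    by rewrite -frobN; congr frob; apply/matrixP => i j; rewrite !mxE; ring.
  rewrite (frob_distC w1 w0).
  by apply: (Qd w1 v1) => //; exact: near_add.
have q0 v : near v -> frob (Q v1 (v - v1)) <= C * frob (v - v1) ^+ 2.
  move=> nv; apply: (tame_quad0 tp (near_r k1)).
  by rewrite subrKC; exact: near_r.
have q2 : frob q' <= C * frob (v2 - v1) ^+ 2 + C * frob (v1 - v0) ^+ 2.
  apply: le_trans (frobD _ _) _; apply: lerD; first exact: q0.
  by rewrite [frob (v1 - v0)]frob_distC; exact: q0.
have q2g : frob q' * g <= (C * frob (v2 - v1) ^+ 2 + C * frob (v1 - v0) ^+ 2) * g.
  exact: ler_wpM2r.
have eC : e <= 2 * C * e by rewrite ler_peMl//; lra.
have G20 : 0 <= G2 by rewrite G2E mulr_ge0 ?addr_ge0 ?frob_ge0.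
have G10 : 0 <= G1 by rewrite G1E mulr_ge0 ?addr_ge0 ?frob_ge0.
rewrite (_ : 2 * C ^+ 4 * _ = C ^+ 3 *
  (2 * C * (b * g) + 2 * C * G2 + 2 * C * G1 + 2 * C * e)); last by ring.
rewrite ler_pM2l ?exprn_gt0//.
have G1' : 0 <= C * G1 by rewrite mulr_ge0// ltW.
have G2' : 0 <= C * G2 by rewrite mulr_ge0// ltW.
rewrite bE -/eta'; clear -q1 q2g eC G1' G2'.
move: (frob (q - q')) (frob q') (frob (v2 - v1)) (frob (v1 - v0)) (frob eta')
  q1 q2g => A B x1 x2 x3 q1 q2g; lra.
Qed.

End discrete_step.

(* One step of the discrete Gronwall argument: [A] and [B] are consecutive
   increments of the error, [x] and [y] the errors themselves. *)
Lemma gronwall_step {R : realType} (K t x y A B D : R) :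
  1 <= K -> 0 < t -> K * t <= 1 / 8 -> 0 <= A -> 0 <= B -> 0 <= x -> 0 <= y ->
  8 * K * B <= 1 -> t * x + A <= t -> y <= x + A -> B <= A + D ->
  D <= K * (t ^+ 2 * y + (t + B) * B + (t + A) * A + t ^+ 3) ->
  t * y + B + t ^+ 2 <= (1 + 40 * K * t) * (t * x + A + t ^+ 2).
Proof.
move=> K1 t0 Kt A0 B0 x0 y0 KB tx yx BD DK.
have t8 : t <= 1 / 8.
  by apply: le_trans Kt; rewrite ler_peMl// ltW.
have tx0 : 0 <= t * x by rewrite mulr_ge0// ltW.
have At : A <= t by lra.
have x1 : x <= 1 by rewrite -(ler_pM2l t0) mulr1; lra.
have y2 : y <= 2 by lra.
set k := K * t in Kt *.
have k0 : 0 <= k by rewrite mulr_ge0 ?ltW// (lt_le_trans ltr01).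
have E : K * (t ^+ 2 * y + (t + B) * B + (t + A) * A + t ^+ 3) =
    k * (t * y) + k * B + (K * B) * B + k * A + (K * A) * A + k * t ^+ 2.
  by rewrite /k; ring.
have KA : K * A <= k by rewrite /k ler_wpM2l// (le_trans ler01).
(* A bootstrap: [8 * K * B <= 1] first absorbs the quadratic term [K * B * B] and yields this bound;
   the bound in turn makes that term at most [3 * k * B], of the order required by a growth factor
   linear in [k]. *)
have B2 : B <= 3 * t.
  have ty : k * (t * y) <= 1 / 8 * (t * 2).
    by apply: ler_pM => //; [rewrite mulr_ge0// ltW|rewrite ler_pM2l].
  have i1 : k * B <= 1 / 8 * B by exact: ler_wpM2r.
  have i2 : K * B * B <= 1 / 8 * B by apply: ler_wpM2r => //; lra.
  have i3 : k * A <= 1 / 8 * t by exact: ler_pM.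
  have i4 : K * A * A <= 1 / 8 * t.
    by apply: ler_pM => //; [rewrite mulr_ge0// (le_trans ler01)|lra].
  have i5 : k * t ^+ 2 <= 1 / 8 * (t * (1 / 8)).
    by apply: ler_pM => //; [rewrite exprn_ge0// ltW|rewrite expr2 ler_pM2l].
  move: DK; rewrite E; lra.
have KB2 : K * B <= 3 * k by rewrite /k mulrCA ler_wpM2l// (le_trans ler01).
have D2 : D <= k * (t * y) + 4 * k * B + 2 * k * A + k * t ^+ 2.
  have i2 : K * B * B <= 3 * k * B by exact: ler_wpM2r.
  have i4 : K * A * A <= k * A by exact: ler_wpM2r.
  by move: DK; rewrite E; lra.
have ty : t * y <= t * x + t * A by rewrite -mulrDr ler_pM2l.
have tA : t * A <= k * A by rewrite ler_wpM2r// /k ler_peMl// ltW.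
have kty : k * (t * y) <= k * (t * x + t * A) by exact: ler_wpM2l.
have ktA : k * (t * A) <= k * A by apply: ler_wpM2l => //; rewrite ler_piMl//; lra.
have kB : k * B <= 1 / 8 * B by exact: ler_wpM2r.
have kt2 : 0 <= k * t ^+ 2 by rewrite mulr_ge0// exprn_ge0// ltW.
have ktx : 0 <= k * (t * x) by exact: mulr_ge0.
have kA : 0 <= k * A by exact: mulr_ge0.
have k2tx : k * (k * (t * x)) <= 1 / 8 * (k * (t * x)) by exact: ler_wpM2r.
have k2A : k * (k * A) <= 1 / 8 * (k * A) by exact: ler_wpM2r.
have k2t : k * (k * t ^+ 2) <= 1 / 8 * (k * t ^+ 2) by exact: ler_wpM2r.
set P := k * (t * y) in kty D2 *.
have P0 : 0 <= P by apply: mulr_ge0 => //; apply: mulr_ge0 => //; exact: ltW.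
have k2P : k * P <= 1 / 8 * P by exact: ler_wpM2r.
pose Z := A + P + 2 * (k * A) + k * t ^+ 2.
have BZ : B <= 2 * Z by rewrite /Z; lra.
have kBZ : k * B <= k * (2 * Z) by exact: ler_wpM2l.
have kZ : k * (2 * Z) = 2 * (k * A) + 2 * (k * P) + 4 * (k * (k * A)) + 2 * (k * (k * t ^+ 2)).
  by rewrite /Z; ring.
have -> : (1 + 40 * K * t) * (t * x + A + t ^+ 2) =
    t * x + A + t ^+ 2 + 40 * (k * (t * x)) + 40 * (k * A) + 40 * (k * t ^+ 2).
  by rewrite /k; ring.
lra.
Qed.

(** The Euler-Lagrange equation for the energy of a chain of [N] steps with fixed end points, the
    discrete counterpart of vanishing covariant acceleration. *)
Definition discrete_geodesic {R : realType} {m n : nat} (M : set 'M[R]_(m, n))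
    (p : nat -> 'M[R]_(m, n)) (N : nat) : Prop :=
  (forall i, (i <= N)%N -> M (p i)) /\
  forall i v, (i.+1 < N)%N -> tangent M (p i.+1) v ->
    mxdot (p i.+2 - p i.+1 - (p i.+1 - p i)) v = 0.

(** Closeness in the [C^1] sense: after division by [t] the second bound compares a difference
    quotient with the velocity. A second order recursion needs both data to start. *)
Definition tracks {R : realType} {m n : nat} (c : R -> 'M[R]_(m, n))
    (p : nat -> 'M[R]_(m, n)) (t e : R) (i : nat) : Prop :=
  frob (p i - c (i%:R * t)) <= e /\
  frob (p i.+1 - p i - t *: derive1 c (i%:R * t)) <= e * t.

Lemma neighbour_times {R : realType} (x s0 rho t : R) :
  `|x + t - s0| < rho -> 0 < t -> t < rho ->
  [/\ `|x - s0| < 2 * rho, `|x + t - s0| < 2 * rho & `|x + t + t - s0| < 2 * rho].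
Proof. by rewrite !ltr_norml => h t0 tr; split; lra. Qed.

(** Bookkeeping between the terms delivered by [chart_step] and those accepted by [gronwall_step]:
    [x1] and [x2] are increments of the sampled geodesic, [f1] and [f2] those of the chain, which
    are of order [t] up to the errors [A] and [B]. *)
Lemma step_coefficients {R : realType} (L t y A B K x1 x2 e f1 f2 : R) :
  1 <= L -> 0 < t -> 0 <= y -> 0 <= A -> 0 <= B -> 0 <= x1 -> 0 <= x2 ->
  x1 <= L * t -> x2 <= L * t -> e <= L * t ^+ 2 -> f1 <= L * t + A ->
  f2 <= L * t + B -> 2 * K <= L ->
  (x2 ^+ 2 + x1 ^+ 2 + e) * y + (f2 + x2) * B + (f1 + x1) * A + 2 * K * t ^+ 3 <=
  (2 * L ^+ 2 + 2 * L + 1) *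
    (t ^+ 2 * y + (t + B) * B + (t + A) * A + t ^+ 3).
Proof.
move=> L1 t0 y0 A0 B0 x10 x20 x1L x2L eL f1L f2L KL.
have sq x : 0 <= x -> x <= L * t -> x ^+ 2 <= L ^+ 2 * t ^+ 2.
  by move=> h0 h; rewrite -exprMn ler_pXn2r ?nnegrE// (le_trans h0).
have := sq _ x10 x1L; have := sq _ x20 x2L => s2 s1.
have LL : 0 <= L ^+ 2 by exact: sqr_ge0.
have t20 : 0 <= t ^+ 2 by exact: sqr_ge0.
have lin b : 0 <= b -> 2 * L * t + b <= (2 * L ^+ 2 + 2 * L + 1) * (t + b).
  move=> b0; rewrite [leRHS]mulrDr lerD//; first by rewrite ler_pM2r//; lra.
  by rewrite ler_peMl//; lra.
rewrite !mulrDr; apply: lerD; first apply: lerD; first apply: lerD.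
- rewrite [leRHS]mulrA; apply: ler_wpM2r => //.
  apply: (@le_trans _ _ (L ^+ 2 * t ^+ 2 + L ^+ 2 * t ^+ 2 + L * t ^+ 2)); first by lra.
  by rewrite -!mulrDl; apply: ler_wpM2r => //; lra.
- rewrite [leRHS]mulrA; apply: ler_wpM2r => //.
  by apply: le_trans (lin _ B0); lra.
- rewrite [leRHS]mulrA; apply: ler_wpM2r => //.
  by apply: le_trans (lin _ A0); lra.
- by apply: ler_wpM2r; [rewrite exprn_ge0// ltW|lra].
Qed.

(** * Comparison of a chain with a geodesic near a given time *)

Section local_stability.
Context {R : realType} {m n : nat} (M : set 'M[R]_(m, n)) (c : R -> 'M[R]_(m, n)).
Variables (s0 r C : R) (phi psi : 'M[R]_(m, n) -> 'M[R]_(m, n))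
  (S : {vspace 'M[R]_(m, n)}) (Kc dc : R).
Hypothesis gc : geodesic M c.
Hypothesis ch : chart M (c s0) r C phi psi S.
Hypothesis Kc0 : 0 < Kc.
Hypothesis taylor : forall s t, `|s - s0| < dc -> 0 <= t < dc ->
  [/\ frob (derive1n 2 c s) <= Kc,
      frob (c (s + t) - c s - t *: derive1n 1 c s) <= Kc * t ^+ 2 &
      frob (c (s + t) - c s - (c s - c (s - t)) - t ^+ 2 *: derive1n 2 c s)
        <= 2 * Kc * t ^+ 3].

Let z := c s0.
Let sg := frob (derive1 c 0).
Let u := r / (32 * C).
Let L := C * sg + 3 * C * Kc + 2 * C * sg ^+ 2 + 2 * Kc + 1.
Let K2 := 2 * C ^+ 4 * (2 * L ^+ 2 + 2 * L + 1).

Variable rho : R.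
Hypothesis rho_dc : rho <= dc.
Hypothesis rho_u : 2 * rho * sg < u.

Variables (p : nat -> 'M[R]_(m, n)) (N : nat) (t : R).
Hypothesis dg : discrete_geodesic M p N.
Hypothesis t0 : 0 < t.
Hypothesis t_rho : t < rho.
Hypothesis t1 : t <= 1.
Hypothesis K2t : K2 * t <= 1 / 8.

Let C0 : 0 < C. Proof. exact: chart_C0 ch. Qed.
Let C1 : 1 <= C. Proof. exact: chart_C ch. Qed.
Let r0 : 0 < r. Proof. exact: chart_r ch. Qed.
Let sg0 : 0 <= sg. Proof. exact: frob_ge0. Qed.
Let u0 : 0 < u. Proof. by rewrite divr_gt0// mulr_gt0. Qed.

Let Cs0 : 0 <= C * sg. Proof. by rewrite mulr_ge0// ltW. Qed.
Let CK0 : 0 <= C * Kc. Proof. by rewrite mulr_ge0// ltW. Qed.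
Let Cs20 : 0 <= C * sg ^+ 2. Proof. by rewrite mulr_ge0 ?sqr_ge0// ltW. Qed.

Let L1 : 1 <= L.
Proof. by rewrite /L; move: Cs0 CK0 Cs20 Kc0; lra. Qed.

Let L_ge1 : 3 * C * Kc + 2 * C * sg ^+ 2 <= L.
Proof. by rewrite /L; move: Cs0 Kc0; lra. Qed.

Let L_ge2 : C * sg <= L.
Proof. by rewrite /L; move: Cs20 CK0 Kc0; lra. Qed.

Let L_ge3 : 2 * Kc <= L.
Proof. by rewrite /L; move: Cs0 Cs20 CK0; lra. Qed.

Let K21 : 1 <= K2.
Proof.
have C4 : 1 <= C ^+ 4 by exact: exprn_ege1.
have L2 : 0 <= L ^+ 2 by exact: sqr_ge0.
rewrite /K2 -[X in X <= _]mulr1; apply: ler_pM => //; move: L1; lra.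
Qed.

Let cnear s : `|s - s0| < 2 * rho -> frob (c s - z) < u.
Proof.
move=> ss; apply: le_lt_trans (geodesic_lipschitz gc _ _) _.
by apply: le_lt_trans rho_u; rewrite mulrC ler_wpM2r// ltW.
Qed.

Let near w := w \in S /\ frob (w - phi z) < r / 4.

Let in_chart x : M x -> frob (x - z) < 4 * u ->
  [/\ frob (x - z) < r, near (phi x) & psi (phi x) = x].
Proof.
move=> Mx xu.
have xr : frob (x - z) < r / 4 / C.
  apply: lt_le_trans xu _; rewrite ler_pdivlMr// /u.
  rewrite (_ : 4 * (r / (32 * C)) * C = r / 8 * (C / C)); last by field; rewrite gt_eqF.
  by rewrite divff ?gt_eqF//; move: r0; lra.
have r4 : r / 4 <= r by move: r0; lra.
have [h1 h2] := chart_phi_near ch r4 xr.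
split=> //; last exact: (chart_phiK ch).
by split=> //; apply/(chart_M ch h1).
Qed.

Let T i : R := i%:R * t.
Let W i := phi (c (T i)).
Let w i := phi (p i).
Let g i := frob (w i - W i).
Let G i := frob (w i.+1 - w i - (W i.+1 - W i)).
(** The quantity of the Gronwall argument. The weight [t] makes the position error comparable with
    the increment error, and [t ^+ 2] lets a truncation error of order [t ^+ 3] count as relative
    growth of order [t]. *)
Let Y i := t * g i + G i + t ^+ 2.

Let TS i : T i.+1 = T i + t.
Proof. by rewrite /T -natr1 mulrDl mul1r. Qed.

Let c_in i : `|T i - s0| < 2 * rho ->
  [/\ frob (c (T i) - z) < r, near (W i) & psi (W i) = c (T i)].
Proof.
move=> h; apply: in_chart; first exact: (geodesic_M gc).
by have := cnear h; move: u0; lra.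
Qed.

Let dW i : `|T i - s0| < 2 * rho -> `|T i.+1 - s0| < 2 * rho ->
  frob (W i.+1 - W i) <= C * sg * t.
Proof.
move=> /c_in[h1 _ _] /c_in[h2 _ _].
apply: le_trans (chart_phi_lipschitz ch h2 h1) _; rewrite -mulrA ler_pM2l//.
apply: le_trans (geodesic_lipschitz gc _ _) _.
by rewrite TS addrAC subrr add0r gtr0_norm.
Qed.

(** Around the middle point [phi] is its derivative plus quadratic errors, so second differences in
    the chart are of order [t ^+ 2] like those of [c]. *)
Let ddW i : `|T i.+1 - s0| < rho ->
  frob (W i.+2 - W i.+1 - (W i.+1 - W i)) <= L * t ^+ 2.
Proof.
move=> h.
have [h0 h1 h2] : [/\ `|T i - s0| < 2 * rho, `|T i.+1 - s0| < 2 * rho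
    & `|T i.+2 - s0| < 2 * rho].
  by rewrite (TS i.+1) TS; apply: neighbour_times => //; rewrite -TS.
have [k0 _ _] := c_in h0; have [k1 _ _] := c_in h1; have [k2 _ _] := c_in h2.
have tdc : 0 <= t < dc by rewrite ltW//= (lt_le_trans t_rho).
have [b2 _ b3] := taylor (lt_le_trans h rho_dc) tdc.
rewrite -TS in b3.
have Tm : T i.+1 - t = T i by rewrite TS addrK.
rewrite Tm in b3.
have tp := chart_phi ch.
set x0 := c (T i) in k0 b3 *; set x1 := c (T i.+1) in k1 b3 *.
set x2 := c (T i.+2) in k2 b3 *.
have dx : differentiable phi x1 by case: (tame_bounded tp k1).
have q2 : frob (phi x2 - phi x1 - 'D_(x2 - x1) phi x1) <= C * frob (x2 - x1) ^+ 2.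
  by have := tame_quad0 (a := x2 - x1) tp k1; rewrite subrKC; exact.
have q0 : frob (phi x0 - phi x1 - 'D_(x0 - x1) phi x1) <= C * frob (x0 - x1) ^+ 2.
  by have := tame_quad0 (a := x0 - x1) tp k1; rewrite subrKC; exact.
have l2 : frob (x2 - x1) <= sg * t.
  apply: le_trans (geodesic_lipschitz gc _ _) _.
  by rewrite (TS i.+1) addrAC subrr add0r gtr0_norm.
have l0 : frob (x0 - x1) <= sg * t.
  rewrite frob_distC; apply: le_trans (geodesic_lipschitz gc _ _) _.
  by rewrite (TS i) addrAC subrr add0r gtr0_norm.
have st0 : 0 <= sg * t by rewrite mulr_ge0// ltW.
have q2' : C * frob (x2 - x1) ^+ 2 <= C * (sg * t) ^+ 2.
  by rewrite ler_pM2l// ler_pXn2r ?nnegrE ?frob_ge0.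
have q0' : C * frob (x0 - x1) ^+ 2 <= C * (sg * t) ^+ 2.
  by rewrite ler_pM2l// ler_pXn2r ?nnegrE ?frob_ge0.
have bd : frob ('D_(x2 - x1 + (x0 - x1)) phi x1) <= C * (3 * Kc * t ^+ 2).
  have [_ bv] := tame_bounded tp k1; apply: le_trans (bv _) _; rewrite ler_pM2l//.
  apply: le_trans (frob_le_distD _ (t ^+ 2 *: derive1n 2 c (T i.+1))) _.
  rewrite frobZ ger0_norm ?sqr_ge0//.
  have -> : x2 - x1 + (x0 - x1) = x2 - x1 - (x1 - x0) by rewrite opprB.
  have i1 : t ^+ 2 * frob (derive1n 2 c (T i.+1)) <= t ^+ 2 * Kc.
    by rewrite ler_pM2l ?exprn_gt0.
  have i2 : 2 * Kc * t ^+ 3 <= 2 * Kc * t ^+ 2.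
    rewrite ler_pM2l ?mulr_gt0// exprS ler_piMl//.
    exact: sqr_ge0.
  have -> : 3 * Kc * t ^+ 2 = t ^+ 2 * Kc + 2 * Kc * t ^+ 2 by ring.
  exact: lerD i1 (le_trans b3 i2).
rewrite /W -/x0 -/x1 -/x2.
have -> : phi x2 - phi x1 - (phi x1 - phi x0) =
    'D_(x2 - x1 + (x0 - x1)) phi x1 + ((phi x2 - phi x1 - 'D_(x2 - x1) phi x1)
      + (phi x0 - phi x1 - 'D_(x0 - x1) phi x1)).
  rewrite (derive_dirD _ _ dx).
  move: ('D_(x2 - x1) phi x1) ('D_(x0 - x1) phi x1) (phi x0) (phi x1) (phi x2).
  by move=> p1 p2 p3 p4 p5; apply/matrixP => a b; rewrite !mxE; ring.
apply: le_trans (frobD _ _) _; apply: le_trans (lerD bd (frobD _ _)) _.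
apply: (@le_trans _ _ ((3 * C * Kc + 2 * C * sg ^+ 2) * t ^+ 2)).
  have -> : (3 * C * Kc + 2 * C * sg ^+ 2) * t ^+ 2 =
      C * (3 * Kc * t ^+ 2) + (C * (sg * t) ^+ 2 + C * (sg * t) ^+ 2) by ring.
  apply: lerD => //; exact: lerD (le_trans q2 q2') (le_trans q0 q0').
by rewrite ler_pM2r ?exprn_gt0//.
Qed.

(** The sampled geodesic solves the discrete equation up to [2 * Kc * t ^+ 3]: its acceleration is
    normal, so only the Taylor error survives against tangent vectors. [chart_step] compares it with
    the exact chain, and [gronwall_step] closes the inequality. *)
Lemma track_step i : (i.+1 < N)%N ->
  frob (p i - z) < 2 * u -> frob (p i.+1 - p i) < u -> frob (p i.+2 - p i.+1) < u ->
  8 * K2 * (C * frob (p i.+2 - p i.+1) + L * t) <= 1 ->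
  `|T i.+1 - s0| < rho -> Y i <= t ->
  Y i.+1 <= (1 + 40 * K2 * t) * Y i.
Proof.
move=> iN pz d1 d2 dK h Yi; have [pM pn] := dg.
have [h0 h1 h2] : [/\ `|T i - s0| < 2 * rho, `|T i.+1 - s0| < 2 * rho
    & `|T i.+2 - s0| < 2 * rho].
  by rewrite (TS i.+1) TS; apply: neighbour_times => //; rewrite -TS.
have [k0 n0 e0] := c_in h0; have [k1 n1 e1] := c_in h1; have [k2 n2 e2] := c_in h2.
have p1z : frob (p i.+1 - z) < 3 * u.
  by apply: le_lt_trans (frob_dist_triangle (p i) _ _) _; move: pz d1; lra.
have p2z : frob (p i.+2 - z) < 4 * u.
  by apply: le_lt_trans (frob_dist_triangle (p i.+1) _ _) _; move: p1z d2; lra.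
have [a0 b0 f0] : [/\ frob (p i - z) < r, near (w i) & psi (w i) = p i].
  by apply: in_chart; [apply: pM; rewrite ltnW// ltnW|move: pz u0; lra].
have [a1 b1 f1] : [/\ frob (p i.+1 - z) < r, near (w i.+1) & psi (w i.+1) = p i.+1].
  by apply: in_chart; [apply: pM; rewrite ltnW|move: p1z u0; lra].
have [a2 b2 f2] : [/\ frob (p i.+2 - z) < r, near (w i.+2) & psi (w i.+2) = p i.+2].
  by apply: in_chart; [exact: pM|].
have tdc : 0 <= t < dc by rewrite ltW//= (lt_le_trans t_rho).
have [_ _ t3] := taylor (lt_le_trans h rho_dc) tdc.
rewrite -TS [T i.+1 - t](_ : _ = T i) in t3; last by rewrite TS addrK.
have e0' : 0 <= 2 * Kc * t ^+ 3 by rewrite !mulr_ge0 ?exprn_ge0 ?(ltW t0) ?(ltW Kc0).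
have Hw v : tangent M (psi (w i.+1)) v ->
    mxdot (psi (w i.+2) - psi (w i.+1) - (psi (w i.+1) - psi (w i))) v = 0.
  by rewrite f0 f1 f2; exact: pn.
have Hv v : tangent M (psi (W i.+1)) v ->
    `|mxdot (psi (W i.+2) - psi (W i.+1) - (psi (W i.+1) - psi (W i))) v|
      <= 2 * Kc * t ^+ 3 * frob v.
  rewrite e0 e1 e2 => tv; have [_ _ acc] := gc; have av := acc _ _ tv.
  have -> : mxdot (c (T i.+2) - c (T i.+1) - (c (T i.+1) - c (T i))) v =
      mxdot (c (T i.+2) - c (T i.+1) - (c (T i.+1) - c (T i))
        - t ^+ 2 *: derive1n 2 c (T i.+1)) v.
    by rewrite [RHS]mxdotBl mxdotZl av mulr0 subr0.
  apply: le_trans (normr_mxdot_le _ _) _; apply: ler_wpM2r; first exact: frob_ge0.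
  exact: t3.
have st := chart_step ch b0 b1 b2 n0 n1 n2 e0' Hw Hv erefl erefl erefl erefl.
have dW1 := dW h0 h1; have dW2 := dW h1 h2; have dW3 := ddW h.
have Cst : C * sg * t <= L * t.
  by rewrite ler_pM2r.
have Lt0 : 0 <= L * t by rewrite mulr_ge0 ?ltW// (lt_le_trans ltr01).
have wd2 : frob (w i.+2 - w i.+1) <= L * t + G i.+1.
  apply: le_trans (frob_le_distD _ (W i.+2 - W i.+1)) _.
  by rewrite lerD2r (le_trans dW2).
have wd1 : frob (w i.+1 - w i) <= L * t + G i.
  apply: le_trans (frob_le_distD _ (W i.+1 - W i)) _.
  by rewrite lerD2r (le_trans dW1).
have Gsmall : 8 * K2 * G i.+1 <= 1.
  apply: le_trans dK; rewrite ler_wpM2l// /G; first by move: K21; lra.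
  apply: le_trans (frobB _ _) _; apply: lerD; last exact: le_trans dW2 Cst.
  exact: (chart_phi_lipschitz ch).
set D := frob _ in st.
apply: (@gronwall_step _ K2 t (g i) (g i.+1) (G i) (G i.+1) D) => //; try exact: frob_ge0.
- by apply: le_trans Yi; rewrite /Y lerDl sqr_ge0.
- have -> : g i.+1 = frob ((w i - W i) + (w i.+1 - w i - (W i.+1 - W i))).
    congr frob; move: (w i) (W i) (w i.+1) (W i.+1) => p1 p2 p3 p4.
    by apply/matrixP => a b; rewrite !mxE; ring.
  exact: frobD.
- have -> : G i.+1 = frob ((w i.+1 - w i - (W i.+1 - W i)) +
      (w i.+2 - w i.+1 - (w i.+1 - w i) - (W i.+2 - W i.+1 - (W i.+1 - W i)))).
    congr frob; move: (w i) (W i) (w i.+1) (W i.+1) (w i.+2) (W i.+2).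
    by move=> p1 p2 p3 p4 p5 p6; apply/matrixP => a b; rewrite !mxE; ring.
  exact: frobD.
apply: le_trans st _; rewrite /K2 -[leRHS]mulrA ler_pM2l; last first.
  by rewrite mulr_gt0// exprn_gt0.
rewrite -/(G i.+1) -/(G i) -/(g i.+1).
by apply: step_coefficients => //; try exact: frob_ge0; exact: le_trans Cst.
Qed.

(** Entry into chart coordinates. The condition [t <= e] absorbs both the Taylor error [Kc * t ^+ 2]
    and the summand [t ^+ 2] of [Y]. *)
Lemma track_init l (e : R) : (l < N)%N -> frob (p l - z) < 2 * u ->
  frob (p l.+1 - p l) < u -> `|T l - s0| < rho -> t <= e -> tracks c p t e l ->
  Y l <= t * ((2 * C + C * sg + C * Kc + 1) * e).
Proof.
move=> lN pz d1 h te [h1 h2]; have [pM _] := dg.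
have hh1 : `|T l - s0| < 2 * rho by move: h; rewrite !ltr_norml; lra.
have hh2 : `|T l.+1 - s0| < 2 * rho.
  by move: h; rewrite TS !ltr_norml; move: t0 t_rho; lra.
have [k0 _ _] := c_in hh1; have [k1 _ _] := c_in hh2.
have p1z : frob (p l.+1 - z) < 3 * u.
  by apply: le_lt_trans (frob_dist_triangle (p l) _ _) _; move: pz d1; lra.
have [a0 _ _] : [/\ frob (p l - z) < r, near (w l) & psi (w l) = p l].
  by apply: in_chart; [apply: pM; rewrite ltnW|move: pz u0; lra].
have [a1 _ _] : [/\ frob (p l.+1 - z) < r, near (w l.+1) & psi (w l.+1) = p l.+1].
  by apply: in_chart; [apply: pM|move: p1z u0; lra].
have gl : g l <= C * e.
  apply: le_trans (chart_phi_lipschitz ch a0 k0) _.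
  by rewrite ler_pM2l.
have dl : frob (c (T l.+1) - c (T l)) <= sg * t.
  apply: le_trans (geodesic_lipschitz gc _ _) _.
  by rewrite TS addrAC subrr add0r gtr0_norm.
have tdc : 0 <= t < dc by rewrite ltW//= (lt_le_trans t_rho).
have [_ t2 _] := taylor (lt_le_trans h rho_dc) tdc; rewrite -TS in t2.
have pc : frob (p l + (c (T l.+1) - c (T l)) - z) < r.
  rewrite addrAC; apply: le_lt_trans (frobD _ _) _.
  have := frob_dist_triangle z (c (T l.+1)) (c (T l)).
  rewrite (frob_distC z); have := cnear hh1; have := cnear hh2.
  have : 8 * u <= r.
    rewrite /u mulrA ler_pdivrMr ?mulr_gt0// -subr_ge0.
    rewrite (_ : _ - _ = r * (32 * C - 8)); last by ring.
    by rewrite mulr_ge0 ?(ltW r0)//; move: C1; lra.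
  by move: pz u0; lra.
have inc := @tame_increment _ _ _ phi z r C (p l) (c (T l)) (p l.+1 - p l)
  (c (T l.+1) - c (T l)) (chart_phi ch) a0 k0.
rewrite !subrKC in inc; have {}inc := inc a1 pc k1.
have e0 : 0 <= e by rewrite (le_trans _ te)// ltW.
have dd : frob (p l.+1 - p l - (c (T l.+1) - c (T l))) <= e * t + Kc * t ^+ 2.
  apply: le_trans (frob_dist_triangle (t *: derive1 c (T l)) _ _) _.
  by apply: lerD => //; rewrite frob_distC.
have Gl : G l <= C * (sg * t) * e + C * (e * t + Kc * t ^+ 2).
  apply: le_trans inc _; apply: lerD; last by rewrite ler_pM2l.
  apply: ler_pM => //; rewrite ?mulr_ge0 ?frob_ge0 ?(ltW C0)//.
  by rewrite ler_pM2l.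
have tt : t ^+ 2 <= t * e by rewrite expr2 ler_pM2l.
have Ktt : C * (Kc * t ^+ 2) <= C * (Kc * (t * e)) by rewrite !ler_pM2l.
have tg : t * g l <= t * (C * e) by rewrite ler_pM2l.
rewrite /Y; apply: le_trans (lerD (lerD tg Gl) tt) _.
apply: le_trans (_ : t * (C * e) + (C * (sg * t) * e + (C * (e * t) +
  C * (Kc * (t * e)))) + t * e <= _).
  by rewrite lerD2r lerD2l lerD2l mulrDr lerD2l.
by rewrite le_eqVlt; apply/orP; left; apply/eqP; ring.
Qed.

(** The return from chart coordinates, by the Lipschitz and increment bounds of [psi]. The first
    conclusion restores the closeness to [z] that each step of the induction spends. *)
Lemma track_final i (k : R) : (i < N)%N -> frob (p i - z) < 3 * u ->
  frob (p i.+1 - p i) < u -> `|T i - s0| < rho -> Y i <= k * t ->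
  frob (p i - z) < u + C * k /\ tracks c p t ((2 * C + C * L + Kc) * k) i.
Proof.
move=> iN pz d1 h Yk; have [pM _] := dg.
have hh1 : `|T i - s0| < 2 * rho by move: h; rewrite !ltr_norml; lra.
have hh2 : `|T i.+1 - s0| < 2 * rho.
  by move: h; rewrite TS !ltr_norml; move: t0 t_rho; lra.
have [k0 n0 f0] := c_in hh1; have [k1 n1 f1] := c_in hh2.
have p1z : frob (p i.+1 - z) < 4 * u.
  by apply: le_lt_trans (frob_dist_triangle (p i) _ _) _; move: pz d1; lra.
have [_ [b0S b0] e0] : [/\ frob (p i - z) < r, near (w i) & psi (w i) = p i].
  by apply: in_chart; [apply: pM; rewrite ltnW|move: pz u0; lra].
have [_ [b1S b1] e1] : [/\ frob (p i.+1 - z) < r, near (w i.+1) & psi (w i.+1) = p i.+1].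
  by apply: in_chart; [apply: pM|move: p1z u0; lra].
case: n0 => _ n0; case: n1 => _ n1.
have rr x : frob (x - phi z) < r / 4 -> frob (x - phi z) < r by move: r0; lra.
have g0 : 0 <= g i := frob_ge0 _; have G0 : 0 <= G i := frob_ge0 _.
have tg0 : 0 <= t * g i by rewrite mulr_ge0// ltW.
have t20 : 0 <= t ^+ 2 by exact: sqr_ge0.
have gk : g i <= k by rewrite -(ler_pM2l t0) (mulrC t k); move: Yk; rewrite /Y; lra.
have Cgk : C * g i <= C * k by rewrite ler_pM2l.
have kk0 : 0 <= k by exact: le_trans gk.
have pcd : frob (p i - c (T i)) <= C * k.
  rewrite -e0 -f0; apply: le_trans (chart_psi_lipschitz ch (rr _ b0) (rr _ n0)) _.
  exact: Cgk.
have Lk0 : 0 <= (C + C * L + Kc) * k.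
  by rewrite mulr_ge0// !addr_ge0 ?mulr_ge0 ?(ltW C0) ?(ltW Kc0) ?(le_trans ler01 L1).
split.
  apply: le_lt_trans (frob_dist_triangle (c (T i)) _ _) _.
  by have := cnear hh1; move: pcd; lra.
split; first by apply: le_trans pcd _; move: Lk0; lra.
have wW : frob (w i + (W i.+1 - W i) - phi z) < r.
  rewrite addrAC; apply: le_lt_trans (frobD _ _) _.
  have := frob_dist_triangle (phi z) (W i.+1) (W i); rewrite (frob_distC (phi z)).
  by move: b0 n0 n1 r0; lra.
have inc := @tame_increment _ _ _ psi (phi z) r C (w i) (W i) (w i.+1 - w i)
  (W i.+1 - W i) (chart_psi ch) (rr _ b0) (rr _ n0).
rewrite !subrKC in inc; have {inc} := inc (rr _ b1) wW (rr _ n1).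
rewrite e0 e1 f0 f1 -/(g i) -/(G i) => inc.
have tdc : 0 <= t < dc by rewrite ltW//= (lt_le_trans t_rho).
have [_ t2 _] := taylor (lt_le_trans h rho_dc) tdc; rewrite -TS in t2.
apply: le_trans (frob_dist_triangle (c (T i.+1) - c (T i)) _ _) _.
apply: le_trans (lerD inc t2) _.
have dWL : frob (W i.+1 - W i) <= L * t.
  by apply: le_trans (dW hh1 hh2) _; rewrite ler_pM2r.
have i1 : C * frob (W i.+1 - W i) * g i <= C * L * (t * g i).
  rewrite mulrA -[C * L * t]mulrA; apply: ler_wpM2r => //.
  by rewrite ler_pM2l.
have L0 : 0 <= L by exact: le_trans ler01 L1.
have i2 : C * L * (t * g i) <= C * L * Y i.
  by apply: ler_wpM2l; [rewrite mulr_ge0// ltW|rewrite /Y; lra].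
have i3 : C * G i <= C * Y i by rewrite ler_pM2l// /Y; lra.
have i4 : Kc * t ^+ 2 <= Kc * Y i by rewrite ler_pM2l// /Y; lra.
apply: (@le_trans _ _ ((C * L + C + Kc) * Y i)); first by move: i1 i2 i3 i4; lra.
apply: (@le_trans _ _ ((C * L + C + Kc) * (k * t))).
  by apply: ler_wpM2l => //; rewrite !addr_ge0 ?mulr_ge0 ?(ltW C0) ?(ltW Kc0).
rewrite mulrA; apply: ler_wpM2r; first exact: ltW.
apply: ler_wpM2r => //; move: C0; lra.
Qed.

(** Closeness to [z] and the bound on [Y] are carried together, since a step is estimated only
    inside the chart. The factor [(1 + 40 * K2 * t) ^+ j] stays below the exponential because all
    times lie in an interval of length [2 * rho]. *)
Lemma track_all l (k : R) : 0 < k -> k <= 1 -> C * k <= u ->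
  (forall i, (i < N)%N -> frob (p i.+1 - p i) < u /\
     8 * K2 * (C * frob (p i.+1 - p i) + L * t) <= 1) ->
  `|T l - s0| < rho -> frob (p l - z) < 2 * u ->
  expR (40 * K2 * (2 * rho)) * Y l <= k * t ->
  forall j, (l + j < N)%N -> `|T (l + j) - s0| < rho ->
  frob (p (l + j)%N - z) < 2 * u /\ Y (l + j)%N <= k * t.
Proof.
move=> k0 k1 Ck steps hl pl Yl.
have K20 : 0 <= 40 * K2 by apply: mulr_ge0 => //; exact: le_trans ler01 K21.
have K0 : 0 <= 40 * K2 * t by apply: mulr_ge0 => //; exact: ltW.
have Yl0 : 0 <= Y l by rewrite /Y !addr_ge0 ?mulr_ge0 ?frob_ge0 ?sqr_ge0 ?(ltW t0).
have grow j : `|T (l + j) - s0| < rho -> (1 + 40 * K2 * t) ^+ j * Y l <= k * t.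
  move=> hj; apply: le_trans Yl; apply: ler_wpM2r => //.
  apply: (@le_trans _ _ (expR (40 * K2 * t) ^+ j)).
    rewrite lerXn2r ?nnegrE ?expR_ge0 ?expR_ge1Dx//.
    by rewrite addr_ge0.
  rewrite -expRM_natr ler_expR -mulrA ler_wpM2l//.
  move: hl hj; rewrite /T natrD mulrDl !ltr_norml (mulrC t); lra.
suff H j : (l + j < N)%N -> `|T (l + j) - s0| < rho ->
    frob (p (l + j)%N - z) < 2 * u /\ Y (l + j)%N <= (1 + 40 * K2 * t) ^+ j * Y l.
  by move=> j jN hj; have [h1 h2] := H j jN hj; split=> //; exact: le_trans (grow j hj).
elim: j => [|j IH]; first by rewrite addn0 expr0 mul1r.
rewrite addnS => jN hj.
have hj' : `|T (l + j) - s0| < rho.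
  move: hl hj; rewrite TS /T natrD mulrDl !ltr_norml.
  have : 0 <= j%:R * t by rewrite mulr_ge0// ltW.
  by move: t0; lra.
have [pj Yj] := IH (ltnW jN) hj'.
have Ykt : Y (l + j)%N <= k * t := le_trans Yj (grow j hj').
have Yt : Y (l + j)%N <= t by apply: le_trans Ykt _; rewrite ler_piMl// ltW.
have [d1 _] := steps _ (ltnW jN); have [d2 dK] := steps _ jN.
have Y1 := track_step jN pj d1 d2 dK hj Yt.
have Y2 : Y (l + j).+1 <= (1 + 40 * K2 * t) ^+ j.+1 * Y l.
  apply: le_trans Y1 _; rewrite exprS -[leRHS]mulrA; apply: ler_wpM2l => //.
  by rewrite addr_ge0.
split=> //; rewrite -addnS in hj.
have Y3 := le_trans Y2 (grow j.+1 hj); rewrite addnS in hj.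
have p1z : frob (p (l + j).+1 - z) < 3 * u.
  by apply: le_lt_trans (frob_dist_triangle (p (l + j)%N) _ _) _; move: pj d1; lra.
have [h _] := track_final jN p1z d2 hj Y3.
by apply: lt_le_trans h _; move: Ck; lra.
Qed.

Lemma track_main l (k e : R) : 0 < k -> k <= 1 -> C * k <= u ->
  (forall i, (i < N)%N -> frob (p i.+1 - p i) < u /\
     8 * K2 * (C * frob (p i.+1 - p i) + L * t) <= 1) ->
  (l < N)%N -> `|l%:R * t - s0| < rho -> e < u -> t <= e -> tracks c p t e l ->
  expR (40 * K2 * (2 * rho)) * ((2 * C + C * sg + C * Kc + 1) * e) <= k ->
  forall i, (l <= i < N)%N -> `|i%:R * t - s0| < rho ->
  tracks c p t ((2 * C + C * L + Kc) * k) i.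
Proof.
move=> k0 k1 Ck steps lN hl eu te trl ek i /andP[li iN] hi.
have pl : frob (p l - z) < 2 * u.
  apply: le_lt_trans (frob_dist_triangle (c (T l)) _ _) _.
  have hh1 : `|T l - s0| < 2 * rho by move: hl; rewrite -/(T l) !ltr_norml; lra.
  by have := cnear hh1; case: trl => + _; rewrite -/(T l); move: eu; lra.
have [d1 _] := steps _ lN.
have Yl : expR (40 * K2 * (2 * rho)) * Y l <= k * t.
  apply: le_trans (_ : expR (40 * K2 * (2 * rho)) *
    (t * ((2 * C + C * sg + C * Kc + 1) * e)) <= _).
    by apply: ler_wpM2l; [exact: expR_ge0|exact: track_init].
  by rewrite mulrCA [leRHS]mulrC ler_pM2l.
have H := track_all k0 k1 Ck steps hl pl Yl.
have := H (i - l)%N; rewrite subnKC// => /(_ iN hi)[pi Yi].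
have [d2 _] := steps _ iN.
have pi3 : frob (p i - z) < 3 * u by move: pi u0; lra.
by have [_] := track_final iN pi3 d2 hi Yi.
Qed.

End local_stability.

(** Stands for a nest of minima when several smallness conditions are imposed at once. *)
Lemma pos_lower_bound {R : realType} (s : seq R) : all (fun x => 0 < x) s ->
  exists2 d : R, 0 < d & all (fun x => d <= x) s.
Proof.
elim: s => [_|x s IH /= /andP[x0 /IH[d d0 ds]]]; first by exists 1.
exists (Num.min x d); first by rewrite lt_min x0.
rewrite ge_min lexx/=; apply: sub_all ds => y dy.
by rewrite ge_min dy orbT.
Qed.

(** * Comparison on bounded time intervals *)

Section stability.
Context {R : realType} {m n : nat} (d : nat) (M : set 'M[R]_(m, n))
  (c : R -> 'M[R]_(m, n)).
Hypothesis eM : embedded_submanifold d M.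
Hypothesis gc : geodesic M c.

Lemma tracks_le p t (e e' : R) i : 0 <= t -> e <= e' -> tracks c p t e i -> tracks c p t e' i.
Proof.
move=> t0 ee [h1 h2]; split; first exact: le_trans ee.
by apply: le_trans h2 _; exact: ler_wpM2r.
Qed.

(** The window [rho] is fixed before the accuracy [e], and only [dl] depends on [e]. This order of
    quantifiers lets the continuation argument cross the supremum of the good times. *)
Lemma local_stability s0 : exists2 rho : R, 0 < rho &
  forall e : R, 0 < e -> exists2 dl : R, 0 < dl & forall p N t l,
    discrete_geodesic M p N -> (forall i, (i < N)%N -> frob (p i.+1 - p i) <= dl) ->
    0 < t -> t <= dl -> (l < N)%N -> `|l%:R * t - s0| < rho -> tracks c p t dl l ->
    forall i, (l <= i < N)%N -> `|i%:R * t - s0| < rho -> tracks c p t e i.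
Proof.
have [r [C [phi [psi [S ch]]]]] := chart_exists eM (geodesic_M gc s0).
have [Kc Kc0 [dc dc0 taylor]] := curve_taylor (geodesic_smooth gc) s0.
pose sg := frob (derive1 c 0).
pose u := r / (32 * C).
pose L := C * sg + 3 * C * Kc + 2 * C * sg ^+ 2 + 2 * Kc + 1.
pose K2 := 2 * C ^+ 4 * (2 * L ^+ 2 + 2 * L + 1).
pose K5 := 2 * C + C * L + Kc.
pose K6 := 2 * C + C * sg + C * Kc + 1.
have C0 := chart_C0 ch; have C1 := chart_C ch; have r0 := chart_r ch.
have sg0 : 0 <= sg by exact: frob_ge0.
have u0 : 0 < u by rewrite divr_gt0// mulr_gt0.
have L0 : 0 < L.
  by rewrite ltr_wpDl// !addr_ge0 ?mulr_ge0 ?sqr_ge0 ?(ltW C0) ?(ltW Kc0).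
have K20 : 0 < K2.
  by rewrite !mulr_gt0 ?exprn_gt0// ltr_wpDl// addr_ge0 ?mulr_ge0 ?sqr_ge0 ?(ltW L0).
have K50 : 0 < K5 by rewrite ltr_wpDl// addr_ge0 ?mulr_ge0 ?(ltW C0) ?(ltW L0).
have K60 : 0 < K6.
  by rewrite ltr_wpDl// !addr_ge0 ?mulr_ge0 ?(ltW C0) ?(ltW Kc0).
have sg1 : 0 < 2 * (sg + 1) by rewrite mulr_gt0// ltr_wpDl.
have [rho rho0 /and3P[rho1 rho2 _]] :=
  @pos_lower_bound R [:: dc; u / (2 * (sg + 1))] ltac:(by rewrite /= dc0 divr_gt0).
have rho_u : 2 * rho * sg < u.
  rewrite ler_pdivlMr// in rho2; apply: lt_le_trans rho2.
  by rewrite -mulrA mulrCA ltr_pM2l// ltr_pM2l//; lra.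
exists rho => // e e0.
pose Ex := expR (40 * K2 * (2 * rho)); have Ex0 : 0 < Ex by exact: expR_gt0.
have [k k0 /and4P[k1 k2 k3 _]] := @pos_lower_bound R [:: 1; u / C; e / K5]
  ltac:(by rewrite /= ltr01 (divr_gt0 u0 C0) (divr_gt0 e0 K50)).
have CL0 : 0 < 8 * K2 * (C + L) by exact: mulr_gt0 (mulr_gt0 (ltr0Sn _ 7) K20) (addr_gt0 C0 L0).
have c3 : 0 < 1 / (8 * K2) by exact: divr_gt0 ltr01 (mulr_gt0 (ltr0Sn _ 7) K20).
have c5 : 0 < 1 / (8 * K2 * (C + L)) by rewrite divr_gt0.
have c6 : 0 < k / (Ex * K6) by rewrite divr_gt0// mulr_gt0.
(* In turn these thresholds give [t < rho], [t <= 1], [K2 * t <= 1 / 8], steps shorter than [u],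
   increments small enough for the bootstrap, and an initial error that the growth factor [Ex]
   leaves below [k]. *)
have [dl dl0 /= /and5P[d1 d2 d3 d4 /and3P[d5 d6 _]]] := @pos_lower_bound R
  [:: rho / 2; 1; 1 / (8 * K2); u / 2; 1 / (8 * K2 * (C + L)); k / (Ex * K6)]
  ltac:(by rewrite /= ltr01 c3 c5 c6 (divr_gt0 rho0 (ltr0Sn _ 1)) (divr_gt0 u0 (ltr0Sn _ 1))).
exists dl => // p N t l dg steps t0 tdl lN hl trl i iN hi.
have Ck : C * k <= u by rewrite mulrC -ler_pdivlMr.
have K5k : K5 * k <= e by rewrite mulrC -ler_pdivlMr.
apply: (tracks_le (ltW t0) K5k).
have dlu : dl < u by apply: le_lt_trans d4 _; lra.
have t_rho : t < rho by apply: le_lt_trans (le_trans tdl d1) _; lra.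
apply: (@track_main _ _ _ M c s0 r C phi psi S Kc dc gc ch Kc0 taylor rho rho1 rho_u
  p N t dg t0 t_rho _ _ l k dl) => //.
- exact: le_trans d2.
- change (K2 * t <= 1 / 8).
  have h : t * (8 * K2) <= 1.
    by rewrite -ler_pdivlMr; [exact: le_trans tdl d3|exact: mulr_gt0].
  by rewrite ler_pdivlMr// mulrAC mulrC (mulrC K2).
- move=> j jN; have sj := steps j jN; split; first exact: le_lt_trans dlu.
  change (8 * K2 * (C * frob (p j.+1 - p j) + L * t) <= 1).
  apply: le_trans (_ : 8 * K2 * (C + L) * dl <= _).
    rewrite -[leRHS]mulrA; apply: ler_wpM2l; first by apply: ltW; exact: mulr_gt0.
    by rewrite [leRHS]mulrDl; apply: lerD; rewrite ler_pM2l.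
  by rewrite mulrC -ler_pdivlMr.
- change (Ex * (K6 * dl) <= k).
  by rewrite mulrA mulrC -ler_pdivlMr// mulr_gt0.
Qed.

(** Continuation in [T]: the supremum of the good times is the centre of a window of
    [local_stability], so a good time just below it hands the chain over and the estimate passes
    beyond it. *)
Lemma global_stability (T e : R) : 0 < e -> exists2 dl : R, 0 < dl & forall p N t,
  discrete_geodesic M p N -> (forall i, (i < N)%N -> frob (p i.+1 - p i) <= dl) ->
  0 < t -> t <= dl -> tracks c p t dl 0 ->
  forall i, (i < N)%N -> i%:R * t <= T -> tracks c p t e i.
Proof.
pose GS T := forall e : R, 0 < e -> exists2 dl : R, 0 < dl & forall p N t,
  discrete_geodesic M p N -> (forall i, (i < N)%N -> frob (p i.+1 - p i) <= dl) ->
  0 < t -> t <= dl -> tracks c p t dl 0 ->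
  forall i, (i < N)%N -> i%:R * t <= T -> tracks c p t e i.
suff: GS T by exact.
have GSle T1 T2 : T1 <= T2 -> GS T2 -> GS T1.
  move=> T12 G e' e'0; have [dl dl0 H] := G e' e'0; exists dl => // p N t ? ? ? ? ? i iN iT.
  by apply: (H p N t) => //; exact: le_trans T12.
have GS0 : GS 0.
  move=> e' e'0; exists e' => [//|p N t _ _ t0 _ tr [|i] _ it0]; first exact: tr.
  exfalso; have it1 : 0 < i.+1%:R * t by exact: mulr_gt0 (ltr0Sn R i) t0.
  by clear tr; have := lt_le_trans it1 it0; rewrite ltxx.
apply: contrapT => nT.
pose A := [set x | GS x].
have ubA : ubound A T.
  by move=> x Ax; rewrite leNgt; apply/negP => Tx; apply: nT; exact: GSle (ltW Tx) Ax.
have supA : has_sup A by split; [exists 0|exists T].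
pose s0 := sup A.
have [rho rho0 LS] := local_stability s0.
have [T' AT' T's] := sup_adherent rho0 supA.
have T'le : T' <= s0 by apply: ub_le_sup => //; exists T.
have T'0 : 0 <= T' \/ T' < 0 by case: leP; [left|right].
suff G : GS (s0 + rho / 2).
  have : s0 + rho / 2 <= s0 by apply: ub_le_sup => //; exists T.
  by move: rho0; lra.
wlog T'p : T' AT' T's T'le {T'0} / 0 <= T'.
  move=> H; case: T'0 => h; first exact: (H T').
  by apply: (H 0) => //; [move: T's h; rewrite -/s0; lra|apply: ub_le_sup => //; exists T].
move=> e' e'0; have [dl1 dl10 H1] := LS e' e'0.
have [dl2 dl20 H2] := AT' (Num.min e' dl1) ltac:(by rewrite lt_min e'0).
have gap : 0 < (T' - (s0 - rho)) / 2 by rewrite divr_gt0// subr_gt0.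
have [dl dl0 /and4P[a1 a2 a3 _]] := @pos_lower_bound R
  [:: dl1; dl2; (T' - (s0 - rho)) / 2] ltac:(by rewrite /= dl10 dl20 gap).
exists dl => // p N t dg steps t0 tdl tr i iN iT.
have steps1 j : (j < N)%N -> frob (p j.+1 - p j) <= dl1.
  by move=> /steps h; exact: le_trans a1.
have steps2 j : (j < N)%N -> frob (p j.+1 - p j) <= dl2.
  by move=> /steps h; exact: le_trans a2.
have G2 := H2 p N t dg steps2 t0 (le_trans tdl a2) (tracks_le (ltW t0) a2 tr).
have [iT'|T'i] := leP (i%:R * t) T'.
  apply: tracks_le (ltW t0) _ (G2 i iN iT').
  by clear; rewrite ge_min lexx.
(* The last index with time at most [T']. Its time exceeds [T' - t], which the third threshold on
   [dl] keeps inside the window. *)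
pose l := Num.truncn (T' / t).
have /andP[l1 l2] : l%:R <= T' / t < l.+1%:R by apply: truncn_itv; rewrite divr_ge0// ltW.
rewrite ler_pdivlMr// in l1; rewrite ltr_pdivrMr// -natr1 mulrDl mul1r in l2.
have li : (l <= i)%N.
  by rewrite -(@ler_nat R) -(ler_pM2r t0); apply: le_trans l1 (ltW T'i).
have lN := leq_ltn_trans li iN.
have trl : tracks c p t dl1 l.
  apply: tracks_le (ltW t0) _ (G2 l lN l1).
  by clear; rewrite ge_min lexx orbT.
apply: (H1 p N t l) => //.
- exact: le_trans a1.
- by rewrite ltr_norml; move: (le_trans tdl a3) gap T'le; move: l1 l2; rewrite -/s0; lra.
- by rewrite li.
- by rewrite ltr_norml; move: T'i iT T's; rewrite -/s0; move: rho0; lra.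
Qed.

End stability.

(** * Completeness *)

Lemma mxdot_mxvec {R : realType} {m n : nat} (A B : 'M[R]_(m, n)) :
  mxdot (mxvec A) (mxvec B) = mxdot A B.
Proof.
rewrite /mxdot big_ord1 pair_big/= (reindex (uncurry (@mxvec_index m n))) /=; last first.
  by have [g gK Kg] := curry_mxvec_bij m n; exists g.
by apply: eq_bigr => -[i j] _; rewrite /= !mxvecE.
Qed.

Section compactness.
Context {R : realType} {m n : nat}.
Implicit Types (K : set 'M[R]_(m, n)) (x z : 'M[R]_(m, n)).

Definition adherent K x := forall e : R, 0 < e -> exists2 y, K y & frob (x - y) <= e.

Lemma frob_closedP K : closed K <-> forall x, adherent K x -> K x.
Proof.
split=> [cK x ax|aK x cx].
  apply: cK => B /nbhs_frobP[e e0 eB].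
  have [y Ky xy] := ax (e / 2) (divr_gt0 e0 (ltr0Sn _ 1)).
  exists y; split=> //; apply: eB; rewrite frob_distC.
  by apply: le_lt_trans xy _; lra.
apply: aK => e e0.
have nb : nbhs x [set y | frob (y - x) < e] by apply/nbhs_frobP; exists e.
have [y [Ky yx]] := cx _ nb.
by exists y => //; rewrite frob_distC; exact: ltW.
Qed.

(** Heine-Borel for row vectors is carried over by [vec_mx], an isometry for the Frobenius norm. *)
Lemma frob_closed_compact K (B : R) : (forall x, K x -> frob x <= B) ->
  (forall x, adherent K x -> K x) -> compact K.
Proof.
move=> KB /frob_closedP cK.
have fv (v : 'rV[R]_(m * n)) : frob (vec_mx v : 'M[R]_(m, n)) = frob v.
  by rewrite /frob -mxdot_mxvec vec_mxK.
have cv : continuous (vec_mx : 'rV[R]_(m * n) -> 'M[R]_(m, n)).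
  move=> v P /nbhs_frobP[e e0 eP]; apply/nbhs_frobP; exists e => // w wv.
  by apply: eP; rewrite -linearB/= fv.
pose K' := (vec_mx : 'rV[R]_(m * n) -> 'M[R]_(m, n)) @^-1` K.
have cK' : compact K'.
  apply: bounded_closed_compact; last exact: closed_comp.
  exists B; split; first exact: num_real.
  move=> b Bb v /KB; rewrite fv => vB.
  by apply: le_trans (mx_norm_le_frob _) _; exact: le_trans vB (ltW Bb).
have -> : K = (vec_mx : 'rV[R]_(m * n) -> 'M[R]_(m, n)) @` K'.
  apply/seteqP; split=> [x Kx|_ [v Kv <-]//].
  by exists (mxvec x); rewrite /K' /= ?mxvecK.
apply: continuous_compact => //.
by apply: continuous_subspaceT => v; exact: cv.
Qed.

Lemma compact_frob_cover K (r : 'M[R]_(m, n) -> R) : compact K ->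
  (forall z, K z -> 0 < r z) -> exists2 s : seq 'M[R]_(m, n),
    (forall z, z \in s -> K z) &
    forall x, K x -> exists2 z, z \in s & frob (x - z) < r z.
Proof.
move=> cK r0; pose U z := [set x | frob (x - z) < r z].
have oU z : K z -> open (U z).
  move=> Kz; rewrite openE => x Ux; apply/nbhs_frobP.
  exists (r z - frob (x - z)); first by rewrite subr_gt0.
  move=> y yx; rewrite /U/=; apply: le_lt_trans (frob_dist_triangle x _ _) _.
  by rewrite -ltrBrDr.
move: cK; rewrite compact_cover => /(_ _ K U oU)[|D DK cov].
  by move=> x Kx; exists x => //; rewrite /U/= subrr frob0 r0.
exists (finmap.enum_fset D) => [z zD|x /cov[z zD xz]].
  by have := DK z zD; rewrite inE.
by exists z.
Qed.

Lemma seq_pos_min (s : seq 'M[R]_(m, n)) (r : 'M[R]_(m, n) -> R) :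
  (forall z, z \in s -> 0 < r z) ->
  exists2 d : R, 0 < d & forall z, z \in s -> d <= r z.
Proof.
move=> r0; have [d d0 /allP dP] := @pos_lower_bound R (map r s)
  ltac:(by apply/allP => _ /mapP[z zs ->]; exact: r0).
by exists d => // z zs; apply: dP; exact: map_f.
Qed.

(* Lebesgue number, for a property of pairs that holds near every diagonal
   point. *)
Lemma compact_uniform K (P : 'M[R]_(m, n) -> 'M[R]_(m, n) -> Prop) : compact K ->
  (forall z, K z -> exists2 d : R, 0 < d & forall x y,
     frob (x - z) < d -> frob (y - z) < d -> P x y) ->
  exists2 d : R, 0 < d & forall x y, K x -> frob (y - x) < d -> P x y.
Proof.
move=> cK locP; pose r z := xget 1 [set d : R | 0 < d /\ forall x y,
  frob (x - z) < d -> frob (y - z) < d -> P x y].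
have rP z : K z -> 0 < r z /\ forall x y, frob (x - z) < r z -> frob (y - z) < r z -> P x y.
  move=> /locP[d d0 dP]; rewrite /r; case: xgetP => [e _ //|/(_ d)/= h].
  by exfalso; apply: h.
have [|s sK cov] := @compact_frob_cover K (fun z => r z / 2) cK.
  by move=> z /rP[r0 _]; rewrite divr_gt0.
have [|d d0 ds] := @seq_pos_min s (fun z => r z / 2).
  by move=> z /sK/rP[r0 _]; rewrite divr_gt0.
exists d => // x y Kx yx; have [z zs xz] := cov x Kx.
have [r0 zP] := rP z (sK _ zs); apply: zP; first by move: xz; lra.
apply: le_lt_trans (frob_dist_triangle x _ _) _.
by have := ds z zs; lra.
Qed.

(** A cluster point replaces a convergent subsequence: indices beyond any [J] with [v j] close to
    [l] are all that a limiting argument consumes. *)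
Lemma bounded_seq_cluster (v : nat -> 'M[R]_(m, n)) (B : R) :
  (forall j, frob (v j) <= B) -> exists2 l, frob l <= B &
  forall (e : R) J, 0 < e -> exists2 j, (J <= j)%N & frob (v j - l) <= e.
Proof.
move=> vB; pose K := [set x : 'M[R]_(m, n) | frob x <= B].
have cK : compact K.
  apply: (@frob_closed_compact _ B) => // x ax; rewrite /K/=.
  apply/ler_addgt0Pr => e e0; have [y Ky xy] := ax e e0.
  by apply: le_trans (frob_le_distD _ y) _; exact: lerD.
have [|l [Kl cl]] := cK (v @ \oo) _.
  by exists 0%N => // j _ /=; exact: vB.
exists l => // e J e0.
have nb : nbhs l [set y | frob (y - l) < e] by apply/nbhs_frobP; exists e.
have FJ : (v @ \oo) [set v j | j in [set j | (J <= j)%N]].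
  by exists J => // j /= Jj; exists j.
have [_ [[j Jj <-] vl]] := cl _ _ FJ nb.
by exists j => //; exact: ltW.
Qed.

End compactness.

(** * Points reached by paths of bounded length *)

Section reach.
Context {R : realType} {m n : nat} (M : set 'M[R]_(m, n)).
Implicit Types (x y q : 'M[R]_(m, n)) (r : R).

(* [q] is the end of a path in [M] of length at most [r] starting at [x]. *)
Definition reach x r q : Prop := exists g : R -> 'M[R]_(m, n),
  [/\ g 0 = x, g r = q, forall s, 0 <= s <= r -> M (g s) &
      forall s s', 0 <= s <= r -> 0 <= s' <= r -> frob (g s - g s') <= `|s - s'|].

Lemma reach_M x r q : 0 <= r -> reach x r q -> M q.
Proof. by move=> r0 [g [_ <- gM _]]; apply: gM; rewrite r0 lexx. Qed.

Lemma reach_dist x r q : 0 <= r -> reach x r q -> frob (q - x) <= r.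
Proof.
move=> r0 [g [<- <- _ gl]]; have := gl r 0; rewrite subr0 (ger0_norm r0); apply.
  by rewrite r0 lexx.
by rewrite lexx r0.
Qed.

Lemma reach_refl x r : M x -> reach x r x.
Proof. by move=> Mx; exists (fun=> x); split=> // s s' _ _; rewrite subrr frob0. Qed.

Lemma reach_cat x y q r r' : 0 <= r -> 0 <= r' -> reach x r y -> reach y r' q ->
  reach x (r + r') q.
Proof.
move=> r0 r'0 [g [g0 gr gM gl]] [h [h0 hr hM hl]].
pose k s := if s <= r then g s else h (s - r).
exists k; split.
- by rewrite /k r0.
- rewrite /k; case: ifPn => [rr|_]; last by rewrite addrAC subrr add0r.
  have r'E : r' = 0 by lra.
  by rewrite r'E addr0 gr -h0 -hr r'E.
- move=> s /andP[s0 sr]; rewrite /k; case: leP => sr'; first by apply: gM; rewrite s0.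
  by apply: hM; lra.
have key s s' : 0 <= s -> s <= s' -> s' <= r + r' -> frob (k s - k s') <= `|s - s'|.
  move=> s0 ss' s'r; rewrite /k; case: (leP s r) => sr; case: (leP s' r) => s'r'.
  - by apply: gl; lra.
  - apply: le_trans (frob_dist_triangle y _ _) _.
    have h1 : frob (g s - y) <= `|s - r| by rewrite -gr; apply: gl; lra.
    have h2 : frob (y - h (s' - r)) <= `|0 - (s' - r)| by rewrite -h0; apply: hl; lra.
    apply: le_trans (lerD h1 h2) _.
    rewrite !ler0_norm; lra.
  - lra.
  - apply: le_trans (hl _ _ _ _) _; try lra.
    by rewrite opprB addrA subrK.
move=> s s' sr s'r; have [ss'|/ltW ss'] := leP s s'; first by apply: key; lra.
by rewrite frob_distC distrC; apply: key; lra.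
Qed.

Lemma reach_le x q r r' : 0 <= r -> r <= r' -> reach x r q -> reach x r' q.
Proof.
move=> r0 rr' xq; have := reach_cat r0 (_ : 0 <= r' - r) xq (reach_refl _ (reach_M r0 xq)).
by rewrite subrKC subr_ge0; exact.
Qed.

Lemma reach_shorten x r q (e : R) : 0 <= r -> 0 <= e <= r -> reach x r q ->
  exists2 q', reach x (r - e) q' & frob (q - q') <= e.
Proof.
move=> r0 er [g [g0 gr gM gl]]; exists (g (r - e)).
  exists g; split=> // [s sr|s s' sr sr']; first by apply: gM; lra.
  by apply: gl; lra.
rewrite -gr; apply: le_trans (gl _ _ _ _) _; try lra.
by rewrite opprB subrKC ger0_norm; lra.
Qed.

End reach.

(** Ambient distance and path length agree to first order. The path is the image under [psi] of the
    segment from [phi x] to [phi y]; its velocity differs from [y - x] by at most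
    [e * frob (y - x)], the errors of the chart being quadratic. *)
Lemma chart_reach {R : realType} {m n : nat} (M : set 'M[R]_(m, n)) z r C phi psi S :
  chart M z r C phi psi S -> forall (e : R) (x y : 'M[R]_(m, n)), 0 < e ->
  2 * C ^+ 3 * frob (y - x) <= e -> M x -> M y ->
  frob (x - z) < r / C -> frob (y - z) < r / C ->
  reach M x ((1 + e) * frob (y - x)) y.
Proof.
move=> ch e x y e0 sm Mx My xz yz.
have [->|xy] := eqVneq y x; first by rewrite subrr frob0 mulr0; exact: reach_refl.
have C0 := chart_C0 ch.
have D0 : 0 < frob (y - x).
  rewrite lt_def frob_ge0 andbT; apply: contra_neq xy => /frob_eq0/eqP.
  by rewrite subr_eq0 => /eqP.
have [xr wr] := chart_phi_near ch (lexx r) xz.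
have [yr vr] := chart_phi_near ch (lexx r) yz.
set w := phi x in wr *; set v := phi y in vr *.
have wS : w \in S by apply/(chart_M ch xr).
have vS : v \in S by apply/(chart_M ch yr).
pose o : 'M[R]_(m, n) := v - w; pose D : 'M[R]_(m, n) := y - x.
have oC : frob o <= C * frob D by exact: (chart_phi_lipschitz ch yr xr).
have seg (s : R) : 0 <= s <= 1 -> frob (w + s *: o - phi z) < r by exact: frob_segment_lt.
have tp := chart_psi ch.
have dif (s : R) : 0 <= s <= 1 -> differentiable psi (w + s *: o).
  by move=> /seg/(tame_bounded tp)[].
have pw : psi w = x by exact: (chart_phiK ch).
have pv : psi v = y by exact: (chart_phiK ch).
pose h (s : R) := psi (w + s *: o) - (0 + s *: D).
have hD (s : R) : 0 <= s <= 1 -> is_derive s (1 : R) h ('D_o psi (w + s *: o) - D).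
  move=> s01; exact: (is_deriveB (is_derive_along_line (dif s s01)) (is_derive_line 0 D s)).
have o2 : frob o ^+ 2 <= C ^+ 2 * frob D ^+ 2.
  by rewrite -exprMn ler_pXn2r ?nnegrE ?frob_ge0// mulr_ge0 ?frob_ge0// ltW.
have hB (s : R) : 0 <= s <= 1 -> frob ('D_o psi (w + s *: o) - D) <= e * frob D.
  move=> s01; apply: le_trans (frob_dist_triangle ('D_o psi w) _ _) _.
  have h1 : frob ('D_o psi (w + s *: o) - 'D_o psi w) <= C * frob o * frob o.
    apply: le_trans (tame_lipschitz_derive tp o (seg s s01) wr) _.
    rewrite addrAC subrr add0r frobZ; case/andP : s01 => s0 s1.
    apply: ler_wpM2l; first by rewrite mulr_ge0 ?frob_ge0// ltW.
    by rewrite ger0_norm// ler_piMl// frob_ge0.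
  have h2 : frob ('D_o psi w - D) <= C * frob o ^+ 2.
    rewrite frob_distC; have := tame_quad0 (a := o) tp wr.
    by rewrite /o subrKC pw pv; exact.
  apply: le_trans (lerD h1 h2) _.
  rewrite -mulrA -expr2 -mulrDr; apply: (@le_trans _ _ (2 * C ^+ 3 * frob D * frob D)).
    rewrite (_ : 2 * C ^+ 3 * _ * _ = C * (C ^+ 2 * frob D ^+ 2 + C ^+ 2 * frob D ^+ 2)).
      by rewrite ler_pM2l// lerD.
    by ring.
  by rewrite ler_pM2r.
pose l := (1 + e) * frob D; have l0 : 0 < l by rewrite mulr_gt0// addr_gt0.
have key a b : 0 <= a -> a <= b -> b <= 1 ->
    frob (psi (w + b *: o) - psi (w + a *: o)) <= l * (b - a).
  move=> a0 ab b1.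
  have hb : frob (h b - h a) <= e * frob D * (b - a).
    apply: (frob_mean_value ab (fun s sab => hD s _)) => s sab; last by apply: hB; lra.
    by lra.
  have -> : psi (w + b *: o) - psi (w + a *: o) = (h b - h a) + (b - a) *: D.
    rewrite /h; move: (psi _) (psi _) => p1 p2.
    by apply/matrixP => i j; rewrite !mxE; ring.
  apply: le_trans (frobD _ _) _; rewrite frobZ ger0_norm ?subr_ge0//.
  rewrite (_ : l * (b - a) = e * frob D * (b - a) + (b - a) * frob D).
    by rewrite lerD2r.
  by rewrite /l; ring.
exists (fun s => psi (w + (s / l) *: o)); split.
- by rewrite mul0r scale0r addr0.
- by rewrite divff ?gt_eqF// scale1r /o subrKC.
- move=> s /andP[s0 sl]; have sl1 : 0 <= s / l <= 1.
    by rewrite divr_ge0 ?(ltW l0)//= ler_pdivrMr// mul1r.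
  by apply/(chart_psiM ch (seg _ sl1)); rewrite memvD// memvZ// memvB.
have sym s s' : 0 <= s -> s <= s' -> s' <= l ->
    frob (psi (w + (s / l) *: o) - psi (w + (s' / l) *: o)) <= `|s - s'|.
  move=> s0 ss' s'l; rewrite frob_distC; apply: le_trans (key _ _ _ _ _) _.
  - by rewrite divr_ge0// ltW.
  - by rewrite ler_pM2r ?invr_gt0.
  - by rewrite ler_pdivrMr// mul1r.
  rewrite -mulrBl mulrC divfK ?gt_eqF// distrC; exact: ler_norm.
move=> s s' /andP[s0 sl] /andP[s'0 s'l].
have [ss'|/ltW ss'] := leP s s'; first exact: sym.
by rewrite frob_distC distrC; exact: sym.
Qed.

(** * Chains of minimal energy *)

Lemma sum_sqr_le {R : realType} N (a : nat -> R) :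
  (\sum_(i < N) a i) ^+ 2 <= N%:R * \sum_(i < N) a i ^+ 2.
Proof.
pose u : 'rV[R]_N := \row_i a i; pose v : 'rV[R]_N := const_mx 1.
have -> : \sum_(i < N) a i = mxdot u v.
  by rewrite /mxdot big_ord1; apply: eq_bigr => i _; rewrite !mxE mulr1.
have -> : \sum_(i < N) a i ^+ 2 = frob u ^+ 2.
  by rewrite sqr_frob /mxdot big_ord1; apply: eq_bigr => i _; rewrite !mxE expr2.
have -> : N%:R = frob v ^+ 2.
  rewrite sqr_frob /mxdot big_ord1 -[N in LHS]card_ord -sumr_const.
  by apply: eq_bigr => i _; rewrite !mxE mulr1.
rewrite -exprMn mulrC -real_normK ?num_real//.
by rewrite ler_pXn2r ?nnegrE ?mulr_ge0 ?frob_ge0// normr_mxdot_le.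
Qed.

Lemma continuous_at_sum {R : realType} {T : topologicalType} (I : Type) (s : seq I)
    (F : I -> T -> R) (f : T) :
  (forall i, {for f, continuous (F i)}) ->
  {for f, continuous (fun t => \sum_(i <- s) F i t)}.
Proof.
move=> cF; elim: s => [|i s IH].
  have -> : (fun t => \sum_(i <- [::]) F i t) = cst 0.
    by apply/funext => t; rewrite big_nil.
  exact: cst_continuous.
have -> : (fun t => \sum_(j <- i :: s) F j t) = F i + (fun t => \sum_(j <- s) F j t).
  by apply/funext => t; rewrite big_cons.
exact: continuousD.
Qed.

Section minimal_chain.
Context {R : realType} {m n : nat} (d : nat) (M : set 'M[R]_(m, n)).
Hypothesis eM : embedded_submanifold d M.
Variables (x0 : 'M[R]_(m, n)).

(** By Cauchy-Schwarz, [N] times this quantity dominates the squared length of the chain, with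
    equality for equal steps; the squares make it differentiable in the points. *)
Definition energy (N : nat) (p : nat -> 'M[R]_(m, n)) : R :=
  \sum_(i < N) frob (p i.+1 - p i) ^+ 2.

Lemma reach_adherent_compact r : 0 <= r -> compact (adherent (reach M x0 r)).
Proof.
move=> r0; apply: (@frob_closed_compact _ _ _ _ (frob x0 + r + 1)) => x ax.
  have [y ry xy] := ax 1 ltr01; have := reach_dist r0 ry.
  have := frob_le_distD x y; have := frob_le_distD y x0; move: xy; lra.
move=> e e0; have e2 : 0 < e / 2 by rewrite divr_gt0.
have [y ay xy] := ax _ e2; have [q rq yq] := ay _ e2.
exists q => //; apply: le_trans (frob_dist_triangle y _ _) _.
by move: xy yq; lra.
Qed.

Lemma uniform_reach (K : set 'M[R]_(m, n)) (e : R) : compact K -> K `<=` M -> 0 < e ->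
  exists2 l : R, 0 < l & forall x y, K x -> frob (y - x) < l ->
    M x -> M y -> reach M x ((1 + e) * frob (y - x)) y.
Proof.
move=> cK KM e0; apply: compact_uniform => // z /KM Mz.
have [r [C [phi [psi [S ch]]]]] := chart_exists eM Mz.
have C0 := chart_C0 ch; have r0 := chart_r ch.
have c3 : 0 < 4 * C ^+ 3 by rewrite mulr_gt0// exprn_gt0.
have [l l0 /and3P[l1 l2 _]] := @pos_lower_bound R [:: r / C; e / (4 * C ^+ 3)]
  ltac:(by rewrite /= (divr_gt0 r0 C0) (divr_gt0 e0 c3)).
exists l => // x y xz yz Mx My; apply: (chart_reach ch) => //.
- have yx : frob (y - x) <= 2 * l.
    apply: le_trans (frob_dist_triangle z _ _) _.
    by rewrite (frob_distC z); move: xz yz; lra.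
  apply: le_trans (_ : 2 * C ^+ 3 * (2 * l) <= _).
    by apply: ler_wpM2l => //; rewrite mulr_ge0// exprn_ge0// ltW.
  by rewrite ler_pdivlMr// in l2; lra.
- exact: lt_le_trans l1.
- exact: lt_le_trans l1.
Qed.

(** A chain is a point of a product of compact sets, its end points being pinned by singletons. The
    product is compact by Tychonoff, and the energy is continuous as it involves finitely many
    coordinates. *)
Lemma minimal_chain_exists (K : set 'M[R]_(m, n)) N (p0 : nat -> 'M[R]_(m, n)) :
  compact K -> (forall i, K (p0 i)) -> exists p : nat -> 'M[R]_(m, n),
  [/\ p 0%N = p0 0%N, p N = p0 N, forall i, K (p i) &
      forall p' : nat -> 'M[R]_(m, n), p' 0%N = p0 0%N -> p' N = p0 N ->
        (forall i, K (p' i)) -> energy N p <= energy N p'].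
Proof.
move=> cK Kp0; pose A i := if (i == 0%N) || (i == N) then [set p0 i] else K.
have cA i : compact (A i) by rewrite /A; case: ifP => // _; exact: compact_set1.
pose AA := [set f : prod_topology (fun _ : nat => 'M[R]_(m, n)) | forall i, A i (f i)].
have cAA : compact AA := tychonoff cA.
have AA0 : AA !=set0 by exists p0 => i; rewrite /A; case: ifP.
have cE : continuous (energy N : prod_topology (fun _ : nat => 'M[R]_(m, n)) -> R).
  have prj i : continuous (fun f : prod_topology (fun _ : nat => 'M[R]_(m, n)) => f i).
    exact: (@proj_continuous _ (fun _ : nat => 'M[R]_(m, n)) i).
  move=> f; apply: (@continuous_at_sum R _ _ (index_enum 'I_N)
    (fun i (f : prod_topology (fun _ : nat => 'M[R]_(m, n))) => frob (f i.+1 - f i) ^+ 2)) => i.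
  have -> : (fun f : prod_topology (fun _ : nat => 'M[R]_(m, n)) =>
      frob (f i.+1 - f i) ^+ 2) = (fun f => \sum_(a < m) \sum_(b < n)
        ((f i.+1 : 'M[R]_(m, n)) a b - (f i : 'M[R]_(m, n)) a b) *
        ((f i.+1 : 'M[R]_(m, n)) a b - (f i : 'M[R]_(m, n)) a b)).
    apply/funext => g; rewrite sqr_frob /mxdot; apply: eq_bigr => a _.
    by apply: eq_bigr => b _; rewrite !mxE.
  apply: (@continuous_at_sum R _ _ (index_enum 'I_m)
    (fun a (f : prod_topology (fun _ : nat => 'M[R]_(m, n))) => \sum_(b < n)
        ((f i.+1 : 'M[R]_(m, n)) a b - (f i : 'M[R]_(m, n)) a b) *
        ((f i.+1 : 'M[R]_(m, n)) a b - (f i : 'M[R]_(m, n)) a b))) => a.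
  apply: (@continuous_at_sum R _ _ (index_enum 'I_n)
    (fun b (f : prod_topology (fun _ : nat => 'M[R]_(m, n))) =>
        ((f i.+1 : 'M[R]_(m, n)) a b - (f i : 'M[R]_(m, n)) a b) *
        ((f i.+1 : 'M[R]_(m, n)) a b - (f i : 'M[R]_(m, n)) a b))) => b.
  have cab j : {for f, continuous (fun f : prod_topology (fun _ : nat => 'M[R]_(m, n)) => f j a b)}.
    apply: (@continuous_comp _ _ _ (fun f : prod_topology (fun _ : nat => 'M[R]_(m, n)) => f j)
      (fun X : 'M[R]_(m, n) => X a b)); first exact: prj.
    exact: coord_continuous.
  have cd : {for f, continuous (fun f : prod_topology (fun _ : nat => 'M[R]_(m, n)) =>
      f i.+1 a b - f i a b)}.
    exact: (continuousB (cab i.+1) (cab i)).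
  exact: (continuousM cd cd).
have [p pA pmin] := compact_EVT_min AA0 cAA (continuous_subspaceT cE).
have {}pA : AA p by exact: set_mem.
have p_0 : p 0%N = p0 0%N by have := pA 0%N; rewrite /A eqxx.
have p_N : p N = p0 N by have := pA N; rewrite /A eqxx orbT.
exists p; split=> // [i|p' h0 hN hK].
  by have := pA i; rewrite /A; case: ifP => // _ ->; exact: Kp0.
apply: pmin; apply/mem_set => i; rewrite /A.
by case: ifPn => // /orP[] /eqP ->.
Qed.

End minimal_chain.

Lemma energy_replace {R : realType} {m n : nat} (p : nat -> 'M[R]_(m, n)) N i y :
  (i.+1 < N)%N ->
  energy N (fun j => if j == i.+1 then y else p j) - energy N p =
  frob (y - p i) ^+ 2 + frob (p i.+2 - y) ^+ 2
  - (frob (p i.+1 - p i) ^+ 2 + frob (p i.+2 - p i.+1) ^+ 2).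
Proof.
move=> iN; pose a := Ordinal (ltnW iN); pose b := Ordinal iN.
have ba : b != a by rewrite -val_eqE/= gtn_eqF.
have E (f : nat -> 'M[R]_(m, n)) : energy N f = frob (f i.+1 - f i) ^+ 2 +
    (frob (f i.+2 - f i.+1) ^+ 2 +
     \sum_(j < N | (j != a) && (j != b)) frob (f j.+1 - f j) ^+ 2).
  by rewrite /energy (bigD1 a)//= (bigD1 b).
rewrite (E p) E !eqxx (ltn_eqF (ltnSn i)) (gtn_eqF (ltnSn i.+1)).
rewrite (eq_bigr (fun j : 'I_N => frob (p j.+1 - p j) ^+ 2)) => [|j /andP[ja jb]].
  by move: (frob _ ^+ 2) (frob _ ^+ 2) (frob _ ^+ 2) (frob _ ^+ 2) (\sum_(_ | _) _) => *; ring.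
move: ja jb; rewrite -!val_eqE/= => ja jb.
by rewrite eqSS (negbTE ja) (negbTE jb).
Qed.

Section discrete_geodesics.
Context {R : realType} {m n : nat} (d : nat) (M : set 'M[R]_(m, n)).
Hypothesis eM : embedded_submanifold d M.
Variables (x0 : 'M[R]_(m, n)).

(** Fermat's rule along a curve of [M] through [y] with velocity [v]. *)
Lemma local_min_normal (p q y v : 'M[R]_(m, n)) (e : R) : 0 < e ->
  (forall x, M x -> frob (x - y) < e ->
     frob (y - p) ^+ 2 + frob (q - y) ^+ 2 <= frob (x - p) ^+ 2 + frob (q - x) ^+ 2) ->
  tangent M y v -> mxdot (q - y - (y - p)) v = 0.
Proof.
move=> e0 ymin [c [I [oI I0 sc cM c0]] cv].
pose f (s : R) := mxdot (c s - p) (c s - p) + mxdot (q - c s) (q - c s).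
have cD s : I s -> is_derive s (1 : R) c (derive1 c s).
  move=> Is; rewrite derive1E; apply: derivableP; apply/derivable1_diffP.
  exact: smooth_on_differentiable sc Is.
have fD s : I s -> is_derive s (1 : R) f
    (2 * mxdot (derive1 c s) (c s - p) - 2 * mxdot (derive1 c s) (q - c s)).
  move=> Is; have D1 := is_deriveB (cD s Is) (is_derive_cst p s (1 : R)).
  have D2 := is_deriveB (is_derive_cst q s (1 : R)) (cD s Is).
  have := is_deriveD (is_derive_mxdot D1 D1) (is_derive_mxdot D2 D2).
  move=> /is_derive_eq; apply; rewrite subr0 sub0r /= mxdotNl mxdotNr.
  by rewrite !(mxdotC _ (derive1 c s)); ring.
have nI : nbhs (0 : R) [set s | I s /\ frob (c s - y) < e].
  apply: filterI; first exact: open_nbhs_nbhs.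
  have cc : {for 0 : R, continuous c} by exact: smooth_on_continuous sc I0.
  have nb : nbhs (c 0) [set x | frob (x - y) < e].
    by rewrite c0; apply/nbhs_frobP; exists e.
  exact: (cc _ nb).
move/nbhs_normP : nI => [a /= a0 aP].
have inI s : s \in `]-a, a[%R -> I s /\ frob (c s - y) < e.
  rewrite in_itv/= => /andP[s1 s2]; apply: aP; rewrite /ball_/= sub0r normrN.
  by rewrite ltr_norml s1.
have z_in : (0 : R) \in `]-a, a[%R by rewrite in_itv/= oppr_lt0 a0.
have Na : - a <= a by lra.
have := @derive1_at_min R f (- a) a 0 Na.
move=> /(_ _ z_in)[].
- by move=> s /inI[/fD[]].
- move=> s /inI[Is se]; rewrite /f -!sqr_frob c0.
  by apply: ymin => //; exact: cM.
move=> _; have [_ ->] := fD 0 I0; rewrite c0 cv => fE.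
by rewrite mxdotBl !(mxdotC _ v); lra.
Qed.

(** Minimality yields the normal equation only where interior points can move freely within the
    compact constraint [K]. The gap between [r] and [r1] provides the room: the minimiser has length
    at most [r], so its points are reached within [r2], halfway to [r1], and nearby points of [M]
    still belong to [K]. *)
Lemma discrete_geodesic_exists (r r1 dl : R) q : 0 <= r -> r < r1 -> 0 < dl ->
  adherent (reach M x0 r1) `<=` M -> reach M x0 r q ->
  exists N p, [/\ (0 < N)%N, p 0%N = x0, p N = q & N%:R^-1 <= dl] /\
    [/\ discrete_geodesic M p N, forall i, (i < N)%N -> frob (p i.+1 - p i) <= dl &
        N%:R * energy N p <= r ^+ 2].
Proof.
move=> r0 rr1 dl0 KM rq; pose K := adherent (reach M x0 r1).
have r10 : 0 <= r1 by lra.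
have cK : compact K by exact: reach_adherent_compact.
(* Chosen so that [(1 + h) * r] is at most the midpoint of [r] and [r1]; the [+ 1] covers
   [r = 0]. *)
pose h := (r1 - r) / (2 * (r + 1)).
have r20 : 0 < 2 * (r + 1) by lra.
have h0 : 0 < h by rewrite divr_gt0// subr_gt0.
have hr : h * r <= (r1 - r) / 2.
  rewrite /h mulrAC ler_pdivrMr//.
  rewrite (_ : (r1 - r) / 2 * (2 * (r + 1)) = (r1 - r) * r + (r1 - r)); last by field.
  by rewrite lerDl subr_ge0 ltW.
have [l l0 lP] := uniform_reach eM cK KM h0.
have [mu mu0 /and3P[mu1 mu2 _]] := @pos_lower_bound R [:: l / 2; dl]
  ltac:(by rewrite /= dl0 divr_gt0).
(* The first summand makes every step at most [mu], since one squared step is at most the energy and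
   thus at most [r ^+ 2 / N]; the second makes [1 / N <= dl]. *)
pose N := (Num.truncn (r ^+ 2 / mu ^+ 2 + dl^-1)).+1.
have N0 : 0 < N%:R :> R by rewrite ltr0n.
have rmu0 : 0 <= r ^+ 2 / mu ^+ 2 by rewrite divr_ge0 ?sqr_ge0.
have Nbig : r ^+ 2 / mu ^+ 2 + dl^-1 < N%:R.
  have dlV0 : 0 <= dl^-1 by rewrite invr_ge0 ltW.
  by have /andP[] := truncn_itv (addr_ge0 rmu0 dlV0).
have mu20 : 0 < mu ^+ 2 by rewrite exprn_gt0.
have dlV : 0 < dl^-1 by rewrite invr_gt0.
have Nmu : r ^+ 2 / N%:R <= mu ^+ 2.
  rewrite ler_pdivrMr// -ler_pdivrMl// mulrC; apply: ltW.
  by apply: le_lt_trans Nbig; rewrite lerDl ltW.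
have Ndl : N%:R^-1 <= dl.
  rewrite -[dl]invrK lef_pV2 ?posrE//; apply: ltW; apply: le_lt_trans Nbig.
  by rewrite lerDr.
have rK s x : 0 <= s -> s <= r1 -> reach M x0 s x -> K x.
  move=> s0 sr xs e e0; exists x; last by rewrite subrr frob0 ltW.
  exact: reach_le xs.
have [g [g0 gr gM gl]] := rq.
(* The competitor samples the given path in [N] equal steps and rests at its end afterwards, so that
   all coordinates lie in [K]. *)
pose tm (i : nat) : R := (minn i N)%:R * (r / N%:R).
have tm_r i : 0 <= tm i <= r.
  rewrite /tm mulr_ge0 ?divr_ge0 ?ler0n//=.
  rewrite mulrA ler_pdivrMr// mulrC; apply: ler_wpM2l => //.
  by rewrite ler_nat geq_minr.
have K0 i : K (g (tm i)).
  have /andP[t0 tr] := tm_r i; apply: (rK (tm i)) => //; first by lra.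
  exists g; split=> // [s sr|s s' sr sr']; first by apply: gM; lra.
  by apply: gl; lra.
have [p [p0 pN pK pmin]] := minimal_chain_exists N cK K0.
have tm0 : tm 0%N = 0 by rewrite /tm min0n mul0r.
have tmN : tm N = r by rewrite /tm minnn mulrC divfK ?gt_eqF.
rewrite tm0 g0 in p0 pmin; rewrite tmN gr in pN pmin.
have Ep : energy N p <= r ^+ 2 / N%:R.
  apply: le_trans (pmin (fun i => g (tm i)) _ _ K0) _; rewrite ?tm0 ?tmN//.
  apply: (@le_trans _ _ (\sum_(i < N) (r / N%:R) ^+ 2)).
    apply: ler_sum => i _; rewrite ler_pXn2r ?nnegrE ?frob_ge0 ?divr_ge0 ?ler0n//.
    apply: le_trans (gl _ _ (tm_r _) (tm_r _)) _.
    rewrite /tm (minn_idPl (ltn_ord i)) (minn_idPl (ltnW (ltn_ord i))).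
    by rewrite -mulrBl -natrB// subSnn mul1r ger0_norm// divr_ge0 ?ler0n.
  rewrite sumr_const card_ord -[leLHS]mulr_natr expr2 -mulrA divfK ?gt_eqF//.
  by rewrite mulrAC -expr2.
have NE : N%:R * energy N p <= r ^+ 2 by rewrite mulrC -ler_pdivlMr.
have step i : (i < N)%N -> frob (p i.+1 - p i) <= mu.
  move=> iN; rewrite -(@ler_pXn2r _ 2%N)// ?nnegrE ?frob_ge0 ?(ltW mu0)//.
  apply: le_trans (le_trans Ep Nmu); rewrite /energy (bigD1 (Ordinal iN))//= lerDl.
  by apply: sumr_ge0 => j _; exact: sqr_ge0.
have pM i : M (p i) := KM _ (pK i).
have mul_ : mu < l by lra.
have pr i : (i <= N)%N -> reach M x0 ((1 + h) * \sum_(j < i) frob (p j.+1 - p j)) (p i).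
  elim: i => [_|i IH iN].
    by rewrite big_ord0 mulr0 p0; apply: reach_refl; rewrite -p0.
  rewrite big_ord_recr/= mulrDr; apply: reach_cat (IH (ltnW iN)) _.
  - by rewrite mulr_ge0 ?addr_ge0 ?(ltW h0)// sumr_ge0// => j _; exact: frob_ge0.
  - by rewrite mulr_ge0 ?addr_ge0 ?(ltW h0)// frob_ge0.
  by apply: lP => //; exact: le_lt_trans (step i iN) mul_.
have tot i : (i <= N)%N -> \sum_(j < i) frob (p j.+1 - p j) <= r.
  move=> iN; apply: (@le_trans _ _ (\sum_(j < N) frob (p j.+1 - p j))).
    rewrite (big_ord_widen N (fun j => frob (p j.+1 - p j)) iN) big_mkcond/=.
    by apply: ler_sum => j _; case: ifP => // _; exact: frob_ge0.
  rewrite -(@ler_pXn2r _ 2%N)// ?nnegrE ?sumr_ge0// => [|j _]; last exact: frob_ge0.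
  exact: le_trans (sum_sqr_le N (fun j => frob (p j.+1 - p j))) NE.
pose r2 := (r + r1) / 2.
have pr2 i : (i <= N)%N -> reach M x0 r2 (p i).
  move=> iN; apply: reach_le (pr i iN).
    by rewrite mulr_ge0 ?addr_ge0 ?(ltW h0)// sumr_ge0// => j _; exact: frob_ge0.
  apply: (@le_trans _ _ ((1 + h) * r)).
    by apply: ler_wpM2l; [rewrite addr_ge0// ltW|exact: tot].
  by rewrite mulrDl mul1r /r2; lra.
exists N, p; split; first by split.
split=> //; last by move=> i iN; exact: le_trans (step i iN) mu2.
split=> [i _|i v iN tv]; first exact: pM.
have h10 : 0 < 1 + h by rewrite addr_gt0.
have gap0 : 0 < (r1 - r2) / (1 + h) by rewrite divr_gt0// subr_gt0 /r2; lra.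
have [e e0 /and3P[e1 e2 _]] := @pos_lower_bound R [:: l; (r1 - r2) / (1 + h)]
  ltac:(by rewrite /= l0 gap0).
apply: (local_min_normal e0) tv => x Mx xe.
have Kx : K x.
  apply: (rK r1) => //; rewrite -[r1](subrKC r2); apply: reach_cat (pr2 i.+1 (ltnW iN)) _.
  - by rewrite /r2; lra.
  - by rewrite subr_ge0 /r2; lra.
  apply: reach_le (lP _ _ (pK i.+1) (lt_le_trans xe e1) (pM _) Mx).
    by rewrite mulr_ge0 ?frob_ge0// ltW.
  by rewrite mulrC -ler_pdivlMr//; apply: ltW; exact: lt_le_trans e2.
have := pmin (fun j => if j == i.+1 then x else p j).
rewrite /= (gtn_eqF iN) => /(_ p0 pN) E.
have : energy N p <= energy N (fun j => if j == i.+1 then x else p j).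
  by apply: E => j; case: ifP.
by rewrite -subr_ge0 energy_replace// subr_ge0.
Qed.

End discrete_geodesics.

(** * The Hopf-Rinow theorem *)

Section hopf_rinow.
Context {R : realType} {m n : nat} (d : nat) (M : set 'M[R]_(m, n))
  (E : 'M[R]_(m, n) -> 'M[R]_(m, n) -> 'M[R]_(m, n)).
Hypothesis eM : embedded_submanifold d M.
Hypothesis hE : exponential_map M E.
Variable x0 : 'M[R]_(m, n).
Hypothesis Mx0 : M x0.

(** [M] is closed within a uniform distance [e] of the compact set. A limit of points reached within
    [r + e / 3] is at distance at most [e / 3 + e / 3] from a point reached within [r]. *)
Lemma reach_extend (r : R) : 0 <= r -> adherent (reach M x0 r) `<=` M ->
  exists2 e : R, 0 < e & adherent (reach M x0 (r + e)) `<=` M.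
Proof.
move=> r0 KM; have cK : compact (adherent (reach M x0 r)) := reach_adherent_compact r0.
pose P (x y : 'M[R]_(m, n)) := adherent M y -> M y.
have [|e e0 eP] := @compact_uniform _ _ _ _ P cK.
  move=> z /KM Mz; have [r1 [C [phi [psi [S ch]]]]] := chart_exists eM Mz.
  exists r1; first exact: chart_r ch.
  by move=> x y _ yz; exact: (chart_closed ch).
have e30 : 0 < e / 3 by rewrite divr_gt0.
exists (e / 3) => // a aa.
have aM : adherent M a.
  move=> e' e'0; have [q rq aq] := aa e' e'0; exists q => //.
  by apply: reach_M rq; lra.
have [q rq aq] := aa _ e30.
have [||q' rq' qq'] := @reach_shorten _ _ _ M x0 (r + e / 3) q (e / 3) _ _ rq; try lra.
rewrite addrK in rq'.
apply: (eP q' a) aM.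
  by move=> e' e'0; exists q' => //; rewrite subrr frob0 ltW.
by apply: le_lt_trans (frob_dist_triangle q _ _) _; lra.
Qed.

(** In a chart the quotients of [phi (y j) - phi x0] by [t j] lie in [S] and come close to
    ['D_l phi x0]: the quadratic remainder divided by [t j] is small because
    [frob (y j - x0) <= t j]. *)
Lemma limit_tangent (y v : nat -> 'M[R]_(m, n)) (t : nat -> R) l :
  (forall j, [/\ M (y j), 0 < t j, frob (y j - x0) <= t j & y j - x0 = t j *: v j]) ->
  (forall (e : R) J, 0 < e -> exists2 j, (J <= j)%N & frob (v j - l) <= e) ->
  (forall e : R, 0 < e -> exists J, forall j, (J <= j)%N -> frob (y j - x0) <= e) ->
  tangent M x0 l.
Proof.
move=> yP vl y0; have [r [C [phi [psi [S ch]]]]] := chart_exists eM Mx0.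
have xr := chart_center ch; have C0 := chart_C0 ch; have r0 := chart_r ch.
apply/(chart_tangentP ch _ xr Mx0); apply: vspace_closed => e e0.
have [dphi bphi] := tame_bounded (chart_phi ch) xr.
have c2 : 0 < 2 * C by rewrite mulr_gt0.
have [e1 e10 /and3P[e11 e12 _]] := @pos_lower_bound R [:: e / (2 * C); r / 2]
  ltac:(by rewrite /= (divr_gt0 e0 c2) divr_gt0).
have [J yJ] := y0 e1 e10; have [j Jj vj] := vl e1 J e10.
have yj := yJ j Jj; have [My t0 yt yv] := yP j.
have yr : frob (y j - x0) < r by apply: le_lt_trans yj _; lra.
exists ((t j)^-1 *: (phi (y j) - phi x0)).
  apply: memvZ; apply: memvB; first exact/(chart_M ch yr).
  exact/(chart_M ch xr).
have q := tame_quad0 (a := y j - x0) (chart_phi ch) xr.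
rewrite subrKC in q; have {}q := q yr.
have -> : 'D_l phi x0 - (t j)^-1 *: (phi (y j) - phi x0) =
    'D_(l - v j) phi x0 - (t j)^-1 *: (phi (y j) - phi x0 - 'D_(y j - x0) phi x0).
  rewrite yv (derive_dirB _ _ dphi) (derive_dirZ _ _ dphi) [X in _ = _ - X]scalerBr.
  rewrite scalerA mulVf ?gt_eqF// scale1r.
  move: ('D_l phi x0) ('D_(v j) phi x0) (phi _) (phi _) => p1 p2 p3 p4.
  by apply/matrixP => a b; rewrite !mxE; ring.
apply: le_trans (frobB _ _) _.
have i1 : frob ('D_(l - v j) phi x0) <= C * e1.
  by apply: le_trans (bphi _) _; rewrite frob_distC ler_pM2l.
have i2 : frob ((t j)^-1 *: (phi (y j) - phi x0 - 'D_(y j - x0) phi x0)) <= C * e1.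
  rewrite frobZ gtr0_norm ?invr_gt0// ler_pdivrMl//.
  apply: le_trans q _; rewrite [leRHS]mulrCA ler_pM2l// expr2.
  by apply: ler_pM => //; exact: frob_ge0.
apply: le_trans (lerD i1 i2) _.
by rewrite ler_pdivlMr// in e11; lra.
Qed.

(** During the first unit of time every step is at least [t / 2] long, so about [1 / t] steps
    contribute at least a multiple of [t] to the energy, and the bound on [N] times the energy
    limits [N * t]. The summand [2] makes a chain violating the bound outlast that unit of time. *)
Lemma discrete_speed (c : R -> 'M[R]_(m, n)) (p : nat -> 'M[R]_(m, n)) N (t rs : R) :
  geodesic M c -> 0 < t -> t <= 1 / 2 -> 3 / 4 <= frob (derive1 c 0) ->
  (forall i, (i < N)%N -> i%:R * t <= 1 -> tracks c p t (1 / 4) i) ->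
  N%:R * energy N p <= rs ^+ 2 -> N%:R * t <= 8 * rs ^+ 2 + 2.
Proof.
move=> gc t0 t1 v0 tr En; rewrite leNgt; apply/negP => big.
have rs0 : 0 <= rs ^+ 2 by exact: sqr_ge0.
pose k := Num.truncn t^-1.
have /andP[k1 k2] : k%:R <= t^-1 < k.+1%:R by apply: truncn_itv; rewrite invr_ge0 ltW.
have kt : k%:R * t <= 1 by rewrite -ler_pdivlMr// div1r.
have kt2 : 1 / 2 <= k%:R * t.
  have : 1 < k.+1%:R * t by rewrite -ltr_pdivrMr// div1r.
  by rewrite -natr1 mulrDl mul1r; lra.
have kN : (k <= N)%N.
  rewrite -(@ler_nat R) -(ler_pM2r t0); lra.
have stp i : (i < k)%N -> t ^+ 2 / 4 <= frob (p i.+1 - p i) ^+ 2.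
  move=> ik.
  have it : i%:R * t <= 1.
    by apply: le_trans kt; rewrite ler_pM2r// ler_nat ltnW.
  have [_ h] := tr i (leq_trans ik kN) it.
  have hv : t / 2 <= frob (p i.+1 - p i).
    have := frob_le_distD (t *: derive1 c (i%:R * t)) (p i.+1 - p i).
    rewrite frobZ gtr0_norm// (geodesic_speed gc) (frob_distC (t *: _)) => h2.
    have h3 : t * (3 / 4) <= t * frob (derive1 c 0) by rewrite ler_pM2l.
    clear tr; move: h h2 h3; lra.
  rewrite (_ : t ^+ 2 / 4 = (t / 2) ^+ 2); last by field.
  by rewrite ler_pXn2r ?nnegrE ?frob_ge0// divr_ge0// ltW.
have Ek : k%:R * (t ^+ 2 / 4) <= energy N p.
  apply: (@le_trans _ _ (\sum_(i < k) frob (p i.+1 - p i) ^+ 2)).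
    rewrite -[k in k%:R]card_ord -sumr_const mulr_suml.
    by apply: ler_sum => i _; rewrite mul1r stp.
  rewrite /energy (big_ord_widen N (fun j => frob (p j.+1 - p j) ^+ 2) kN) big_mkcond/=.
  by apply: ler_sum => i _; case: ifP => // _; exact: sqr_ge0.
have N0 : 0 <= N%:R :> R by [].
have h1 : N%:R * (k%:R * (t ^+ 2 / 4)) <= rs ^+ 2.
  by apply: le_trans En; exact: ler_wpM2l.
have h2 : N%:R * t * (1 / 2) <= N%:R * t * (k%:R * t).
  by apply: ler_wpM2l => //; rewrite mulr_ge0// ltW.
have h3 : N%:R * (k%:R * (t ^+ 2 / 4)) = N%:R * t * (k%:R * t) / 4 by field.
clear tr stp; move: h1 h2 h3 big rs0; lra.
Qed.

(** The point [a] is approached by end points of ever finer discrete geodesics from [x0]. A cluster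
    value of their initial velocities determines one genuine geodesic, which suitable chains track
    for a time at most [T]; so [a] is adherent to a compact arc of that geodesic and lies on it. *)
Lemma reach_limit (rs : R) : 0 < rs ->
  (forall r, 0 <= r -> r < rs -> adherent (reach M x0 r) `<=` M) ->
  adherent (reach M x0 rs) `<=` M.
Proof.
move=> rs0 Hr a aa.
have chain j : exists Np : nat * (nat -> 'M[R]_(m, n)),
    [/\ (0 < Np.1)%N, Np.2 0%N = x0, frob (a - Np.2 Np.1) <= j.+1%:R^-1 &
        Np.1%:R^-1 <= j.+1%:R^-1 :> R] /\
    [/\ discrete_geodesic M Np.2 Np.1,
        forall i, (i < Np.1)%N -> frob (Np.2 i.+1 - Np.2 i) <= j.+1%:R^-1 &
        Np.1%:R * energy Np.1 Np.2 <= rs ^+ 2].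
  have e0 : 0 < j.+1%:R^-1 :> R by rewrite invr_gt0 ltr0n.
  have e20 : 0 < j.+1%:R^-1 / 2 :> R by rewrite divr_gt0.
  have [q rq aq] := aa _ e20.
  (* Shortening the path by [e1] creates the gap between [rs - e1] and [rs - e1 / 2] in which the
     chain can vary, still below [rs] where closedness is assumed. *)
  have [e1 e10 /and3P[e11 e12 _]] := @pos_lower_bound R [:: j.+1%:R^-1 / 2; rs / 2]
    ltac:(by rewrite /= e20 divr_gt0).
  have [|q' rq' qq'] := reach_shorten (ltW rs0) _ rq (e := e1).
    by rewrite ltW//=; lra.
  have r0 : 0 <= rs - e1 by lra.
  have rr : rs - e1 < rs - e1 / 2 by lra.
  have r1 : 0 <= rs - e1 / 2 by lra.
  have r2 : rs - e1 / 2 < rs by lra.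
  have [N [p [[N0 p0 pN Nd] [dg st En]]]] :=
    discrete_geodesic_exists eM r0 rr e0 (Hr _ r1 r2) rq'.
  exists (N, p); split=> /=; split=> //.
    rewrite pN; apply: le_trans (frob_dist_triangle q _ _) _.
    by apply: le_trans (lerD aq (le_trans qq' e11)) _; rewrite -splitr.
  apply: le_trans En _; rewrite ler_pXn2r ?nnegrE ?(ltW rs0)//.
  by rewrite gerBl ltW.
have /choice[Np NpP] := chain.
pose N j := (Np j).1; pose p j := (Np j).2.
(* The first increment sets the time step, so that velocities have size at most one; the lower cap
   [1 / N j] prevents a division by zero when that increment vanishes. *)
pose t j : R := Num.max (frob (p j 1%N - x0)) (N j)%:R^-1.
pose v j := (t j)^-1 *: (p j 1%N - x0).
have N0 j : (0 < N j)%N by case: (NpP j) => -[].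
have t0 j : 0 < t j by rewrite lt_max invr_gt0 ltr0n N0 orbT.
have tv j : p j 1%N - x0 = t j *: v j.
  by rewrite /v scalerA mulfV ?gt_eqF// scale1r.
have p0 j : p j 0%N = x0 by case: (NpP j) => -[].
have st j i : (i < N j)%N -> frob (p j i.+1 - p j i) <= j.+1%:R^-1.
  by case: (NpP j) => _ [_ h _]; exact: h.
have s1 j : frob (p j 1%N - x0) <= j.+1%:R^-1 by rewrite -(p0 j); exact: st.
have tj j : t j <= j.+1%:R^-1.
  by rewrite ge_max s1/=; case: (NpP j) => -[].
have vB j : frob (v j) <= 1.
  rewrite /v frobZ gtr0_norm ?invr_gt0// ler_pdivrMl// mulr1.
  by rewrite le_max lexx.
have [l lB vl] := bounded_seq_cluster vB.
have small (e : R) : 0 < e -> exists J, forall j, (J <= j)%N -> j.+1%:R^-1 <= e.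
  move=> e0; exists (Num.truncn e^-1) => j Jj.
  have /andP[_ h] : (Num.truncn e^-1)%:R <= e^-1 < (Num.truncn e^-1).+1%:R.
    by apply: truncn_itv; rewrite invr_ge0 ltW.
  rewrite -[e]invrK lef_pV2 ?posrE ?invr_gt0 ?ltr0n//.
  by apply: le_trans (ltW h) _; rewrite ler_nat ltnS.
have tl : tangent M x0 l.
  apply: (@limit_tangent (fun j => p j 1%N) v t) => //.
    move=> j; split=> //; last by rewrite le_max lexx.
    by case: (NpP j) => _ [[h _] _ _]; apply: h; exact: N0.
  move=> e e0; have [J JP] := small e e0; exists J => j Jj.
  exact: le_trans (s1 j) (JP j Jj).
have [c [gc c0 cl _]] := hE Mx0 tl.
pose T := 8 * rs ^+ 2 + 2.
have T1 : 1 <= T by rewrite /T; have := sqr_ge0 rs; lra.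
have adh : adherent (c @` `[0, T]) a.
  move=> e e0.
  have e40 : 0 < e / 4 by rewrite divr_gt0.
  have [e' e'0 /and3P[e'1 e'2 _]] := @pos_lower_bound R [:: e / 4; 1 / 4]
    ltac:(by rewrite /= e40 divr_gt0).
  have [dl dl0 GS] := global_stability eM gc T e'0.
  have [dd dd0 /and4P[dd1 dd2 dd3 _]] := @pos_lower_bound R [:: dl; e / 4; 1 / 4]
    ltac:(by rewrite /= dl0 e40 divr_gt0).
  have [J JP] := small dd dd0.
  have [j Jj vj] := vl dd J dd0.
  have [[_ _ aj _] [dg _ En]] := NpP j.
  have jd := JP j Jj.
  have tr0 : tracks c (p j) (t j) dl 0.
    split; first by rewrite mul0r c0 p0 subrr frob0 ltW.
    rewrite mul0r cl p0 tv -scalerBr frobZ gtr0_norm// mulrC ler_pM2r//.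
    exact: le_trans vj dd1.
  have tjd : t j <= dd by exact: le_trans (tj j) jd.
  have G i : (i < N j)%N -> i%:R * t j <= T -> tracks c (p j) (t j) e' i.
    apply: (GS (p j) (N j) (t j)) => //; last exact: le_trans dd1.
    by move=> k kN; apply: le_trans (st j k kN) _; exact: le_trans jd dd1.
  (* The two cases of the maximum in [t j]: total time [1], or a first velocity of unit size, for
     which [discrete_speed] applies. *)
  have NT : (N j)%:R * t j <= T.
    have [h|h] := leP (frob (p j 1%N - x0)) (N j)%:R^-1.
      have -> : t j = (N j)%:R^-1 by rewrite /t; apply/max_idPr.
      by rewrite mulfV// pnatr_eq0 -lt0n N0.
    have tE : t j = frob (p j 1%N - x0) by rewrite /t; apply/max_idPl/ltW.
    have v1 : frob (v j) = 1.
      by rewrite /v frobZ gtr0_norm ?invr_gt0// -tE mulVf ?gt_eqF.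
    apply: (@discrete_speed c (p j) (N j) (t j) rs) => //.
    - by apply: le_trans tjd _; apply: le_trans dd3 _; lra.
    - have := frob_le_distD (v j) l; rewrite cl v1.
      by move: (le_trans vj dd3); clear; move: (frob _) (frob _) => x y; lra.
    move=> i iN it; have [g1 g2] := G i iN (le_trans it T1); split.
      exact: le_trans e'2.
    by apply: le_trans g2 _; rewrite ler_pM2r.
  (* Tracking is asserted for indices below [N j], so the geodesic is compared with the last point
     but one; the end point is one short step further. *)
  have [k kE] : exists k, N j = k.+1 by exists (N j).-1; rewrite prednK.
  have kN : (k < N j)%N by rewrite kE.
  have kT : k%:R * t j <= T.
    by apply: le_trans NT; rewrite ler_pM2r// ler_nat ltnW.
  have [g1 _] := G k kN kT.
  exists (c (k%:R * t j)).
    by exists (k%:R * t j) => //=; rewrite in_itv/= kT mulr_ge0// ltW.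
  have sk := st j k kN; rewrite -kE in sk.
  apply: le_trans (frob_dist_triangle (p j (N j)) _ _) _.
  have h1 : frob (a - p j (N j)) <= e / 4 by apply: le_trans aj _; exact: le_trans jd dd2.
  have h2 : frob (p j (N j) - c (k%:R * t j)) <= e / 4 + e / 4.
    apply: le_trans (frob_dist_triangle (p j k) _ _) _; apply: lerD.
      by apply: le_trans sk _; exact: le_trans jd dd2.
    exact: le_trans g1 e'1.
  by apply: le_trans (lerD h1 h2) _; lra.
have cc : compact (c @` `[0, T]).
  apply: continuous_compact; last exact: segment_compact.
  apply: continuous_subspaceT => s.
  exact: smooth_on_continuous (geodesic_smooth gc) _.
have clo : closed (c @` `[0, T]) by apply: compact_closed => //; exact: norm_hausdorff.
have [s _ <-] := (frob_closedP _).1 clo a adh.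
exact: geodesic_M gc s.
Qed.

(** If the good radii were bounded, their supremum would be good by [reach_limit] and could be
    enlarged by [reach_extend]. *)
Lemma hopf_rinow (r : R) : 0 <= r -> adherent (reach M x0 r) `<=` M.
Proof.
move=> r0; apply: contrapT => nr.
pose H s := adherent (reach M x0 s) `<=` M.
have Hle s s' : 0 <= s -> s <= s' -> H s' -> H s.
  move=> s0 ss' Hs' x ax; apply: Hs' => e e0; have [y ry xy] := ax e e0.
  by exists y => //; exact: reach_le ry.
pose A := [set s | 0 <= s /\ H s].
have A0 : A 0.
  split=> // x ax; suff -> : x = x0 by [].
  apply/eqP; rewrite -subr_eq0; apply/eqP; apply: frob_eq0; apply/eqP.
  rewrite eq_le frob_ge0 andbT; apply/ler_addgt0Pr => e e0; rewrite add0r.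
  have [y ry xy] := ax e e0; have := reach_dist (lexx 0) ry => yx.
  by apply: le_trans (frob_dist_triangle y _ _) _; lra.
have ubA : ubound A r.
  move=> s [s0 Hs]; rewrite leNgt; apply/negP => rs; apply: nr.
  exact: Hle (ltW rs) Hs.
have supA : has_sup A by split; [exists 0|exists r].
have s0 : 0 <= sup A by apply: ub_le_sup => //; exists r.
have Hs : H (sup A).
  have [sE|sN] := eqVneq (sup A) 0; first by rewrite sE; case: A0.
  have sp : 0 < sup A by rewrite lt_def sN.
  apply: reach_limit => // s s00 ss.
  have sp' : 0 < sup A - s by rewrite subr_gt0.
  have [s' [s'0 Hs'] ss'] := sup_adherent sp' supA.
  by apply: (Hle s s') => //; move: ss'; lra.
have [e e0 He] := reach_extend s0 Hs.
have : sup A + e <= sup A by apply: ub_le_sup; [exists r|split=> //; lra].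
lra.
Qed.

End hopf_rinow.

(** * Linear algebra of the natural gradient direction *)

Section mxdot_products.
Context {R : realType}.

Lemma mxdot_tr m n (A B : 'M[R]_(m, n)) : mxdot A^T B^T = mxdot A B.
Proof.
rewrite /mxdot exchange_big; apply: eq_bigr => i _.
by apply: eq_bigr => j _; rewrite !mxE.
Qed.

Lemma mxdot_vec m n (A B : 'M[R]_(m, n)) : mxdot (vec A) (vec B) = mxdot A B.
Proof. by rewrite /vec mxdot_tr mxdot_mxvec mxdot_tr. Qed.

Lemma frob_vec m n (A : 'M[R]_(m, n)) : frob (vec A) = frob A.
Proof. by rewrite /frob mxdot_vec. Qed.

Lemma unvecK m n (w : 'cV[R]_(n * m)) : vec (unvec w : 'M[R]_(m, n)) = w.
Proof. by rewrite /vec /unvec trmxK vec_mxK trmxK. Qed.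

Lemma vecK m n (A : 'M[R]_(m, n)) : unvec (vec A) = A.
Proof. by rewrite /vec /unvec trmxK mxvecK trmxK. Qed.

Lemma vecZ m n (k : R) (A : 'M[R]_(m, n)) : vec (k *: A) = k *: vec A.
Proof. by rewrite /vec !linearZ. Qed.

Lemma vecN m n (A : 'M[R]_(m, n)) : vec (- A) = - vec A.
Proof. by rewrite /vec !linearN. Qed.

Lemma vecB m n (A B : 'M[R]_(m, n)) : vec (A - B) = vec A - vec B.
Proof. by rewrite /vec !linearB. Qed.

Lemma mxdot_mulmx m n p (A : 'M[R]_(m, n)) (B : 'M[R]_(n, p)) (C : 'M[R]_(m, p)) :
  mxdot (A *m B) C = mxdot B (A^T *m C).
Proof.
have tr k l (X Y : 'M[R]_(k, l)) : mxdot X Y = \tr (X^T *m Y).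
  rewrite /mxdot exchange_big /mxtrace; apply: eq_bigr => j _; rewrite mxE.
  by apply: eq_bigr => i _; rewrite mxE.
by rewrite !tr trmx_mul mulmxA.
Qed.

Lemma col_mxdotE n (u v : 'cV[R]_n) : (u^T *m v) 0 0 = mxdot u v.
Proof. by rewrite mxE /mxdot; apply: eq_bigr => i _; rewrite big_ord1 mxE. Qed.

Lemma loewner_lower n (A : 'M[R]_n) (k : R) (v : 'cV[R]_n) : loewner_le k%:M A ->
  k * frob v ^+ 2 <= mxdot v (A *m v).
Proof.
move=> /(_ v); rewrite -mulmxA col_mxdotE mulmxBl mxdotBr mul_scalar_mx mxdotZr.
by rewrite -sqr_frob subr_ge0.
Qed.

Lemma loewner_upper n (A : 'M[R]_n) (k : R) (v : 'cV[R]_n) : loewner_le A k%:M ->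
  mxdot v (A *m v) <= k * frob v ^+ 2.
Proof.
move=> /(_ v); rewrite -mulmxA col_mxdotE mulmxBl mxdotBr mul_scalar_mx mxdotZr.
by rewrite -sqr_frob subr_ge0.
Qed.

Lemma coercive_unitmx n (A : 'M[R]_n) (k : R) : 0 < k ->
  (forall v : 'cV[R]_n, k * frob v ^+ 2 <= mxdot v (A *m v)) -> A \in unitmx.
Proof.
move=> k0 Ak; rewrite -unitmx_tr -row_free_unit; apply/row_freeP.
have : kermx A^T = 0.
  apply/row_matrixP => i; rewrite row0; apply/eqP.
  set u := row i _; have uA : u *m A^T = 0 by rewrite -row_mul mulmx_ker row0.
  have Au : A *m u^T = 0 by rewrite -[A]trmxK -trmx_mul uA trmx0.
  have := Ak u^T; rewrite Au mxdot0r pmulr_rle0// => h.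
  have : frob u^T ^+ 2 == 0 by rewrite eq_le h sqr_ge0.
  rewrite sqrf_eq0 => /eqP/frob_eq0 uT.
  by rewrite -[u]trmxK uT trmx0.
by move/eqP; rewrite kermx_eq0 => /row_freeP.
Qed.

(* The minimum of the Rayleigh quotient is an eigenvalue. *)
Lemma lambda_min_le n k (J : 'M[R]_(n, k)) (z : 'cV[R]_n) :
  lambda_min (J *m J^T) * frob z ^+ 2 <= frob (J^T *m z) ^+ 2.
Proof.
set A := J *m J^T.
have AE (v : 'cV[R]_n) : mxdot v (A *m v) = frob (J^T *m v) ^+ 2.
  by rewrite sqr_frob mxdot_mulmx trmxK mulmxA.
have AT : A^T = A by rewrite /A trmx_mul trmxK.
have [z0|z0] := eqVneq (frob z) 0.
  by rewrite z0 expr0n mulr0 sqr_ge0.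
have {}z0 : 0 < frob z by rewrite lt_def z0 frob_ge0.
pose K := [set v : 'cV[R]_n | frob v = 1].
have cfrob2 (B : 'M[R]_n) : continuous (fun v : 'cV[R]_n => mxdot v (B *m v)).
  move=> v; apply: (@continuous_at_sum R _ _ (index_enum 'I_n)
    (fun i (v : 'cV[R]_n) => \sum_(j < 1) v i j * (B *m v) i j)) => i.
  apply: (@continuous_at_sum R _ _ (index_enum 'I_1)
    (fun j (v : 'cV[R]_n) => v i j * (B *m v) i j)) => j.
  have c1 : {for v, continuous (fun v : 'cV[R]_n => (B *m v) i j)}.
    have -> : (fun v : 'cV[R]_n => (B *m v) i j) = (fun v => \sum_l B i l * v l j).
      by apply/funext => w; rewrite mxE.
    apply: (@continuous_at_sum R _ _ (index_enum 'I_n)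
      (fun l (v : 'cV[R]_n) => B i l * v l j)) => l.
    apply: (@continuousM _ _ (fun=> B i l) (fun v : 'cV[R]_n => v l j)).
      exact: cst_continuous.
    exact: coord_continuous.
  exact: (continuousM (@coord_continuous R n 1 i j v) c1).
have cK : compact K.
  apply: (@frob_closed_compact _ _ _ _ 1) => [v ->//|v av].
  apply/eqP; rewrite eq_le; apply/andP; split; apply/ler_addgt0Pr => e e0;
    have [y Ky vy] := av e e0.
    by apply: le_trans (frob_le_distD _ y) _; rewrite Ky lerD2l.
  rewrite -{1}Ky; apply: le_trans (frob_le_distD _ v) _.
  by rewrite lerD2l frob_distC.
have K0 : K !=set0.
  exists ((frob z)^-1 *: z); rewrite /K/= frobZ gtr0_norm ?invr_gt0//.
  by rewrite mulVf// gt_eqF.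
have [v vK vmin] := compact_EVT_min K0 cK (continuous_subspaceT (cfrob2 A)).
have {}vK : frob v = 1 by exact: set_mem vK.
pose l := mxdot v (A *m v).
have lmin (w : 'cV[R]_n) : l * frob w ^+ 2 <= mxdot w (A *m w).
  have [w0|w0] := eqVneq (frob w) 0.
    by rewrite w0 expr0n mulr0 AE sqr_ge0.
  have {}w0 : 0 < frob w by rewrite lt_def w0 frob_ge0.
  have Kw : (frob w)^-1 *: w \in K.
    apply/mem_set; rewrite /K/= frobZ gtr0_norm ?invr_gt0//.
    by rewrite mulVf// gt_eqF.
  have := vmin _ Kw; rewrite -scalemxAr mxdotZl mxdotZr mulrA -expr2 exprVn.
  by rewrite ler_pdivlMl ?exprn_gt0// mulrC.
have [B BE] : exists B, B = A *m v - l *: v by exists (A *m v - l *: v).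
have B0 : B = 0.
  (* Since [v] minimises the quotient, this polynomial in [t], which vanishes at [0], is
     nonnegative; its linear coefficient is twice the squared norm of the defect [B], which must
     therefore be zero. *)
  have key (t : R) : 0 <= 2 * t * frob B ^+ 2 + t ^+ 2 * (mxdot B (A *m B) - l * frob B ^+ 2).
    have := lmin (v + t *: B); rewrite sqr_frob mulmxDr -scalemxAr.
    rewrite !(mxdotDl, mxdotDr, mxdotZl, mxdotZr) -/l -!sqr_frob vK.
    have h1 : mxdot v (A *m B) = mxdot B (A *m v) by rewrite -{1}AT -mxdot_mulmx mxdotC.
    have h2 : mxdot B (A *m v) = frob B ^+ 2 + l * mxdot B v.
      by rewrite sqr_frob {3}BE mxdotBr mxdotZr subrK.
    rewrite h1 h2 (mxdotC v B).
    move: (mxdot B v) (mxdot B (A *m B)) (frob B) => x y b; lra.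
  set b := frob B ^+ 2 in key; set k0 := mxdot B (A *m B) - l * b in key.
  have k00 : 0 <= k0 by rewrite subr_ge0 lmin.
  have b0 : 0 <= b by exact: sqr_ge0.
  have kp : 0 < k0 + 1 by rewrite ltr_wpDl.
  have := key (- b / (k0 + 1)).
  have -> : 2 * (- b / (k0 + 1)) * b + (- b / (k0 + 1)) ^+ 2 * k0 =
      - (b ^+ 2 * ((k0 + 2) / (k0 + 1) ^+ 2)) by field; rewrite gt_eqF.
  rewrite oppr_ge0 pmulr_lle0; last by rewrite divr_gt0 ?exprn_gt0// ltr_wpDl.
  move=> h; apply: frob_eq0; apply/eqP; rewrite -sqrf_eq0 -/b -sqrf_eq0.
  by rewrite eq_le h sqr_ge0.
have vn0 : v^T != 0.
  apply: contra_eq_neq vK => /(congr1 trmx); rewrite trmxK trmx0 => ->.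
  by rewrite frob0 eq_sym oner_neq0.
have Av : A *m v = l *: v by apply/eqP; rewrite -subr_eq0 -BE B0.
have el : eigenvalue A l.
  apply/eigenvalueP; exists v^T => //.
  by rewrite -{1}AT -trmx_mul Av linearZ.
have le_l : lambda_min A <= l.
  (* The infimum is meaningful because a Gram matrix has no negative eigenvalue. *)
  apply: ge_inf => //; exists 0 => a /= /eigenvalueP[u uA u0].
  have Au : A *m u^T = a *: u^T by rewrite -{1}AT -trmx_mul uA linearZ.
  have := AE u^T; rewrite Au mxdotZr -sqr_frob => h.
  have u0' : 0 < frob u^T ^+ 2.
    rewrite lt_def sqr_ge0 sqrf_eq0 andbT; apply: contra_neq u0 => /frob_eq0 uT.
    by rewrite -[u]trmxK uT trmx0.
  by rewrite -(pmulr_lge0 _ u0') h sqr_ge0.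
by rewrite -AE; apply: le_trans (lmin z); rewrite ler_wpM2r// sqr_ge0.
Qed.

(** With [z] the image of [g] under the inverse of [H] and then of [J *m J^T], the vector [J^T *m z]
    is sent by [J] to [invmx H *m g], which coercivity of [H] compares with [e]. For the length,
    [|J^T z|^2 = <z, J J^T z>], and [|z|] is bounded by [|J^T z|] because the perturbation [s / 6]
    leaves the lower bound [5 / 6 * s]. *)
Lemma pinv_direction n k (J J0 : 'M[R]_(n, k)) (H : 'M[R]_n) (mu s a : R) (g e : 'cV[R]_n) :
  0 < mu -> 0 < s ->
  (forall v : 'cV[R]_n, mu * frob v ^+ 2 <= mxdot v (H *m v)) ->
  (forall v : 'cV[R]_n, s * frob v <= frob (J0^T *m v)) ->
  frob (J - J0) <= s / 6 -> frob (g - H *m e) <= a ->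
  exists z : 'cV[R]_n,
    [/\ Defs.pinv (J^T *m H *m J) *m J^T *m g = J^T *m z,
        frob (J *m (J^T *m z) - e) <= a / mu &
        frob (J^T *m z) <= 6 / 5 / s * frob (J *m (J^T *m z))].
Proof.
move=> mu0 s0 Hmu J0s JJ0 gH.
have uH : H \in unitmx by exact: coercive_unitmx Hmu.
have Js (v : 'cV[R]_n) : 5 / 6 * s * frob v <= frob (J^T *m v).
  have := J0s v; have := frob_le_distD (J0^T *m v) (J^T *m v).
  have h : frob (J0^T *m v - J^T *m v) <= s / 6 * frob v.
    rewrite -mulmxBl -linearB; apply: le_trans (frob_mulmx _ _) _.
    by rewrite frob_tr frob_distC ler_wpM2r// frob_ge0.
  by move: h; move: (frob _) (frob _) (frob _) (frob _) => *; lra.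
have s56 : 0 < 5 / 6 * s by lra.
have uJ : J *m J^T \in unitmx.
  apply: (@coercive_unitmx _ _ ((5 / 6 * s) ^+ 2)); first by rewrite exprn_gt0.
  move=> v; rewrite -mulmxA mxdotC mxdot_mulmx -sqr_frob -exprMn.
  by rewrite ler_pXn2r ?nnegrE ?frob_ge0// mulr_ge0 ?frob_ge0// ltW.
pose rr := invmx H *m g; pose z := invmx (J *m J^T) *m rr.
have Jz : J *m (J^T *m z) = rr by rewrite mulmxA /z mulmxA mulmxV// mul1mx.
exists z; split.
- rewrite pinv_gram// /z /rr; set G := J *m J^T in uJ *.
  rewrite -!mulmxA; congr (_ *m _); congr (_ *m _); congr (_ *m _).
  by rewrite (mulmxA J) -/G (mulmxA (invmx G)) mulVmx// mul1mx.
- rewrite Jz; have hr : H *m (rr - e) = g - H *m e.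
    by rewrite mulmxBr /rr mulmxA mulmxV// mul1mx.
  have := Hmu (rr - e); rewrite hr => h.
  have h2 := le_trans h (mxdot_le _ _).
  rewrite ler_pdivlMr// mulrC; apply: le_trans gH.
  have [r0|r0] := eqVneq (frob (rr - e)) 0; first by rewrite r0 mulr0 frob_ge0.
  have {}r0 : 0 < frob (rr - e) by rewrite lt_def r0 frob_ge0.
  by rewrite -(ler_pM2l r0) mulrCA -expr2.
rewrite Jz; set D := J^T *m z.
have [D0|D0] := eqVneq (frob D) 0.
  by rewrite D0 mulr_ge0 ?frob_ge0// !mulr_ge0// invr_ge0 ltW.
have {}D0 : 0 < frob D by rewrite lt_def D0 frob_ge0.
have h1 : frob D ^+ 2 <= frob z * frob rr.
  by rewrite sqr_frob {1}/D mxdot_mulmx trmxK Jz; exact: mxdot_le.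
have h2 : frob z <= 6 / 5 / s * frob D.
  have := Js z; rewrite -/D => h.
  rewrite -(ler_pM2l s56) (_ : 5 / 6 * s * (6 / 5 / s * frob D) = frob D)//.
  by field; rewrite gt_eqF.
rewrite -(ler_pM2l D0) -expr2; apply: le_trans h1 _.
rewrite (_ : frob D * (6 / 5 / s * frob rr) = 6 / 5 / s * frob D * frob rr); last by ring.
by rewrite ler_wpM2r// frob_ge0.
Qed.

End mxdot_products.

(** * Stacked vectors and the expansion of the loss gradient *)

Section stacking.
Context {R : realType}.

Lemma sum_stack N q (F : 'I_N -> 'I_q -> R) :
  \sum_(k < \sum_(i < N) q) F (tagnat.sig1 k) (tagnat.sig2 k) =
  \sum_(i < N) \sum_(a < q) F i a.
Proof.
have -> := @sig_big_dep R 0 +%R 'I_N (fun=> 'I_q) xpredT (fun i => xpredT) F.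
by rewrite (reindex _ (@tagnat.sig_bij_on N (fun=> q))).
Qed.

Lemma mxdot_mxcol N q (B D : 'I_N -> 'cV[R]_q) :
  mxdot (\mxcol_(i < N) B i) (\mxcol_(i < N) D i) = \sum_(i < N) mxdot (B i) (D i).
Proof.
rewrite /mxdot -(sum_stack (fun i a => \sum_(j < 1) B i a j * D i a j)).
by apply: eq_bigr => k _; apply: eq_bigr => j _; rewrite !mxE.
Qed.

Lemma sum_sqr_le_sqr_sum (I : Type) (s : seq I) (a : I -> R) : (forall i, 0 <= a i) ->
  \sum_(i <- s) a i ^+ 2 <= (\sum_(i <- s) a i) ^+ 2.
Proof.
move=> a0; elim: s => [|i s IH]; first by rewrite !big_nil expr0n.
rewrite !big_cons sqrrD; have S0 : 0 <= \sum_(i <- s) a i by apply: sumr_ge0.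
apply: le_trans (lerD (lexx _) IH) _; rewrite -addrA lerD2l lerDr.
by rewrite mulrn_wge0// mulr_ge0.
Qed.

Lemma frob_row_sum_le k l (A : 'M[R]_(k, l)) : frob A <= \sum_(i < k) frob (row i A).
Proof.
rewrite -(@ler_pXn2r _ 2%N)// ?nnegrE ?frob_ge0 ?sumr_ge0// => [|i _]; last exact: frob_ge0.
apply: le_trans (sum_sqr_le_sqr_sum _ (fun i => frob_ge0 (row i A))).
rewrite sqr_frob /mxdot; apply: ler_sum => i _; rewrite sqr_frob /mxdot big_ord1.
by apply: ler_sum => j _; rewrite !mxE.
Qed.

(** The entry [(a, b)] of [hessian] differentiates first in [b], then in [a], so the derivative of
    the gradient is the transpose; symmetry enters separately in [gradient_taylor]. *)
Lemma is_derive_gradient q (L : 'cV[R]_q -> R) (y e : 'cV[R]_q) (s : R) :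
  smooth_on setT L ->
  is_derive s (1 : R) (fun s => gradient L (y + s *: e))
    ((hessian L (y + s *: e))^T *m e).
Proof.
move=> sL; apply/is_derive_mxP => b j; rewrite ord1.
have sb : smooth_on setT ('D_(delta_mx b 0) L) by exact: smooth_on_derive.
have db z : differentiable ('D_(delta_mx b 0) L) z by exact: smooth_on_differentiable sb _.
have -> : (fun s : R => gradient L (y + s *: e) b 0) =
    (fun s : R => 'D_(delta_mx b 0) L (y + s *: e)).
  by apply/funext => u; rewrite mxE.
have := is_derive_along_line (db (y + s *: e)).
move=> /is_derive_eq; apply.
move: (y + s *: e) => w; rewrite [in LHS](matrix_sum_delta e) deriveE// linear_sum mxE.
apply: eq_bigr => a _; rewrite big_ord1 linearZ/= -deriveE// !mxE.
by rewrite [RHS]mulrC.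
Qed.

(** The Hessian is taken at [z], because the direction inverts it at the current output and not at
    the label. The plain mean value bound gives [k] instead of [k / 2], enough for the threshold
    [mu / (3 * kH)]. *)
Lemma gradient_taylor q (L : 'cV[R]_q -> R) (y z : 'cV[R]_q) (k : R) :
  smooth_on setT L -> (hessian L z)^T = hessian L z ->
  (forall w, frob (hessian L w - hessian L z) <= k * frob (w - z)) ->
  frob (gradient L z - gradient L y - hessian L z *m (z - y)) <= k * frob (z - y) ^+ 2.
Proof.
move=> sL sym lip; set H := hessian L z in sym lip *; pose e := z - y.
pose g (s : R) := gradient L (y + s *: e) - (0 + s *: (H *m e)).
have gD s : is_derive s (1 : R) g ((hessian L (y + s *: e))^T *m e - H *m e).
  exact: (is_deriveB (is_derive_gradient y e s sL) (is_derive_line 0 (H *m e) s)).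
have -> : gradient L z - gradient L y - H *m (z - y) = g 1 - g 0.
  rewrite /g !scale1r !scale0r !addr0 add0r subr0 /e subrKC.
  by rewrite addrAC.
rewrite -[leRHS]mulr1 -[X in _ * X]subr0.
apply: (frob_mean_value ler01 (fun s _ => gD s)) => s /andP[s0 s1].
rewrite -[X in _ - X *m e]sym -mulmxBl -linearB; apply: le_trans (frob_mulmx _ _) _.
rewrite frob_tr expr2 mulrA; apply: ler_wpM2r; first exact: frob_ge0.
have k0 : 0 <= k * frob (y + s *: e - z) by exact: le_trans (frob_ge0 _) (lip _).
apply: le_trans (lip _) _.
have -> : y + s *: e - z = - ((1 - s) *: e).
  by rewrite /e; apply/matrixP => i j; rewrite !mxE; ring.
rewrite frobN frobZ ger0_norm ?subr_ge0//.
have [e0|e0] := eqVneq (frob e) 0; first by rewrite /e in e0 *; rewrite e0 !mulr0.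
have e1 : 0 < frob e by rewrite lt_def e0 frob_ge0.
(* The sign of [k] follows from the Lipschitz bound at a point different from [z]. *)
have kk : 0 <= k.
  have := le_trans (frob_ge0 _) (lip (z + e)); rewrite addrAC subrr add0r.
  by rewrite pmulr_lge0.
apply: ler_wpM2l => //; rewrite ler_piMl ?frob_ge0//.
by rewrite gerBl.
Qed.

End stacking.

(** * Functions and lengths along geodesics *)

Section geodesic_paths.
Context {R : realType} {m n : nat} (M : set 'M[R]_(m, n)) (c : R -> 'M[R]_(m, n)).
Hypothesis gc : geodesic M c.

Lemma geodesic_curve_at s : curve_at M (c s) (fun t : R => c (s + t *: (1 : R^o))).
Proof.
exists setT; split=> //; first exact: openT.
- exact: (smooth_on_line s (1 : R^o) openT (geodesic_smooth gc)).
- by move=> t _; exact: (geodesic_M gc).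
- by rewrite scale0r addr0.
Qed.

(** A Riemannian gradient is tested by curves at time [0], so the geodesic is shifted to start at
    [s] and shifted back by the chain rule. *)
Lemma geodesic_derive_function (g : 'M[R]_(m, n) -> R) (G : 'M[R]_(m, n)) s :
  is_rgrad M g (c s) G -> is_derive s (1 : R) (g \o c) (mxdot G (derive1 c s)).
Proof.
move=> [_ /(_ _ (geodesic_curve_at s)) gD].
have cE : derive1 (fun t : R => c (s + t *: (1 : R^o))) 0 = derive1 c s.
  have dc : differentiable c (s + (0 : R) *: (1 : R^o)).
    exact: (smooth_on_differentiable (geodesic_smooth gc)).
  rewrite derive1E; have [_ ->] := is_derive_along_line dc.
  by rewrite scale0r addr0 derive1E.
rewrite cE in gD; have [kd kE] := gD.
have l0 : - s + s *: (1 : R^o) = 0 by rewrite /GRing.scale/= mulr1 addNr.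
have dk : differentiable (g \o (fun t : R => c (s + t *: (1 : R^o)))) (- s + s *: (1 : R^o)).
  by rewrite l0; exact/derivable1_diffP.
have := is_derive_chain (is_derive_line (- s : R^o) (1 : R^o) s) dk.
rewrite l0 kE.
suff -> : (g \o (fun t : R => c (s + t *: (1 : R^o)))) \o
    (fun s0 : R => - s + s0 *: (1 : R^o)) = g \o c by [].
by apply/funext => u /=; rewrite /GRing.scale/= !mulr1 addrA subrr add0r.
Qed.

(** The path is the geodesic rescaled to unit speed; a geodesic of zero speed is constant and
    treated apart. *)
Lemma geodesic_reach s : 0 <= s -> reach M (c 0) (frob (derive1 c 0) * s) (c s).
Proof.
move=> s0; set v := frob (derive1 c 0).
have [v0|v0] := eqVneq v 0.
  have -> : c s = c 0.
    apply/eqP; rewrite -subr_eq0; apply/eqP; apply: frob_eq0; apply/eqP.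
    rewrite eq_le frob_ge0 andbT; apply: le_trans (geodesic_lipschitz gc _ _) _.
    by rewrite -/v v0 mul0r.
  by apply: reach_refl; exact: geodesic_M gc _.
have vp : 0 < v by rewrite lt_def v0 frob_ge0.
exists (fun u => c (u / v)); split.
- by rewrite mul0r.
- by rewrite mulrAC divff// mul1r.
- by move=> u _; exact: geodesic_M gc _.
move=> u u' _ _; apply: le_trans (geodesic_lipschitz gc _ _) _.
rewrite -/v -mulrBl normrM (gtr0_norm (_ : 0 < v^-1)) ?invr_gt0//.
by rewrite mulrCA divff// mulr1.
Qed.

Lemma geodesic_derive_lipschitz (k : R) s : 0 <= s <= 1 ->
  (forall u, 0 <= u <= 1 -> frob (derive1n 2 c u) <= k) ->
  frob (derive1 c s - derive1 c 0) <= k.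
Proof.
move=> /andP[s0 s1] ck; have k0 : 0 <= k.
  by apply: le_trans (frob_ge0 _) (ck 0 _); rewrite lexx ler01.
have D1 u : is_derive u (1 : R) (derive1 c) (derive1n 2 c u).
  exact: (is_derive_derive1n (geodesic_smooth gc) 1).
apply: (@le_trans _ _ (k * (s - 0))); last by rewrite subr0 ler_piMr.
apply: (frob_mean_value s0 (fun u _ => D1 u)) => u /andP[u0 us].
by apply: ck; rewrite u0 (le_trans us).
Qed.

End geodesic_paths.

(** Monotonicity in [k] lets the maximum over a finite subcover serve everywhere. *)
Lemma compact_constant {R : realType} {m n : nat} (K : set 'M[R]_(m, n))
    (Q : 'M[R]_(m, n) -> R -> Prop) : compact K ->
  (forall x (k k' : R), k <= k' -> Q x k -> Q x k') ->
  (forall z, K z -> exists d k : R, 0 < d /\ forall x, frob (x - z) < d -> Q x k) ->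
  exists2 k : R, 0 < k & forall x, K x -> Q x k.
Proof.
move=> cK Qle loc.
have /choice[dk dkP] : forall z, exists dk : R * R, K z ->
    0 < dk.1 /\ forall x, frob (x - z) < dk.1 -> Q x dk.2.
  move=> z; have [Kz|nK] := pselect (K z); last by exists (0, 0).
  by have [d [k h]] := loc z Kz; exists (d, k).
have [|s sK cov] := @compact_frob_cover _ _ _ K (fun z => (dk z).1) cK.
  by move=> z /dkP[].
have [k k0 ks] : exists2 k : R, 0 < k & forall z, z \in s -> (dk z).2 <= k.
  elim: s {sK cov} => [|z s [k k0 ks]]; first by exists 1.
  exists (Num.max k (dk z).2); first by rewrite lt_max k0.
  move=> u; rewrite inE => /orP[/eqP ->|/ks h]; first by rewrite le_max lexx orbT.
  by rewrite le_max h.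
exists k => // x Kx; have [z zs xz] := cov x Kx.
have [_ h] := dkP z (sK z zs).
by apply: Qle (h x xz); exact: ks.
Qed.

Lemma acceleration_bound {R : realType} {m n d : nat} (M K : set 'M[R]_(m, n)) :
  embedded_submanifold d M -> compact K -> K `<=` M ->
  exists2 k : R, 0 < k & forall c s, geodesic M c -> K (c s) ->
    frob (derive1n 2 c s) <= k * frob (derive1 c 0) ^+ 2.
Proof.
move=> eM cK KM.
have [||k k0 kP] := @compact_constant _ _ _ K (fun x k => forall c s, geodesic M c ->
    c s = x -> frob (derive1n 2 c s) <= k * frob (derive1 c 0) ^+ 2) cK.
- move=> x k k' kk h c s gc cs; apply: le_trans (h c s gc cs) _.
  by rewrite ler_wpM2r// sqr_ge0.
- move=> z /KM Mz; have [r [C [phi [psi [S ch]]]]] := chart_exists eM Mz.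
  exists (r / C), (2 * C ^+ 3); split; first by rewrite divr_gt0 ?(chart_r ch) ?(chart_C0 ch).
  move=> x xz c s gc cs; apply: (geodesic_acceleration gc ch).
  by rewrite cs.
by exists k => // c s gc Kc; apply: (kP (c s)).
Qed.

(** * Natural gradient steps *)

Section natural_gradient.
Context {R : realType} {m n d q N : nat} {X : Type} {M : set 'M[R]_(m, n)}
  {E : 'M[R]_(m, n) -> 'M[R]_(m, n) -> 'M[R]_(m, n)}
  {nu : {measure set (labels R q) -> \bar R}}
  {p : labels R q -> 'cV[R]_q -> R} {f : X -> 'M[R]_(m, n) -> 'cV[R]_q}
  {x : 'I_N -> X} {y : 'I_N -> 'cV[R]_q} {H_L : 'cV[R]_q -> 'M[R]_q}
  {mu kL kH : R} {th0 : 'M[R]_(m, n)}.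
Hypothesis hM : embedded_submanifold d M.
Hypothesis hE : exponential_map M E.
Hypothesis hf : forall (i : 'I_N) (a : 'I_q), C1_on_manifold M (fun th => f (x i) th a 0).
Hypotheses (hmu : 0 < mu) (hkH : 0 < kH).
Hypothesis hL_smooth : forall i : 'I_N, smooth_on setT (fun z => loss p z (y i)).
Hypothesis hL_hess : forall (i : 'I_N) (z : 'cV[R]_q),
  loewner_le mu%:M (hessian (fun w => loss p w (y i)) z) /\
  loewner_le (hessian (fun w => loss p w (y i)) z) kL%:M.
Hypothesis hL_lip : forall (i : 'I_N) (z z' : 'cV[R]_q),
  frob (hessian (fun w => loss p w (y i)) z
        - hessian (fun w => loss p w (y i)) z') <= kH * frob (z - z').
Hypothesis hL_label : forall i : 'I_N, gradient (fun w => loss p w (y i)) (y i) = 0.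
Hypothesis hF : forall (i : 'I_N) (th : 'M[R]_(m, n)), M th ->
  [/\ fisher_defined nu p (f (x i) th),
      fisher nu p (f (x i) th) = H_L (f (x i) th) &
      forall j : 'I_N,
        hessian (fun w => loss p w (y j)) (f (x i) th) = H_L (f (x i) th)].
Hypothesis hth0 : M th0.

Local Notation J := (RJac M f x).
Local Notation res := (residual f x y).
Local Notation s0 := (sigma0 M f x th0).
Local Notation dir := (RNG_direction M p H_L f x y).
Local Notation e0 := (residual f x y th0).
(** [k] runs over stacked rows; [tagnat.sig1] and [tagnat.sig2] recover the sample and the output
    component. *)
Local Notation G k := (rgrad M (fun th' => f (x (tagnat.sig1 k)) th' (tagnat.sig2 k) 0)).

Hypothesis hs0 : 0 < s0.
Hypothesis hJ : forall th : 'M[R]_(m, n), M th ->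
  frob (th - th0) <= 4 * kL * (mu * s0)^-1 * e0 ->
  frob (J th - J th0) <= Num.min (1 / 2) (mu / (6 * kL)) * s0.

Lemma RJacE th k j : J th k j = vec (G k th) j 0.
Proof. by rewrite [LHS]mxE [LHS]mxE [LHS]mxE. Qed.

Lemma RJac_mul_vec th v k : (J th *m vec v) k 0 = mxdot (G k th) v.
Proof.
rewrite mxE -mxdot_vec /mxdot; apply: eq_bigr => j _.
by rewrite big_ord1 RJacE.
Qed.

Lemma rgradP k th : M th ->
  is_rgrad M (fun th' => f (x (tagnat.sig1 k)) th' (tagnat.sig2 k) 0) th (G k th).
Proof. by move=> Mth; exact: (hf _ _).1. Qed.

Lemma RJac_dist_le th th' : frob (J th - J th') <= \sum_k frob (G k th - G k th').
Proof.
apply: le_trans (frob_row_sum_le _) _; apply: ler_sum => k _.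
have -> : row k (J th - J th') = (vec (G k th - G k th'))^T.
  apply/rowP => j; rewrite vecB [LHS]mxE [LHS]mxE [X in _ + X]mxE !RJacE.
  by rewrite [RHS]mxE [RHS]mxE [X in _ = _ + X]mxE.
by rewrite frob_tr frob_vec.
Qed.

Lemma RJac_locally_continuous z (e : R) : M z -> 0 < e ->
  exists2 r : R, 0 < r & forall th th', frob (th - z) < r -> frob (th' - z) < r ->
    M th -> M th' -> frob (J th' - J th) <= e.
Proof.
move=> Mz e_gt0; pose K := (\sum_(i < N) q)%N.
pose a := e / 2 / K.+1%:R; have a0 : 0 < a by rewrite !divr_gt0.
have near_k k : \forall w \near z, M w -> frob (G k w - G k z) < a.
  have /subspace_continuousP/(_ z Mz) := (hf (tagnat.sig1 k) (tagnat.sig2 k)).2.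
  move=> h; have /h : nbhs (G k z) [set B | frob (B - G k z) < a].
    by apply/nbhs_frobP; exists a.
  by rewrite /nbhs/= /within/=.
have : \forall w \near z, forall k : 'I_K, M w -> frob (G k w - G k z) < a.
  exact: (filter_forall (nbhs_filter z) near_k).
move=> /nbhs_frobP[r r0 rP]; exists r => // th th' hr hr' Mth Mth'.
apply: le_trans (RJac_dist_le _ _) _.
apply: (@le_trans _ _ (\sum_(k < K) (a + a))).
  apply: ler_sum => k _; apply: le_trans (frob_dist_triangle (G k z) _ _) _.
  by apply: lerD; [|rewrite frob_distC]; apply: ltW; apply: rP.
have K1 : (0 : R) < K.+1%:R by rewrite ltr0n.
rewrite sumr_const card_ord -mulr_natr.
have -> : (a + a) * K%:R = e * (K%:R / K.+1%:R) by rewrite /a; field; rewrite gt_eqF.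
by rewrite ler_piMr ?(ltW e_gt0)// ler_pdivrMr// mul1r ler_nat.
Qed.

(** A Jacobian without rows would have [sigma0] equal to [0], the infimum of the empty set being
    [0]. So there are a sample and an output component, on which the two Loewner bounds can be
    compared. *)
Lemma sigma0_index : 'I_N * 'I_q.
Proof.
case: (pickP (fun k : 'I_(\sum_(i < N) q) => true)) => [k _|none].
  exact: (tagnat.sig1 k, tagnat.sig2 k).
exfalso; move: hs0; rewrite /sigma0 /lambda_min.
rewrite (_ : [set a | eigenvalue _ a] = set0) ?inf0 ?sqrtr0 ?ltxx//.
rewrite -subset0 => a /eigenvalueP[v _ /eqP]; apply.
by apply/rowP => k; have := none k.
Qed.

Lemma mu_le_kL : mu <= kL.
Proof.
have [i a] := sigma0_index; have [lo up] := hL_hess i 0.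
pose v : 'cV[R]_q := delta_mx a 0.
have v0 : 0 < frob v ^+ 2.
  rewrite exprn_gt0// lt_def frob_ge0 andbT; apply/eqP => /frob_eq0/matrixP/(_ a 0).
  by rewrite !mxE !eqxx => /eqP; rewrite oner_eq0.
by rewrite -(ler_pM2r v0); exact: le_trans (loewner_lower v lo) (loewner_upper v up).
Qed.

Lemma sigma0_lower (v : 'cV[R]_(\sum_(i < N) q)) : s0 * frob v <= frob ((J th0)^T *m v).
Proof.
rewrite -(@ler_pXn2r _ 2%N)// ?nnegrE ?frob_ge0 ?mulr_ge0 ?frob_ge0 ?(ltW hs0)//.
rewrite exprMn sqr_sqrtr; first exact: lambda_min_le.
by apply: ltW; rewrite -sqrtr_gt0.
Qed.

Lemma residual_sqr th : res th ^+ 2 = \sum_(i < N) frob (f (x i) th - y i) ^+ 2.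
Proof.
rewrite /residual /outputs -mxcolB sqr_frob mxdot_mxcol.
by apply: eq_bigr => i _; rewrite sqr_frob.
Qed.

(** Through the Fisher identity this gives the symmetry of the Hessian of the loss at the
    outputs. *)
Lemma fisher_sym z : (fisher nu p z)^T = fisher nu p z.
Proof.
apply/matrixP => a b; rewrite !mxE; congr Rintegral; apply/funext => w.
rewrite /fisher_entry; congr (_ * _); rewrite !mxE.
by apply: eq_bigr => j _; rewrite mulrC [X in X * _]mxE [X in _ = _ * X]mxE.
Qed.

(** A blockwise expansion between the output and the label, where the gradient vanishes. The block
    errors are quadratic and recombine because a sum of squares is at most the square of the sum. *)
Lemma grad_loss_linearization th : M th ->
  frob (grad_loss p f x y th - \mxdiag_(i < N) H_L (f (x i) th) *m
    (outputs f x th - \mxcol_(i < N) y i)) <= kH * res th ^+ 2.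
Proof.
move=> Mth; rewrite /grad_loss /outputs -mxcolB mul_mxdiag_mxcol -mxcolB.
have kr : 0 <= kH * res th ^+ 2 by apply: mulr_ge0; [exact: ltW|exact: sqr_ge0].
rewrite -(@ler_pXn2r _ 2%N)// ?nnegrE ?frob_ge0//.
rewrite sqr_frob mxdot_mxcol residual_sqr mulr_sumr.
apply: le_trans (sum_sqr_le_sqr_sum _ _); last first.
  by move=> i; rewrite mulr_ge0 ?sqr_ge0 ?(ltW hkH).
apply: ler_sum => i _; rewrite -sqr_frob ler_pXn2r ?nnegrE ?frob_ge0//; last first.
  by rewrite mulr_ge0 ?sqr_ge0 ?(ltW hkH).
have [_ fE hE'] := hF i Mth.
have := @gradient_taylor _ _ (fun w => loss p w (y i)) (y i) (f (x i) th) kH (hL_smooth i).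
rewrite hL_label subr0 !hE'; apply; first by rewrite -fE fisher_sym.
by move=> w; rewrite -(hE' i); exact: hL_lip.
Qed.

Lemma RNG_directionP th : M th -> frob (J th - J th0) <= s0 / 6 ->
  exists z, [/\ dir th = unvec ((J th)^T *m z),
    frob (J th *m vec (dir th) - (outputs f x th - \mxcol_(i < N) y i))
      <= kH * res th ^+ 2 / mu &
    frob (dir th) <= 6 / 5 / s0 * frob (J th *m vec (dir th))].
Proof.
move=> Mth JJ0.
have coer (v : 'cV[R]_(\sum_(i < N) q)) :
    mu * frob v ^+ 2 <= mxdot v (\mxdiag_(i < N) H_L (f (x i) th) *m v).
  rewrite -[v]submxcolK mul_mxdiag_mxcol mxdot_mxcol sqr_frob mxdot_mxcol mulr_sumr.
  apply: ler_sum => i _; rewrite -sqr_frob.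
  have [_ _ /(_ i) <-] := hF i Mth; exact: loewner_lower (hL_hess i _).1.
have [z [zE z1 z2]] :=
  pinv_direction hmu hs0 coer sigma0_lower JJ0 (grad_loss_linearization Mth).
have dE : dir th = unvec ((J th)^T *m z) by rewrite -zE.
by exists z; rewrite dE unvecK -(frob_vec (unvec _)) unvecK.
Qed.

(** The columns of the transposed Jacobian are gradients, hence tangent. *)
Lemma tangent_unvec th z : M th -> tangent M th (unvec ((J th)^T *m z)).
Proof.
move=> Mth; have -> : unvec ((J th)^T *m z) = \sum_k z k 0 *: G k th.
  rewrite -[RHS]vecK; congr unvec.
  have -> : vec (\sum_k z k 0 *: G k th) = \sum_k z k 0 *: vec (G k th).
    by rewrite /vec !linear_sum/=; apply: eq_bigr => k _; rewrite !linearZ.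
  apply/colP => j; rewrite summxE mxE; apply: eq_bigr => k _.
  by rewrite [in LHS]mxE RJacE [RHS]mxE mulrC.
apply: (tangent_sum hM) => // k; apply: (tangentZ hM) => //.
exact: (rgradP k Mth).1.
Qed.

Lemma is_derive_outputs c s : geodesic M c ->
  is_derive s (1 : R) (fun u => outputs f x (c u)) (J (c s) *m vec (derive1 c s)).
Proof.
move=> gc; apply/is_derive_mxP => k j; rewrite ord1 RJac_mul_vec.
have -> : (fun u => outputs f x (c u) k 0) =
    (fun th' => f (x (tagnat.sig1 k)) th' (tagnat.sig2 k) 0) \o c.
  by apply/funext => u; rewrite mxE.
exact: (geodesic_derive_function gc (rgradP k (geodesic_M gc s))).
Qed.

(** To first order the output moves by [- t J d]. Replacing [J d] by the error costs [t * a], and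
    [B] bounds the departure from first order. *)
Lemma residual_geodesic c (t a B : R) : geodesic M c -> 0 <= t <= 1 ->
  derive1 c 0 = - (t *: dir (c 0)) ->
  frob (J (c 0) *m vec (dir (c 0)) - (outputs f x (c 0) - \mxcol_(i < N) y i)) <= a ->
  (forall s, 0 <= s <= 1 ->
    frob (J (c s) *m vec (derive1 c s) - J (c 0) *m vec (derive1 c 0)) <= B) ->
  res (c 1) <= (1 - t) * res (c 0) + t * a + B.
Proof.
move=> gc /andP[t0 t1] c0 ha hB.
set r := J (c 0) *m vec (dir (c 0)) in ha; set w := J (c 0) *m vec (derive1 c 0) in hB.
have wE : w = - (t *: r) by rewrite /w c0 vecN vecZ mulmxN -scalemxAr.
pose g (s : R) := outputs f x (c s) - (0 + s *: w).
have gD s : is_derive s (1 : R) g (J (c s) *m vec (derive1 c s) - w).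
  exact: (is_deriveB (is_derive_outputs s gc) (is_derive_line 0 w s)).
have h : frob (g 1 - g 0) <= B.
  rewrite -[leRHS]mulr1 -[X in _ * X]subr0.
  by apply: (frob_mean_value ler01 (fun s _ => gD s)) => s; exact: hB.
have key (o1 o0 z u : 'cV[R]_(\sum_(i < N) q)) : o1 - z = (1 - t) *: (o0 - z) -
    t *: (u - (o0 - z)) + (o1 - (0 + 1 *: - (t *: u)) - (o0 - (0 + 0 *: - (t *: u)))).
  by apply/matrixP => i j; rewrite !mxE; ring.
rewrite /residual; set e := outputs f x (c 0) - _ in ha *.
have -> : outputs f x (c 1) - \mxcol_(i < N) y i =
    (1 - t) *: e - t *: (r - e) + (g 1 - g 0).
  rewrite /g wE /e; exact: key.
apply: le_trans (frobD _ _) (lerD _ h).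
apply: le_trans (frobB _ _) _; rewrite !frobZ !ger0_norm ?subr_ge0//.
by rewrite lerD2l ler_wpM2l.
Qed.

Lemma RJac_geodesic_variation c (k : R) s : geodesic M c -> 0 <= s <= 1 ->
  (forall u, 0 <= u <= 1 -> frob (derive1n 2 c u) <= k) ->
  frob (J (c s) *m vec (derive1 c s) - J (c 0) *m vec (derive1 c 0)) <=
  frob (J (c s) - J (c 0)) * frob (derive1 c 0) + frob (J (c 0)) * k.
Proof.
move=> gc s01 ck.
have -> : J (c s) *m vec (derive1 c s) - J (c 0) *m vec (derive1 c 0) =
    (J (c s) - J (c 0)) *m vec (derive1 c s) + J (c 0) *m vec (derive1 c s - derive1 c 0).
  by rewrite vecB mulmxBr mulmxBl addrA subrK.
apply: le_trans (frobD _ _) _; apply: lerD; apply: le_trans (frob_mulmx _ _) _.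
  by rewrite frob_vec (geodesic_speed gc).
rewrite frob_vec ler_wpM2l ?frob_ge0//.
exact: (geodesic_derive_lipschitz gc s01 ck).
Qed.

(* The whole iteration stays in this set: each step has length at most
   8 / (5 s0) t times the residual, and the residual drops by t / 2 of itself. *)
Local Notation rad := (16 / 5 / s0 * e0).
Local Notation K := (adherent (reach M th0 rad)).

Lemma rad_ge0 : 0 <= rad.
Proof. by rewrite mulr_ge0 ?frob_ge0// divr_ge0 ?(ltW hs0)//; lra. Qed.

Lemma reach_adherent z : reach M th0 rad z -> K z.
Proof. by move=> rz e e_gt0; exists z; rewrite // subrr frob0 ltW. Qed.

(** Both bounds rest on [mu <= kL]: it gives [16 / 5 <= 4 * kL / mu] for the radius and
    [mu / (6 * kL) <= 1 / 6] for the perturbation. *)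
Lemma reach_RJac z : reach M th0 rad z -> frob (J z - J th0) <= s0 / 6.
Proof.
move=> rz; have kL0 : 0 < kL by exact: lt_le_trans hmu mu_le_kL.
apply: le_trans (hJ (reach_M rad_ge0 rz) _) _.
  apply: le_trans (reach_dist rad_ge0 rz) _; rewrite ler_wpM2r ?frob_ge0//.
  rewrite invfM [leRHS]mulrA ler_wpM2r ?invr_ge0 ?(ltW hs0)//.
  rewrite ler_pdivlMr//; have := mu_le_kL; have := hmu; lra.
rewrite [leRHS]mulrC ler_wpM2r ?(ltW hs0)// ge_min; apply/orP; right.
rewrite ler_pdivrMr; last by rewrite mulr_gt0.
by rewrite mulrA mulVf ?mul1r ?mu_le_kL.
Qed.

Lemma reach_RJac_bound z : reach M th0 rad z -> frob (J z) <= frob (J th0) + s0.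
Proof.
move=> rz; apply: le_trans (frob_le_distD _ (J th0)) _; rewrite lerD2l.
by apply: le_trans (reach_RJac rz) _; have := hs0; lra.
Qed.

Lemma acceleration_on_reach : exists2 k : R, 0 < k & forall c, geodesic M c ->
  (forall s, 0 <= s <= 1 -> reach M th0 rad (c s)) ->
  forall s, 0 <= s <= 1 -> frob (derive1n 2 c s) <= k * frob (derive1 c 0) ^+ 2.
Proof.
have [k k0 kP] := acceleration_bound hM (reach_adherent_compact rad_ge0)
  (hopf_rinow hM hE hth0 rad_ge0).
exists k => // c gc rc s s01; apply: kP => //.
by apply: reach_adherent; exact: rc.
Qed.

(** Uniform continuity on the compact set changes the Jacobian by at most [e / 2] along a short
    geodesic; the acceleration term is quadratic in the speed, hence at most [e / 2] times the speed
    once the speed is small. *)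
Lemma small_variation (e : R) : 0 < e -> exists2 r : R, 0 < r & forall c, geodesic M c ->
  (forall s, 0 <= s <= 1 -> reach M th0 rad (c s)) -> frob (derive1 c 0) <= r ->
  forall s, 0 <= s <= 1 ->
    frob (J (c s) *m vec (derive1 c s) - J (c 0) *m vec (derive1 c 0)) <=
    e * frob (derive1 c 0).
Proof.
move=> e_gt0; have [k k0 kP] := acceleration_on_reach.
have [|r r0 rP] := @compact_uniform _ _ _ K
  (fun th th' => M th -> M th' -> frob (J th' - J th) <= e / 2)
  (reach_adherent_compact rad_ge0).
  move=> z /(hopf_rinow hM hE hth0 rad_ge0) Mz.
  by apply: (RJac_locally_continuous Mz); rewrite divr_gt0.
pose b := frob (J th0) + s0; have b0 : 0 < b by rewrite ltr_wpDl ?frob_ge0.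
have bk0 : 0 < b * k by rewrite mulr_gt0.
exists (Num.min (r / 2) (e / 2 / (b * k))).
  by rewrite lt_min !divr_gt0.
move=> c gc rc; rewrite le_min => /andP[vr ve] s s01.
apply: le_trans (RJac_geodesic_variation gc s01 (kP c gc rc)) _.
have M_ u := geodesic_M gc u.
have I0 : 0 <= (0 : R) <= 1 by rewrite lexx ler01.
have h1 : frob (J (c s) - J (c 0)) <= e / 2.
  apply: rP => //; first by apply: reach_adherent; exact: rc.
  apply: le_lt_trans (geodesic_lipschitz gc _ _) _; rewrite subr0.
  have /andP[s_ge0 s_le1] := s01; rewrite ger0_norm//.
  apply: (@le_lt_trans _ _ (frob (derive1 c 0))); first by rewrite ler_piMr ?frob_ge0.
  by apply: le_lt_trans vr _; rewrite ltr_pdivrMr// ltr_pMr// ltr1n.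
have h2 : frob (J (c 0)) <= b by apply: reach_RJac_bound; exact: rc.
rewrite {1}[e]splitr [leRHS]mulrDl; apply: lerD; first by rewrite ler_wpM2r ?frob_ge0.
rewrite expr2 2!mulrA ler_wpM2r ?frob_ge0//.
move: ve; rewrite ler_pdivlMr// => ve; apply: le_trans ve.
by rewrite mulrC ler_wpM2l ?frob_ge0// ler_wpM2r ?(ltW k0).
Qed.

(** * The iteration for a small initial residual *)

Section small_residual.
Hypothesis he0 : e0 < mu / (3 * kH).

Lemma quadratic_term_le th : res th <= e0 -> kH * res th ^+ 2 / mu <= res th / 3.
Proof.
move=> re; rewrite ler_pdivrMr//.
have : res th <= mu / (3 * kH) by exact: le_trans re (ltW he0).
rewrite ler_pdivlMr ?mulr_gt0// => h.
have r0 : 0 <= res th / 3 by rewrite divr_ge0 ?frob_ge0.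
by have := ler_wpM2l r0 h; move: (res th) => a; lra.
Qed.

(** The length spent so far is charged to the decrease of the residual. This telescopes, so no
    geometric series has to be summed. *)
Definition invariant th := res th <= e0 /\ reach M th0 (16 / 5 / s0 * (e0 - res th)) th.

Lemma invariant_reach th : invariant th -> reach M th0 rad th.
Proof.
move=> [re rt]; have h : 0 <= 16 / 5 / s0 by rewrite divr_ge0 ?(ltW hs0)//; lra.
apply: reach_le rt.
  by rewrite mulr_ge0// subr_ge0.
by rewrite ler_wpM2l// gerBl frob_ge0.
Qed.

(** The contraction is a premise of the invariant at [c 1] because it is reached in two ways: from
    short steps in the linear rate, and from the linear rate itself in the quadratic one. *)
Lemma natural_gradient_step th (t : R) : invariant th -> 0 < t -> t <= 1 ->
  exists c, [/\ geodesic M c, c 0 = th, c 1 = E th (- (t *: dir th)) &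
    frob (derive1 c 0) <= 8 / 5 / s0 * (t * res th)] /\
  [/\ forall s, 0 <= s <= 1 -> reach M th0 rad (c s),
      res (c 1) <= (1 - t / 2) * res th -> invariant (c 1) &
      forall B : R, (forall s, 0 <= s <= 1 ->
        frob (J (c s) *m vec (derive1 c s) - J (c 0) *m vec (derive1 c 0)) <= B) ->
      res (c 1) <= (1 - t) * res th + t * (kH * res th ^+ 2 / mu) + B].
Proof.
move=> ith t0 t1; have [re rt] := ith; have rth := invariant_reach ith.
have Mth := reach_M rad_ge0 rth.
have [z [zE z1 z2]] := RNG_directionP Mth (reach_RJac rth).
have Tv : tangent M th (- (t *: dir th)).
  rewrite -scaleNr; apply: (tangentZ hM) => //.
  by rewrite zE; exact: tangent_unvec.
have [c [gc c0 c'0 c1]] := hE Mth Tv.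
have r0 : 0 <= res th by exact: frob_ge0.
have i0 : 0 < s0^-1 by rewrite invr_gt0.
have dle : frob (dir th) <= 8 / 5 / s0 * res th.
  apply: le_trans z2 _.
  have h1 : frob (J th *m vec (dir th)) <= 4 / 3 * res th.
    apply: le_trans (frob_le_distD _ (outputs f x th - \mxcol_(i < N) y i)) _.
    have := le_trans z1 (quadratic_term_le re); rewrite -/(res th).
    by move: (frob (_ - _)) (res th) => a b; lra.
  apply: le_trans (ler_wpM2l _ h1) _; first by rewrite mulr_ge0 ?(ltW i0)//; lra.
  by move: (s0^-1) (res th) => a b; lra.
have vle : frob (derive1 c 0) <= 8 / 5 / s0 * (t * res th).
  rewrite c'0 frobN frobZ gtr0_norm// [leRHS]mulrCA; exact: (ler_wpM2l (ltW t0) dle).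
have v0 := frob_ge0 (derive1 c 0).
have c5 : 0 <= 8 / 5 / s0 by rewrite mulr_ge0 ?(ltW i0)//; lra.
have c16 : 16 / 5 / s0 = 2 * (8 / 5 / s0) by move: (s0^-1) => a; lra.
have rr0 : 0 <= 16 / 5 / s0 * (e0 - res th).
  by rewrite mulr_ge0 ?subr_ge0// c16 mulr_ge0.
have tr : t * res th <= res th by rewrite ler_piMl.
have tr0 : 0 <= t * res th by rewrite mulr_ge0// ltW.
have reachs s (b : R) : 0 <= s <= 1 -> 8 / 5 / s0 * (t * res th) <= b ->
    reach M th0 (16 / 5 / s0 * (e0 - res th) + b) (c s).
  move=> /andP[s_ge0 s_le1] hb.
  have hs : 0 <= frob (derive1 c 0) * s by exact: mulr_ge0.
  have := geodesic_reach gc s_ge0; rewrite c0 => g.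
  apply: reach_le (reach_cat rr0 hs rt g); first exact: addr_ge0.
  rewrite lerD2l; apply: le_trans hb; apply: le_trans vle; exact: ler_piMr.
exists c; split; first by split.
split.
- move=> s s01; have := reachs s (16 / 5 / s0 * res th) s01.
  rewrite -mulrDr subrK; apply; rewrite c16.
  have := mulr_ge0 c5 r0; have := ler_wpM2l c5 tr.
  by move: (8 / 5 / s0) (t * res th) (res th) => a b r'; lra.
- move=> h; have h' : res (c 1) <= res th - t * res th / 2.
    by apply: le_trans h _; rewrite mulrBl mul1r [X in _ - X]mulrAC.
  split; first by move: h' tr0 re; move: (res (c 1)) (t * res th) => a b; lra.
  have := reachs 1 (16 / 5 / s0 * (t * res th / 2)); rewrite -mulrDr => g.
  have I1 : 0 <= (1 : R) <= 1 by rewrite ler01 lexx.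
  have {}g := g I1; apply: reach_le (g _).
  + rewrite c16; apply: mulr_ge0; first exact: mulr_ge0.
    by rewrite addr_ge0 ?subr_ge0// divr_ge0.
  + rewrite c16; apply: ler_wpM2l; first exact: mulr_ge0.
    by move: h'; move: (res (c 1)) (t * res th) => a b; lra.
  + by rewrite c16; move: (8 / 5 / s0) (t * res th) => a b; lra.
have t01 : 0 <= t <= 1 by rewrite (ltW t0).
have h (a B : R) := @residual_geodesic c t a B gc t01.
by rewrite c0 in h * => B hB; exact: (h _ _ c'0 z1 hB).
Qed.

End small_residual.

Lemma invariant0 : invariant th0.
Proof. by split; [exact: lexx|rewrite subrr mulr0; exact: reach_refl]. Qed.

(* step_bound is a fixed number divided by kR, so a large kR makes the geodesic
   steps as short as needed. *)
Lemma exists_linear_rate :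
  exists2 kR : R, 0 < kR & linear_rate M E p H_L f x y mu kL kH th0 kR.
Proof.
(* [5 / 48] times the speed factor [8 / 5] is [1 / 6], the share of the decrease left to the
   variation. *)
have e48 : 0 < s0 * (5 / 48) by rewrite mulr_gt0//; lra.
have [r r0 rP] := small_variation e48.
pose A := (1 / (6 * e0) - kH / (2 * mu)) * ((3 * mu ^+ 2 * s0) / (8 * kL ^+ 2)).
have i0 : 0 < s0^-1 by rewrite invr_gt0.
have c5 : 0 < 8 / 5 / s0 by rewrite mulr_gt0//; lra.
have ge0 : 0 <= e0 by exact: frob_ge0.
(* Chosen so that [t * k <= |A|], which follows from the step bound, amounts to a first speed bound
   of at most [r]. *)
pose k := `|A| * (8 / 5 / s0 * e0) / r.
have k0 : 0 <= k.
  apply: divr_ge0 (ltW r0); apply: mulr_ge0; first exact: normr_ge0.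
  by apply: mulr_ge0 => //; exact: ltW.
have kp : 0 < 1 + k by rewrite ltr_wpDr.
exists (1 + k) => // he0 t th t0 tb [thE thS].
have t1 : t <= 1.
  by move: tb; rewrite /step_bound; case: ifP => // _; rewrite le_min => /andP[].
have tr : 8 / 5 / s0 * (t * e0) <= r.
  (* For [e0 = 0] the step bound reads [1] and does not involve [k]; the claim is then trivial. *)
  have [ez|ez] := eqVneq e0 0; first by rewrite ez !mulr0 ltW.
  move: tb; rewrite /step_bound (negbTE ez) le_min => /andP[_ tb].
  have tA : t * (1 + k) <= `|A|.
    rewrite -ler_pdivlMr//; apply: le_trans tb _.
    rewrite (_ : _ * _ = A / (1 + k)); last first.
      rewrite /A (_ : 8 * (1 + k) * kL ^+ 2 = 8 * kL ^+ 2 * (1 + k)); last by ring.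
      by rewrite (invfM (8 * kL ^+ 2)) !mulrA.
    by rewrite ler_wpM2r ?ler_norm// invr_ge0 ltW.
  have A0 : 0 < `|A| by apply: lt_le_trans tA; exact: mulr_gt0.
  have : t * k <= `|A|.
    by apply: le_trans tA; rewrite mulrDr mulr1 lerDr ltW.
  rewrite /k mulrA ler_pdivrMr// mulrCA ler_pM2l// => h.
  by rewrite mulrCA.
have step j : invariant (th j) ->
    res (th j.+1) <= (1 - t / 2) * res (th j) /\ invariant (th j.+1).
  move=> ij; have [c [[gc c0 c1 cv] [rc ic Bc]]] := natural_gradient_step he0 ij t0 t1.
  rewrite thS -c1.
  suff h : res (c 1) <= (1 - t / 2) * res (th j) by split; [exact: h|exact: ic].
  have vr : frob (derive1 c 0) <= r.
    apply: le_trans cv _; apply: le_trans tr.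
    apply: ler_wpM2l; first exact: ltW.
    apply: ler_wpM2l; first exact: ltW.
    exact: ij.1.
  apply: le_trans (Bc _ (rP c gc rc vr)) _.
  have h1 : t * (kH * res (th j) ^+ 2 / mu) <= t * (res (th j) / 3).
    by apply: ler_wpM2l (quadratic_term_le he0 ij.1); exact: ltW.
  have h2 : s0 * (5 / 48) * frob (derive1 c 0) <= t * res (th j) / 6.
    apply: le_trans (ler_wpM2l (ltW e48) cv) _.
    rewrite (_ : s0 * (5 / 48) * (8 / 5 / s0 * (t * res (th j))) = t * res (th j) / 6)//.
    by field; rewrite gt_eqF.
  have key (a b z : R) : t * a <= t * (z / 3) -> b <= t * z / 6 ->
      (1 - t) * z + t * a + b <= (1 - t / 2) * z by move=> *; lra.
  exact: key h1 h2.
have inv j : invariant (th j).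
  elim: j => [|j /step[]//]; rewrite thE; exact: invariant0.
by move=> j; have [] := step j (inv j).
Qed.

(** For [t = 1] the term [(1 - t) * res] disappears, and the Lipschitz bound on [J] makes the
    variation along the geodesic quadratic in the speed. The linear rate keeps the iterates in the
    compact set where the acceleration bound holds. *)
Lemma quadratic_rate (kR kJ : R) :
  linear_rate M E p H_L f x y mu kL kH th0 kR -> e0 < mu / (3 * kH) ->
  1 <= step_bound mu kL kH kR s0 e0 ->
  (forall th th', M th -> M th' -> frob (J th - J th') <= kJ * frob (th - th')) ->
  exists2 kq : R, 0 < kq & forall th : nat -> 'M[R]_(m, n),
    RNG_iterates M E p H_L f x y 1 th0 th ->
    forall j, res (th j.+1) <= kq * res (th j) ^+ 2.
Proof.
move=> lr he0 sb lip; have [k k0 kP] := acceleration_on_reach.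
pose b := frob (J th0) + s0; have b0 : 0 < b by rewrite ltr_wpDl ?frob_ge0.
pose C := `|kJ| + b * k; pose c5 := 8 / 5 / s0.
have C0 : 0 <= C.
  by apply: addr_ge0; [exact: normr_ge0|apply: mulr_ge0; exact: ltW].
exists (kH / mu + C * c5 ^+ 2).
  apply: ltr_wpDr; last exact: divr_gt0.
  by apply: mulr_ge0 => //; exact: sqr_ge0.
move=> th it; have rate := lr he0 1 th ltr01 sb it; have [thE thS] := it.
have inv j : invariant (th j).
  elim: j => [|j ij]; first by rewrite thE; exact: invariant0.
  have [c [[_ _ c1 _] [_ ic _]]] := natural_gradient_step he0 ij ltr01 (lexx 1).
  by have := rate j; rewrite thS -c1; exact: ic.
move=> j.
have [c [[gc c0 c1 cv] [rc _ Bc]]] := natural_gradient_step he0 (inv j) ltr01 (lexx 1).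
rewrite thS -c1; set v := frob (derive1 c 0) in cv.
have v0 : 0 <= v by exact: frob_ge0.
have I0 : 0 <= (0 : R) <= 1 by rewrite lexx ler01.
have hB s : 0 <= s <= 1 ->
    frob (J (c s) *m vec (derive1 c s) - J (c 0) *m vec (derive1 c 0)) <= C * v ^+ 2.
  move=> s01; apply: le_trans (RJac_geodesic_variation gc s01 (kP c gc rc)) _.
  rewrite -/v /C mulrDl; apply: lerD.
    rewrite expr2 mulrA; apply: ler_wpM2r => //.
    apply: le_trans (lip _ _ (geodesic_M gc _) (geodesic_M gc _)) _.
    apply: (@le_trans _ _ (`|kJ| * frob (c s - c 0))).
      by apply: ler_wpM2r; [exact: frob_ge0|exact: ler_norm].
    apply: ler_wpM2l; first exact: normr_ge0.
    apply: le_trans (geodesic_lipschitz gc _ _) _; rewrite subr0.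
    by have /andP[s_ge0 s_le1] := s01; rewrite ger0_norm// ler_piMr.
  rewrite mulrA; apply: ler_wpM2r; first exact: sqr_ge0.
  apply: ler_wpM2r; first exact: ltW.
  by apply: reach_RJac_bound; exact: rc.
apply: le_trans (Bc _ hB) _; rewrite subrr mul0r add0r mul1r [leRHS]mulrDl.
apply: lerD; first by rewrite mulrAC.
rewrite -mulrA; apply: ler_wpM2l => //; rewrite -exprMn mul1r in cv *.
rewrite ler_pXn2r ?nnegrE//.
exact: le_trans cv.
Qed.

End natural_gradient.

Theorem theorem5p9 (R : realType) (m n d q N : nat) (X : Type)
    (M : set 'M[R]_(m, n))
    (E : 'M[R]_(m, n) -> 'M[R]_(m, n) -> 'M[R]_(m, n))
    (nu : {measure set (labels R q) -> \bar R})
    (p : labels R q -> 'cV[R]_q -> R)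
    (f : X -> 'M[R]_(m, n) -> 'cV[R]_q)
    (x : 'I_N -> X) (y : 'I_N -> 'cV[R]_q)
    (H_L : 'cV[R]_q -> 'M[R]_q)
    (mu kL kH : R) (th0 : 'M[R]_(m, n))
    (hM : embedded_submanifold d M)
    (hE : exponential_map M E)
    (hf : forall (i : 'I_N) (a : 'I_q),
        C1_on_manifold M (fun th => f (x i) th a 0))
    (hp : conditional_density nu p)
    (hp_pos : forall (i : 'I_N) (z : 'cV[R]_q), 0 < p (y i) z)
    (hmu : 0 < mu) (hkH : 0 < kH)
    (hL_smooth : forall i : 'I_N, smooth_on setT (fun z => loss p z (y i)))
    (hL_hess : forall (i : 'I_N) (z : 'cV[R]_q),
        loewner_le mu%:M (hessian (fun w => loss p w (y i)) z) /\
        loewner_le (hessian (fun w => loss p w (y i)) z) kL%:M)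
    (hL_lip : forall (i : 'I_N) (z z' : 'cV[R]_q),
        frob (hessian (fun w => loss p w (y i)) z
              - hessian (fun w => loss p w (y i)) z') <= kH * frob (z - z'))
    (hL_label : forall i : 'I_N, gradient (fun w => loss p w (y i)) (y i) = 0)
    (hF : forall (i : 'I_N) (th : 'M[R]_(m, n)), M th ->
        [/\ fisher_defined nu p (f (x i) th),
            fisher nu p (f (x i) th) = H_L (f (x i) th) &
            forall j : 'I_N,
              hessian (fun w => loss p w (y j)) (f (x i) th)
              = H_L (f (x i) th)])
    (hth0 : M th0)
    (hs0 : 0 < sigma0 M f x th0)
    (hJ : forall th : 'M[R]_(m, n), M th ->
        frob (th - th0)
          <= 4 * kL * (mu * sigma0 M f x th0)^-1 * residual f x y th0 ->
        frob (RJac M f x th - RJac M f x th0)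
          <= Num.min (1 / 2) (mu / (6 * kL)) * sigma0 M f x th0) :
  (exists2 kR : R, 0 < kR & linear_rate M E p H_L f x y mu kL kH th0 kR)
  /\
  (forall kR kJ : R, 0 < kR ->
     linear_rate M E p H_L f x y mu kL kH th0 kR ->
     residual f x y th0 < mu / (3 * kH) ->
     1 <= step_bound mu kL kH kR (sigma0 M f x th0) (residual f x y th0) ->
     (forall th th' : 'M[R]_(m, n), M th -> M th' ->
        frob (RJac M f x th - RJac M f x th') <= kJ * frob (th - th')) ->
     exists2 kq : R, 0 < kq &
       forall th : nat -> 'M[R]_(m, n),
         RNG_iterates M E p H_L f x y 1 th0 th ->
         forall k : nat,
           residual f x y (th k.+1) <= kq * residual f x y (th k) ^+ 2).
Proof.
split; first exact: (exists_linear_rate hM hE hf hmu hkH hL_smooth hL_hess hL_lip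
  hL_label hF hth0 hs0 hJ).
move=> kR kJ _; exact: (quadratic_rate hM hE hf hmu hkH hL_smooth hL_hess hL_lip
  hL_label hF hth0 hs0 hJ).
Qed.
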